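(* Let $1\le k\le n-1$ and let $\sigma\in\mathcal E^k[k+1]$ be a weighted $k$-form. (1) For each $l$ with $1\le l\le k-1$: $\sigma$ is a conformal Killing $k$-form if and only if $\nabla^x_{\{c}\overline\sigma_{\mathbf a^{k-l}\}_0\mathbf B^l}=0$, where $x=\frac{2}{n-k}$. (2) For each $l$ with $1\le l\le n-k-1$: $\sigma$ is a conformal Killing $k$-form if and only if $\nabla^y_{\{c}\underline\sigma_{\mathbf a^{k+l}\}_0\mathbf B^l}=0$, where $y=\frac2k$.
   Context: Setting. $M$ is a smooth $n$-manifold, $n\ge3$, with a conformal structure $[g]$ (any signature); all objects are smooth. $\mathcal E[w]$: conformal densities of weight $w$ (a choice $g\in[g]$ trivialises $\mathcal E[w]$; under $\hat g=e^{2\Upsilon}g$ the representing function $f$ becomes $e^{w\Upsilon}f$); $[w]$ after a bundle means tensoring with it. One symbol is used for a bundle and its sections. $\mathbf g_{ab}$ is the conformal metric (tautological section of $S^2T^*M[2]$), used to raise, lower and contract abstract indices. $\nabla$ is the Levi-Civita connection of a chosen $g\in[g]$, acting also on densities via the trivialisation; $\Upsilon_a=\nabla_a\Upsilon$. Curvature. $[\nabla_a,\nabla_b]v^c=R_{ab}{}^c{}_dv^d$, $R_{abcd}=C_{abcd}+2\mathbf g_{c[a}P_{b]d}+2\mathbf g_{d[b}P_{a]c}$ with $C$ the trace-free Weyl tensor and $P$ the symmetric Schouten tensor; $A_{abc}=2\nabla_{[b}P_{c]a}$. Form indices. $\mathcal E^k=\mathcal E_{\mathbf a^k}$ is the bundle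 of $k$-forms. Indices with sequential superscripts at the same level are implicitly skew-symmetrised (projection, weight one), also when distributed over several factors: $\mathbf a^k=a^1\cdots a^k$; $\mathbf b^l=b^1\cdots b^l$, $\dot{\mathbf b}^l=b^2\cdots b^l$; also $\mathbf a^{k,l}=a^{k+1}\cdots a^{k+l}$, $\dot{\mathbf a}^{k,l}=a^{k+2}\cdots a^{k+l}$. $\mathbf g_{\mathbf b^l\mathbf a^{k,l}}=\mathbf g_{b^1a^{k+1}}\cdots\mathbf g_{b^la^{k+l}}$, $\mathbf g_{\dot{\mathbf b}^l\dot{\mathbf a}^{k,l}}=\mathbf g_{b^2a^{k+2}}\cdots\mathbf g_{b^la^{k+l}}$. Conformal Killing forms. $\mathcal E(1,m)=\{f_{c\mathbf a^m}: f_{c\mathbf a^m}=f_{c[\mathbf a^m]},\ f_{[c\mathbf a^m]}=0\}$, $\mathcal E(1,m)_0$ its trace-free part; $S_{\{c\mathbf a^m\}_0}$ is the projection of $S_{c\mathbf a^m}$ to $\mathcal E(1,m)_0[w]$ in $T^*M\otimes\Lambda^mT^*M[w]\cong\Lambda^{m+1}[w]\oplus\mathcal E(1,m)_0[w]\oplus\Lambda^{m-1}[w-2]$; for tractor-valued tensors it acts on tensor indices only. $\sigma\in\mathcal E^k[k+1]$ is a conformal Killing $k$-form if $\nabla_{\{c}\sigma_{\mathbf a^k\}_0}=0$. Tractors. For each $g\in[g]$ the standard tractor bundle is $[\mathcal E^A]_g=\mathcal E[1]\oplus\mathcal E_a[1]\oplus\mathcal E[-1]$, with $(\alpha,\mu_a,\tau)_g$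 identified with $(\alpha,\ \mu_a+\Upsilon_a\alpha,\ \tau-\Upsilon^b\mu_b-\tfrac12\Upsilon^b\Upsilon_b\alpha)_{\hat g}$. The tractor metric (quadratic form $2\alpha\tau+\mu^a\mu_a$) raises and lowers tractor indices. Normal tractor connection: $\nabla_a(\alpha,\mu_b,\tau)=(\nabla_a\alpha-\mu_a,\ \nabla_a\mu_b+\mathbf g_{ab}\tau+P_{ab}\alpha,\ \nabla_a\tau-P_{ab}\mu^b)$; $\nabla$ also denotes its coupling with the Levi-Civita connection. Writing $V_A=Y_A\alpha+Z_A{}^a\mu_a+X_A\tau$ defines $Y_A,Z_A{}^a,X_A$. With tractor indices skewed, $\mathbb Z_{\mathbf B^l}{}^{\mathbf b^l}=Z_{B^1}{}^{b^1}\cdots Z_{B^l}{}^{b^l}$, $\mathbb X_{B^1\dot{\mathbf B}^l}{}^{\dot{\mathbf b}^l}=X_{B^1}Z_{B^2}{}^{b^2}\cdots Z_{B^l}{}^{b^l}$. The tractor curvature is $[\nabla_a,\nabla_b]V^C=\Omega_{ab}{}^C{}_EV^E$, explicitly $\Omega_{abCE}=Z_C{}^cZ_E{}^eC_{abce}-2X_{[C}Z_{E]}{}^eA_{eab}$. Tractor extensions of $\sigma$ (conformally invariant): $$\overline\sigma_{\mathbf a^{k-l}\mathbf B^l}=(n-k+1)\mathbb Z_{\mathbf B^l}{}^{\mathbf b^l}\sigma_{\mathbf a^{k-l}\mathbf b^l}-l\,\mathbb X_{B^1\dot{\mathbf B}^l}{}^{\dot{\mathbf b}^l}\nabla^{b^1}\sigma_{\mathbf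 a^{k-l}\mathbf b^l},$$ $$\underline\sigma_{\mathbf a^{k+l}\mathbf B^l}=(k+1)\mathbb Z_{\mathbf B^l}{}^{\mathbf b^l}\mathbf g_{\mathbf b^l\mathbf a^{k,l}}\sigma_{\mathbf a^k}-l\,\mathbb X_{B^1\dot{\mathbf B}^l}{}^{\dot{\mathbf b}^l}\mathbf g_{\dot{\mathbf b}^l\dot{\mathbf a}^{k,l}}\nabla_{a^{k+1}}\sigma_{\mathbf a^k}.$$ Connections $\nabla^x$. Put $\kappa_{cE^0E^1F^0F^1}=X_{[E^0}Z_{E^1]}{}^{e}\Omega_{ceF^0F^1}$ and $\omega_{cE^0E^1f^0f^1}=X_{[E^0}Z_{E^1]}{}^{e}C_{cef^0f^1}$. For an endomorphism field $S$, $S\sharp$ denotes its natural derivation action on tensors (e.g. $S\sharp T_{ab}=-S^c{}_aT_{cb}-S^c{}_bT_{ac}$), and similarly for tractor endomorphisms acting on tractor indices. View $\kappa_c$ as a 1-form with values in $\mathrm{End}(\mathcal E^A)\otimes\mathrm{End}(\mathcal E^A)$ (pairs $E^0E^1$ and $F^0F^1$, raising the first index of each pair) and $\omega_c$ as a 1-form with values in $\mathrm{End}(\mathcal E^A)\otimes\mathrm{End}(\mathcal E^a)$; $\kappa_c\sharp\sharp$, $\omega_c\sharp\sharp$ are the resulting double actions: first apply the $\sharp$-action of the second factor, then that of the first. For real $x$, $\nabla^x_c=\nabla_c+x(\omega_c\sharp\sharp+\kappa_c\sharp\sharp)$ on tensor-tractor fields. *)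

(* Defs.v *)
From HB Require Import structures.
From mathcomp Require Import all_boot all_order all_algebra all_fingroup.
From mathcomp Require Import all_classical all_reals all_analysis.

Set Implicit Arguments.
Unset Strict Implicit.
Unset Printing Implicit Defensive.

Import Order.TTheory GRing.Theory Num.Theory.
Import numFieldNormedType.Exports.

Local Open Scope classical_set_scope.
Local Open Scope ring_scope.

(* A multi-index of length m is a finite function on 'I_m; the index with
   superscript 1 is at position 0.  Conditions such as j == 0 :> nat under
   a sum over j : 'I_m select that position; there is exactly one if 0 < m. *)

Section MultiIndices.
Context {R : realType} {I : finType}.

Definition upd_ix m (a : {ffun 'I_m -> I}) (j : 'I_m) (x : I)
  : {ffun 'I_m -> I} := [ffun i => if i == j then x else a i].

Definition cons_ix m (x : I) (a : {ffun 'I_m -> I}) : {ffun 'I_m.+1 -> I} :=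
  [ffun i => if unlift ord0 i is Some j then a j else x].

Definition behead_ix m (a : {ffun 'I_m.+1 -> I}) : {ffun 'I_m -> I} :=
  [ffun i => a (lift ord0 i)].

Definition take_ix k l (a : {ffun 'I_(k + l) -> I}) : {ffun 'I_k -> I} :=
  [ffun i => a (lshift l i)].

Lemma leq_subDK k l : (k <= k - l + l)%N.
Proof. by rewrite addnC -leq_subLR. Qed.

(* Concatenation; meaningful for l <= k, where k - l + l = k. *)
Definition cat_ix k l (a : {ffun 'I_(k - l) -> I}) (b : {ffun 'I_l -> I})
  : {ffun 'I_k -> I} :=
  [ffun i => match fintype.split (widen_ord (leq_subDK k l) i) with
             | inl s => a s
             | inr t => b t
             end].

Definition skewing m (T : {ffun 'I_m -> I} -> R) (a : {ffun 'I_m -> I}) : R :=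
  (m`!%:R)^-1 * \sum_(s : 'S_m) (-1) ^+ s * T [ffun i => a (s i)].

(* For a sum of elementary tensors whose endomorphism part is the matrix unit
   with upper index D and lower index C and whose coefficient is V D C, apply
   the natural derivation action of the endomorphism part. *)
Definition sharp_gen m (V : I -> I -> {ffun 'I_m -> I} -> R)
  (a : {ffun 'I_m -> I}) : R :=
  - \sum_(j < m) \sum_(D : I) V D (a j) (upd_ix a j D).

(* S D C is the component of S with upper index D and lower index C. *)
Definition sharp m (S : I -> I -> R) (T : {ffun 'I_m -> I} -> R)
  : {ffun 'I_m -> I} -> R :=
  sharp_gen (fun D C b => S D C * T b).

End MultiIndices.

Section Calculus.
Context {R : realType} {n : nat}.

Definition pd (a : 'I_n) (f : 'rV[R]_n -> R) (x : 'rV[R]_n) : R :=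
  'D_(delta_mx 0 a : 'rV[R]_n) f x.

Definition iter_pd (s : seq 'I_n) (f : 'rV[R]_n -> R) : 'rV[R]_n -> R :=
  foldr pd f s.

(* C^oo on an open set. *)
Definition smooth_on (U : set 'rV[R]_n) (f : 'rV[R]_n -> R) : Prop :=
  forall (s : seq 'I_n) (x : 'rV[R]_n), U x ->
    {for x, continuous (iter_pd s f)} /\
    forall a : 'I_n,
      derivable (iter_pd s f) x (delta_mx 0 a : 'rV[R]_n).

End Calculus.

Record manifold (R : realType) (n : nat) := Manifold {
  mcarrier :> topologicalType;
  mhausdorff : hausdorff_space mcarrier;
  msecond_countable : @second_countable mcarrier;
  mchart : Type;
  mdom : mchart -> set mcarrier;
  mmap : mchart -> mcarrier -> 'rV[R]_n;
  minv : mchart -> 'rV[R]_n -> mcarrier;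
  mdom_open : forall i, open (mdom i);
  mimg_open : forall i, open (mmap i @` mdom i);
  mcover : forall p, exists i, mdom i p;
  minvK : forall i p, mdom i p -> minv i (mmap i p) = p;
  mmap_cont : forall i p, mdom i p -> {for p, continuous (mmap i)};
  minv_cont : forall i x, (mmap i @` mdom i) x -> {for x, continuous (minv i)};
  mtrans_smooth : forall i j (a : 'I_n),
    smooth_on (mmap i @` (mdom i `&` mdom j)) (fun x => mmap j (minv i x) 0 a)
}.

Section GlobalObjects.
Context {R : realType} {n : nat}.
Variable M : manifold R n.

Definition mimg (i : mchart M) : set 'rV[R]_n := @mmap _ _ M i @` mdom i.

(* The partial derivative of the b-th coordinate of chart j with respect to
   the a-th coordinate of chart i. *)
Definition jac (i j : mchart M) (b a : 'I_n) (p : M) : R :=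
  pd a (fun y => mmap j (minv i y) 0 b) (mmap i p).

Definition smooth_fun (f : M -> R) : Prop :=
  forall i : mchart M, smooth_on (mimg i) (fun x => f (minv i x)).

(* Smooth covariant k-tensor fields, given by their components in every chart
   of the atlas as functions of the coordinates; values outside the image of
   the chart carry no information. *)
Record tensor (k : nat) := Tensor {
  tcomp :> mchart M -> 'rV[R]_n -> {ffun 'I_k -> 'I_n} -> R;
  tsmooth : forall i a, smooth_on (mimg i) (fun x => tcomp i x a);
  ttrans : forall i j p a, mdom i p -> mdom j p ->
    tcomp i (mmap i p) a =
    \sum_(b : {ffun 'I_k -> 'I_n})
       (\prod_(s < k) jac i j (b s) (a s) p) * tcomp j (mmap j p) b
}.

Record kform (k : nat) := KForm {
  fcomp :> tensor k;
  fskew : forall i x (a : {ffun 'I_k -> 'I_n}) (s : 'S_k), mimg i x ->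
    fcomp i x [ffun t => a (s t)] = (-1) ^+ s * fcomp i x a
}.

Definition ix2 (a b : 'I_n) : {ffun 'I_2 -> 'I_n} :=
  [ffun s : 'I_2 => if s == ord0 then a else b].

Definition gram (T : tensor 2) (i : mchart M) (x : 'rV[R]_n) : 'M[R]_n :=
  \matrix_(a, b) T i x (ix2 a b).

(* Pseudo-Riemannian metrics, of arbitrary constant signature (p, n - p). *)
Record metric := MkMetric {
  mtensor :> tensor 2;
  msym : forall i x, mimg i x -> (gram mtensor i x)^T = gram mtensor i x;
  msignature : exists2 p : nat, (p <= n)%N &
    forall i x, mimg i x -> exists2 S : 'M[R]_n, S \in unitmx &
      S *m gram mtensor i x *m S^T =
      diag_mx (\row_(j < n) (if (j < p)%N then 1 else -1))
}.

Definition rescaled k (w : R) (U : M -> R) (T T' : tensor k) : Prop :=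
  forall i x a, mimg i x -> T' i x a = expR (w * U (minv i x)) * T i x a.

Record conformal_structure := ConformalStructure {
  cclass : set metric;
  cclassP : exists g0 : metric, forall g : metric,
    cclass g <-> exists2 U : M -> R, smooth_fun U & rescaled 2 U g0 g
}.

(* Sections of the bundle of k-forms tensored with densities of weight w: each
   metric g of the conformal class trivialises the densities, and the section
   is then represented by the k-form attached to g.  The value at metrics
   outside the class carries no information. *)
Record weighted_form (c : conformal_structure) (k : nat) (w : R) :=
  WeightedForm {
  wrep :> metric -> kform k;
  wrepP : forall (g g' : metric) (U : M -> R), cclass c g -> cclass c g' ->
    smooth_fun U -> rescaled 2 U g g' -> rescaled w U (wrep g) (wrep g')
}.

End GlobalObjects.

(* The frame of the standard tractor bundle in the splitting of a metric: a
   lower tractor index takes the values tY, tZ a, tX, and the components of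
   V_A = Y_A alpha + Z_A^a mu_a + X_A tau are alpha, mu_a, tau. *)
Definition tix (n : nat) : finType := (bool + 'I_n)%type.
Definition tY {n} : tix n := inl true.
Definition tX {n} : tix n := inl false.
Definition tZ {n} (a : 'I_n) : tix n := inr a.

(* Everything below takes place in the coordinates of one chart: G is the
   component matrix of the chosen metric, which also trivialises all density
   bundles, so that the conformal metric has components G. *)
Section LocalGeometry.
Context {R : realType} {n : nat}.
Variable G : 'rV[R]_n -> 'M[R]_n.
Implicit Types (x : 'rV[R]_n) (a b c d e : 'I_n) (A B C D E : tix n).

Definition ginv x : 'M[R]_n := invmx (G x).

(* Upper index d, lower indices a b. *)
Definition christoffel d a b x : R :=
  2^-1 * \sum_e ginv x d e *
    (pd a (fun y => G y e b) x + pd b (fun y => G y e a) x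
     - pd e (fun y => G y a b) x).

(* R_ab^c_d *)
Definition riemann_up a b c d x : R :=
  pd a (christoffel c b d) x - pd b (christoffel c a d) x
  + \sum_e (christoffel c a e x * christoffel e b d x
            - christoffel c b e x * christoffel e a d x).

(* R_abcd *)
Definition riemann a b c d x : R := \sum_e G x c e * riemann_up a b e d x.

Definition ricci b d x : R := \sum_a riemann_up a b a d x.

(* The trace of the Schouten tensor, i.e. Sc / (2 (n - 1)). *)
Definition schouten_tr x : R :=
  (2 * (n - 1)%:R)^-1 * \sum_a \sum_b ginv x a b * ricci a b x.

Definition schouten a b x : R :=
  ((n - 2)%:R)^-1 * (ricci a b x - schouten_tr x * G x a b).

Definition weyl a b c d x : R :=
  riemann a b c d x
  - (G x c a * schouten b d x - G x c b * schouten a d x)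
  - (G x d b * schouten a c x - G x d a * schouten b c x).

Definition nabla_tensor k (T : 'rV[R]_n -> {ffun 'I_k -> 'I_n} -> R) c x
  (a : {ffun 'I_k -> 'I_n}) : R :=
  pd c (fun y => T y a) x + sharp (fun d b => christoffel d c b x) (T x) a.

(* A_abc = nabla_b P_ca - nabla_c P_ba *)
Definition cotton a b c x : R :=
  let P y (i : {ffun 'I_2 -> 'I_n}) := schouten (i ord0) (i ord_max) y in
  nabla_tensor P b x (ix2 c a) - nabla_tensor P c x (ix2 b a).

Definition Xt A : R := (A == tX)%:R.
Definition Zt A a : R := (A == tZ a)%:R.

(* The tractor metric with upper indices. *)
Definition tractor_metric x A B : R :=
  match A, B with
  | inr a, inr b => ginv x a b
  | inl s, inl t => (s != t)%:R
  | _, _ => 0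
  end.

(* The tractor connection form: nabla_c V_B = pd_c V_B - \sum_D W D B * V_D
   with W = tractor_conn c x. *)
Definition tractor_conn c x D B : R :=
  match B, D with
  | inl true, inr d => (d == c)%:R
  | inr b, inl true => - schouten c b x
  | inr b, inr d => christoffel d c b x
  | inr b, inl false => - G x c b
  | inl false, inr d => \sum_b ginv x b d * schouten c b x
  | _, _ => 0
  end.

Definition tractor_curv a b C E x : R :=
  \sum_c \sum_e Zt C c * Zt E e * weyl a b c e x
  - \sum_e (Xt C * Zt E e - Xt E * Zt C e) * cotton e a b x.

(* X_[E0 Z_E1]^e *)
Definition XZ E0 E1 e : R := 2^-1 * (Xt E0 * Zt E1 e - Xt E1 * Zt E0 e).

Definition kappa_low c E0 E1 F0 F1 x : R :=
  \sum_e XZ E0 E1 e * tractor_curv c e F0 F1 x.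

Definition omega_low c E0 E1 (f0 f1 : 'I_n) x : R :=
  \sum_e XZ E0 E1 e * weyl c e f0 f1 x.

(* First index of each pair raised. *)
Definition kappa c x E0 E1 F0 F1 : R :=
  \sum_(A : tix n) \sum_(B : tix n)
    tractor_metric x E0 A * tractor_metric x F0 B * kappa_low c A E1 B F1 x.

Definition omega c x E0 E1 (f0 f1 : 'I_n) : R :=
  \sum_(A : tix n) \sum_b
    tractor_metric x E0 A * ginv x f0 b * omega_low c A E1 b f1 x.

(* Sections of (covariant m-tensors) (x) (l lower tractor indices). *)
Definition ttfield m l :=
  'rV[R]_n -> {ffun 'I_m -> 'I_n} -> {ffun 'I_l -> tix n} -> R.

Definition nabla_tractor m l (T : ttfield m l) c x
  (a : {ffun 'I_m -> 'I_n}) (B : {ffun 'I_l -> tix n}) : R :=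
  pd c (fun y => T y a B) x
  + sharp (fun d b => christoffel d c b x)
      (fun a' : {ffun 'I_m -> 'I_n} => T x a' B) a
  + sharp (tractor_conn c x) (T x a) B.

Definition kappa_sharp m l (T : ttfield m l) c x
  (a : {ffun 'I_m -> 'I_n}) (B : {ffun 'I_l -> tix n}) : R :=
  sharp_gen (fun E0 E1 => sharp (kappa c x E0 E1) (T x a)) B.

Definition omega_sharp m l (T : ttfield m l) c x
  (a : {ffun 'I_m -> 'I_n}) (B : {ffun 'I_l -> tix n}) : R :=
  sharp_gen
    (fun E0 E1 (B' : {ffun 'I_l -> tix n}) =>
       sharp (omega c x E0 E1)
         (fun a' : {ffun 'I_m -> 'I_n} => T x a' B') a) B.

Definition nabla_x (r : R) m l (T : ttfield m l) c x
  (a : {ffun 'I_m -> 'I_n}) (B : {ffun 'I_l -> tix n}) : R :=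
  nabla_tractor T c x a B + r * (omega_sharp T c x a B + kappa_sharp T c x a B).

(* S_{c a^m}_0 for S skew in a^m.  The skew part S_[c a^m] and the trace part
   are removed; if tau is the trace S^p_{p a^2 ... a^m}, then g_{c[a^1} tau_...]
   has trace (n - m + 1) / m * tau, whence the coefficient. *)
Definition cartan_proj x m (S : 'I_n -> {ffun 'I_m -> 'I_n} -> R)
  c (a : {ffun 'I_m -> 'I_n}) : R :=
  S c a
  - skewing (fun b : {ffun 'I_m.+1 -> 'I_n} => S (b ord0) (behead_ix b))
      (cons_ix c a)
  - m%:R / (n - m + 1)%:R *
    skewing (fun b : {ffun 'I_m -> 'I_n} =>
        \sum_(j < m | j == 0 :> nat)
          G x c (b j) * \sum_p \sum_q ginv x p q * S p (upd_ix b j q)) a.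

Definition ZZ l (B : {ffun 'I_l -> tix n}) (b : {ffun 'I_l -> 'I_n}) : R :=
  skewing (fun B' : {ffun 'I_l -> tix n} => \prod_(i < l) Zt (B' i) (b i)) B.

(* Independent of the first entry of b. *)
Definition XX l (B : {ffun 'I_l -> tix n}) (b : {ffun 'I_l -> 'I_n}) : R :=
  skewing (fun B' : {ffun 'I_l -> tix n} =>
    \prod_(i < l) (if i == 0 :> nat then Xt (B' i) else Zt (B' i) (b i))) B.

Section Extensions.
Variables (k l : nat) (sigma : 'rV[R]_n -> {ffun 'I_k -> 'I_n} -> R).

Definition overline : ttfield (k - l) l :=
  fun x (a : {ffun _ -> 'I_n}) (B : {ffun 'I_l -> tix n}) =>
  (n - k + 1)%:R *
    \sum_(b : {ffun 'I_l -> 'I_n}) ZZ B b * sigma x (cat_ix a b)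
  - l%:R *
    \sum_(b : {ffun 'I_l -> 'I_n}) XX B b *
      \sum_(j < l | j == 0 :> nat)
        \sum_d ginv x (b j) d * nabla_tensor sigma d x (cat_ix a b).

(* The contractions of ZZ and XX with metrics are written with the lowered
   Z_A^b g_ba, since the second one does not involve an index b^1 to sum. *)
Definition Zlow x A a : R := \sum_b Zt A b * G x b a.

Definition underline : ttfield (k + l) l :=
  fun x (a : {ffun _ -> 'I_n}) (B : {ffun 'I_l -> tix n}) =>
  skewing (fun a' : {ffun 'I_(k + l) -> 'I_n} =>
    skewing (fun B' : {ffun 'I_l -> tix n} =>
      (k + 1)%:R * (\prod_(i < l) Zlow x (B' i) (a' (rshift k i)))
        * sigma x (take_ix a')
      - l%:R *
        (\prod_(i < l) (if i == 0 :> nat then Xt (B' i)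
                        else Zlow x (B' i) (a' (rshift k i))))
        * \sum_(j < l | j == 0 :> nat)
            nabla_tensor sigma (a' (rshift k j)) x (take_ix a')) B) a.

End Extensions.
End LocalGeometry.

Section Equations.
Context {R : realType} {n : nat} (M : manifold R n).

Definition conformal_killing (g : metric M) k (sigma : kform M k) : Prop :=
  forall (i : mchart M) x, mimg i x ->
  forall c (a : {ffun 'I_k -> 'I_n}),
    cartan_proj (gram g i) x
      (fun c' a' => nabla_tensor (gram g i) (sigma i) c' x a') c a = 0.

(* The vanishing of nabla^r_{c T_{a^m}_0 B^l}, with the projection acting on
   the tensor indices only; T gives the components of the field in each
   chart. *)
Definition tractor_killing (g : metric M) (r : R) m l
  (T : mchart M -> @ttfield R n m l) : Prop :=
  forall (i : mchart M) x, mimg i x ->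
  forall c (a : {ffun 'I_m -> 'I_n}) (B : {ffun 'I_l -> tix n}),
    cartan_proj (gram g i) x
      (fun c' a' => nabla_x (gram g i) r (T i) c' x a' B) c a = 0.

Definition overline_ext (g : metric M) k l (sigma : kform M k)
  : mchart M -> @ttfield R n (k - l) l :=
  fun i => overline (gram g i) (l := l) (sigma i).

Definition underline_ext (g : metric M) k l (sigma : kform M k)
  : mchart M -> @ttfield R n (k + l) l :=
  fun i => underline (gram g i) (l := l) (sigma i).

End Equations.

Arguments overline_ext {R n M} g {k} l sigma.
Arguments underline_ext {R n M} g {k} l sigma.

(* Main.v *)
Require Import Defs.
From HB Require Import structures.
From mathcomp Require Import all_boot all_order all_algebra all_fingroup.
From mathcomp Require Import all_classical all_reals all_analysis.
From mathcomp Require Import ring lra.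

(** The statement is local, so the proof takes place in the coordinates of one
    chart, on the open set O of its values, with G the component matrix of the
    chosen metric, which also trivialises the densities. Let S be the covariant
    derivative of sigma and K its projection to the trace-free part of E(1,k), so
    that sigma is a conformal Killing form exactly when K = 0.

    Components. Neither extension has a component with a slot Y or with two
    slots X. The components of its nabla^x-derivative therefore have all slots
    Z, or one slot X, or one slot Y, or one slot X and one slot Y
    (cartan_proj_nabla_x). The last two kinds are algebraic in sigma and S, and
    the projection annihilates them identically: for the first extension they
    are skew in the index of the derivative and the tensor indices, for the
    second one they are pure traces, c being carried by a metric factor.

    Slots Z only. Here the X-component of the extension enters through the
    tractor connection, and its coefficients are such that, modulo terms killed
    by the projection, S may be replaced by K: one is left with the projection
    of a nonzero multiple of K(c, a b) for the first extension
    (cartan_proj_overline_Z), and of g_(b_1 a_(k+1)) ... g_(b_l a_(k+l)) K(c, a),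
    skew in a, for the second (cartan_proj_underline_Z). So these components
    vanish when K = 0. Conversely, they determine K. For the first extension K
    is trace-free, hence skew in c and some, hence every, form index, and there
    is no such nonzero K (cartan_proj_eq0); the hypothesis l < k provides a
    tensor index. For the second, K(X) wedge alpha = X^flat wedge tau for every
    vector X and every l-form alpha, whence X^flat wedge K(X) = 0 because
    k + 1 + l <= n; polarising in X and contracting with the metric yields
    (n - k + 1) K = 0 (exterior_eq0).

    One slot X. It remains to see that this component is annihilated when
    K = 0. It consists of second derivatives of sigma, a Schouten term that
    comes from the tractor connection and a Weyl term that comes from omega and
    kappa with the coefficient x. Differentiating the equation K = 0
    (killing_second) and contracting the outer derivative with a form index, one
    uses the Ricci identity and the vanishing of the double divergence of a form:
    the derivative of the divergence of sigma, corrected by the Schouten term and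
    by N/(n-k) times the Weyl term, N = n - k + 1, is skew
    (codifferential_defect_move). Skew-symmetrising instead over the inner
    derivative and the form indices, and using the first Bianchi identity, the
    derivative of d sigma, corrected by the Schouten term and by (k+1)/k times
    the Weyl term, is a pure trace (cartan_proj_differential_defect). The double
    action contributes x/2 times N, respectively k + 1, times the Weyl term,
    which singles out x = 2/(n-k) and x = 2/k.

    Skew symmetry is handled throughout by replacing single entries of
    multi-indices: a[i -> c] below stands for upd_ix a i c. A form is alternating
    under transpositions of positions, and a tensor S(c, a) alternating in a is
    totally skew when S(a_i, a[i -> c]) = - S(c, a). *)

Set Implicit Arguments.
Unset Strict Implicit.
Unset Printing Implicit Defensive.

Import Order.TTheory GRing.Theory Num.Theory.
Import numFieldNormedType.Exports.

Local Open Scope classical_set_scope.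
Local Open Scope ring_scope.

(** * Alternating functions of a multi-index *)

Section Alternating.
Context {R : realType} {I : finType}.

Lemma upd_same m (a : {ffun 'I_m -> I}) j x : upd_ix a j x j = x.
Proof. by rewrite ffunE eqxx. Qed.

Lemma upd_other m (a : {ffun 'I_m -> I}) j x i : i != j -> upd_ix a j x i = a i.
Proof. by rewrite ffunE => /negbTE ->. Qed.

Lemma upd_self m (a : {ffun 'I_m -> I}) j : upd_ix a j (a j) = a.
Proof. by apply/ffunP => i; rewrite ffunE; case: eqP => [->|]. Qed.

Lemma upd_upd m (a : {ffun 'I_m -> I}) j x y :
  upd_ix (upd_ix a j x) j y = upd_ix a j y.
Proof. by apply/ffunP => i; rewrite !ffunE; case: eqP. Qed.

Lemma updC m (a : {ffun 'I_m -> I}) i j x y : i != j ->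
  upd_ix (upd_ix a i x) j y = upd_ix (upd_ix a j y) i x.
Proof.
move=> ij; apply/ffunP => t; rewrite !ffunE.
by have [->|//] := eqVneq t j; rewrite eq_sym (negbTE ij).
Qed.

Definition swap_ix m (a : {ffun 'I_m -> I}) (i j : 'I_m) : {ffun 'I_m -> I} :=
  [ffun t => a (tperm i j t)].

(** Transpositions suffice to express skew symmetry, and they avoid the sign of
    a general permutation. *)
Definition alternating m (F : {ffun 'I_m -> I} -> R) : Prop :=
  forall i j a, i != j -> F (swap_ix a i j) = - F a.

Lemma swap_ixE m (a : {ffun 'I_m -> I}) i j :
  swap_ix a i j = upd_ix (upd_ix a i (a j)) j (a i).
Proof.
apply/ffunP => t; rewrite !ffunE; case: tpermP => [->|->|/eqP/negbTE -> /eqP/negbTE -> //].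
  by case: eqP => [->|]; rewrite ?eqxx.
by rewrite eqxx.
Qed.

Lemma swap_swap m (a : {ffun 'I_m -> I}) i j k l :
  swap_ix (swap_ix a i j) k l =
  swap_ix (swap_ix a (tperm i j k) (tperm i j l)) i j.
Proof.
by apply/ffunP => t; rewrite !ffunE; congr (a _); apply/inj_tperm/perm_inj.
Qed.

Lemma swapK m (a : {ffun 'I_m -> I}) i j : swap_ix (swap_ix a i j) i j = a.
Proof. by apply/ffunP => t; rewrite !ffunE tpermK. Qed.

Lemma swap_sym m (a : {ffun 'I_m -> I}) i j : swap_ix a i j = swap_ix a j i.
Proof. by apply/ffunP => t; rewrite !ffunE tpermC. Qed.

(** The form in which skew symmetry is used most: an entry may wander from one
    position to another, while its old position receives a new entry. *)
Lemma alt_move m (F : {ffun 'I_m -> I} -> R) i j a x : alternating F -> i != j ->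
  F (upd_ix (upd_ix a j (a i)) i x) = - F (upd_ix a j x).
Proof.
move=> sF ij; rewrite -(sF i j) // swap_ixE upd_same upd_other //; congr F.
by rewrite [RHS]updC // upd_upd.
Qed.

Lemma alt_upd2 m (F : {ffun 'I_m -> I} -> R) i j a x y : alternating F -> i != j ->
  F (upd_ix (upd_ix a i x) j y) = - F (upd_ix (upd_ix a i y) j x).
Proof.
move=> sF ij; rewrite -(sF i j) // swap_ixE upd_same upd_other // upd_same; congr F.
by rewrite (updC (upd_ix a i y) x x) 1?eq_sym // !upd_upd.
Qed.

Lemma alt_eq0 m (F : {ffun 'I_m -> I} -> R) (i j : 'I_m) (a : {ffun 'I_m -> I}) : alternating F -> i != j ->
  a i = a j -> F a = 0.
Proof.
move=> sF ij aij; have := sF i j a ij; rewrite swap_ixE {1}aij -aij !upd_self.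
rewrite aij upd_self; lra.
Qed.

Definition perm_ix m (a : {ffun 'I_m -> I}) (s : 'S_m) : {ffun 'I_m -> I} :=
  [ffun t => a (s t)].

Lemma skewingE m (F : {ffun 'I_m -> I} -> R) a :
  skewing F a = (m`!%:R)^-1 * \sum_(s : 'S_m) (-1) ^+ s * F (perm_ix a s).
Proof. by []. Qed.

Lemma alt_perm m (F : {ffun 'I_m -> I} -> R) (s : 'S_m) a : alternating F ->
  F (perm_ix a s) = (-1) ^+ s * F a.
Proof.
move=> sF; have [ts -> {s}] := prod_tpermP s.
elim: ts a => [|t ts IH] a /=.
  move=> _; rewrite big_nil odd_perm1 mul1r; congr F.
  by apply/ffunP => i; rewrite ffunE perm1.
move=> /andP[dt dts]; rewrite big_cons odd_permM odd_tperm dt.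
have -> : perm_ix a (tperm t.1 t.2 * \prod_(u <- ts) tperm u.1 u.2)%g =
   swap_ix (perm_ix a (\prod_(u <- ts) tperm u.1 u.2)%g) t.1 t.2.
  by apply/ffunP => i; rewrite !ffunE permM.
by rewrite sF // IH // signr_addb expr1 mulN1r mulNr.
Qed.

Lemma fact_neq0 m : (m`!%:R : R) != 0.
Proof. by rewrite pnatr_eq0 -lt0n fact_gt0. Qed.

Lemma skewing_id m (F : {ffun 'I_m -> I} -> R) a : alternating F -> skewing F a = F a.
Proof.
move=> sF; rewrite skewingE (eq_bigr (fun=> F a)).
  by rewrite sumr_const card_Sn -[X in _ * X]mulr_natl mulKf // fact_neq0.
by move=> s _; rewrite alt_perm // mulrA -expr2 sqrr_sign mul1r.
Qed.

Lemma eq_skewing m (F F' : {ffun 'I_m -> I} -> R) : F =1 F' -> skewing F =1 skewing F'.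
Proof. by move=> e a; rewrite (funext e). Qed.

Lemma skewing_swap m (F : {ffun 'I_m -> I} -> R) i j a : i != j ->
  skewing (fun b => F (swap_ix b i j)) a = - skewing F a.
Proof.
move=> ij; rewrite !skewingE -mulrN; congr (_ * _).
rewrite -sumrN (reindex_inj (mulgI (tperm i j))) /=.
apply: eq_bigr => s _; rewrite odd_permM odd_tperm ij signr_addb expr1 mulN1r mulNr.
by congr (- (_ * F _)); apply/ffunP => t; rewrite !ffunE permM tpermK.
Qed.

Lemma alt_skewing m (F : {ffun 'I_m -> I} -> R) : alternating (skewing F).
Proof.
move=> i j a ij; rewrite !skewingE -mulrN; congr (_ * _).
rewrite -sumrN (reindex_inj (mulIg (tperm i j))) /=.
apply: eq_bigr => s _; rewrite odd_permM odd_tperm ij signr_addb mulrN1 mulNr.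
by congr (- (_ * F _)); apply/ffunP => t; rewrite !ffunE permM tpermK.
Qed.

Lemma skewingD m (F F' : {ffun 'I_m -> I} -> R) a :
  skewing (fun b => F b + F' b) a = skewing F a + skewing F' a.
Proof.
by rewrite !skewingE -mulrDr -big_split; congr (_ * _); apply: eq_bigr => s _; rewrite mulrDr.
Qed.

Lemma skewingZ m (F : {ffun 'I_m -> I} -> R) r a :
  skewing (fun b => r * F b) a = r * skewing F a.
Proof.
rewrite !skewingE mulrCA; congr (_ * _); rewrite mulr_sumr.
by apply: eq_bigr => s _; rewrite mulrCA.
Qed.

Lemma skewingN m (F : {ffun 'I_m -> I} -> R) a :
  skewing (fun b => - F b) a = - skewing F a.
Proof. by rewrite -mulN1r -skewingZ; apply: eq_skewing => b; rewrite mulN1r. Qed.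

Lemma skewingB m (F F' : {ffun 'I_m -> I} -> R) a :
  skewing (fun b => F b - F' b) a = skewing F a - skewing F' a.
Proof. by rewrite skewingD skewingN. Qed.

Lemma skewing_sum m (J : Type) (r : seq J) (P : pred J)
    (F : J -> {ffun 'I_m -> I} -> R) a :
  skewing (fun b => \sum_(j <- r | P j) F j b) a = \sum_(j <- r | P j) skewing (F j) a.
Proof.
rewrite skewingE; under eq_bigr do rewrite mulr_sumr.
by rewrite exchange_big /= mulr_sumr.
Qed.

Lemma skewing0 m (a : {ffun 'I_m -> I}) : skewing (fun _ => 0 : R) a = 0.
Proof. by rewrite skewingE big1 ?mulr0 // => s _; rewrite mulr0. Qed.

(** If F is already skew in all positions but j0, the average over the m cosets,
    represented by the transpositions at j0, is alternating, and it has the same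
    skew-symmetrisation as F. *)
Lemma skewing_off m (F : {ffun 'I_m -> I} -> R) (j0 : 'I_m) a :
  (forall i j b, i != j0 -> j != j0 -> i != j -> F (swap_ix b i j) = - F b) ->
  skewing F a = m%:R^-1 * (F a - \sum_(j | j != j0) F (swap_ix a j0 j)).
Proof.
move=> sF; pose F' b := m%:R^-1 * (F b - \sum_(j | j != j0) F (swap_ix b j0 j)).
have m0 : (m%:R : R) != 0 by rewrite pnatr_eq0 -lt0n (leq_ltn_trans _ (ltn_ord j0)).
have card_off : \sum_(j < m | j != j0) (1 : R) = m%:R - 1.
  have -> : (m%:R : R) = \sum_(j < m) 1 by rewrite sumr_const card_ord.
  by rewrite [in RHS](bigD1 j0) //= addrC addrK.
suff sF' : alternating F'.
  rewrite -[RHS]/(F' a) -(skewing_id a sF') /F' skewingZ skewingB skewing_sum.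
  rewrite (eq_bigr (fun=> - skewing F a)); last by move=> j jj; rewrite skewing_swap // eq_sym.
  rewrite (eq_bigr (fun=> (- skewing F a) * 1)); last by move=> *; rewrite mulr1.
  by rewrite -mulr_sumr card_off; field.
move=> i j b; have key i' j' c : j' = j0 -> i' != j' -> F' (swap_ix c i' j') = - F' c.
  move=> -> {j'} ij0; rewrite /F' -mulrN; congr (_ * _).
  rewrite (bigD1 i') //= [in RHS](bigD1 i') //= [swap_ix c j0 i']swap_sym [swap_ix _ j0 i']swap_sym swapK.
  rewrite (eq_bigr (fun t => - F (swap_ix c j0 t))); first by rewrite sumrN; ring.
  move=> t /andP[tj0 ti]; rewrite -(sF i' t) //; last by rewrite eq_sym.
  have [i't j0t] : i' != t /\ j0 != t by rewrite ![_ == t]eq_sym.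
  by congr F; rewrite [RHS]swap_swap tpermR tpermD // eq_sym.
have [->|j0j ij] := eqVneq j j0; first by move=> ij; apply: key.
have [ij0|ij0] := eqVneq i j0; first by rewrite swap_sym; apply: key => //; rewrite eq_sym.
rewrite /F' -mulrN; congr (_ * _); rewrite opprB sF // addrC; congr (_ + _).
rewrite -sumrN (reindex_inj (@perm_inj _ (tperm i j))) /=.
apply: eq_big => [t|t tj0].
  by rewrite -[X in _ == X](@tpermD _ i j j0) ?inj_eq //; apply: perm_inj.
rewrite swap_swap tpermD // tpermK sF ?opprK //.
Qed.

End Alternating.

(** * The derivation action of an endomorphism *)

Section Sharp.
Context {R : realType} {I : finType} {m : nat}.
Implicit Types (a b : {ffun 'I_m -> I}) (T F : {ffun 'I_m -> I} -> R) (S : I -> I -> R).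

Lemma sharpE S T a :
  sharp S T a = - \sum_(j < m) \sum_(D : I) S D (a j) * T (upd_ix a j D).
Proof. by []. Qed.

Lemma upd_swap a i j t x :
  upd_ix (swap_ix a i j) t x = swap_ix (upd_ix a (tperm i j t) x) i j.
Proof.
by apply/ffunP => z; rewrite !ffunE -(inj_eq (@perm_inj _ (tperm i j)) z).
Qed.

Lemma upd_perm a (s : 'S_m) t x :
  upd_ix (perm_ix a s) t x = perm_ix (upd_ix a (s t) x) s.
Proof. by apply/ffunP => z; rewrite !ffunE -(inj_eq (@perm_inj _ s) z). Qed.

Lemma alt_sharp_gen (V : I -> I -> {ffun 'I_m -> I} -> R) :
  (forall D C, alternating (V D C)) -> alternating (sharp_gen V).
Proof.
move=> sV i j a ij; rewrite /sharp_gen; congr (- _).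
rewrite -sumrN [RHS](reindex_inj (@perm_inj _ (tperm i j))) /=.
apply: eq_bigr => t _; rewrite -sumrN; apply: eq_bigr => D _.
by rewrite upd_swap sV // ffunE.
Qed.

Lemma alt_sharp S T : alternating T -> alternating (sharp S T).
Proof. by move=> sT; apply: alt_sharp_gen => D C i j a ij; rewrite sT // mulrN. Qed.

Lemma eq_sharp_gen (V V' : I -> I -> {ffun 'I_m -> I} -> R) a :
  (forall D C b, V D C b = V' D C b) -> sharp_gen V a = sharp_gen V' a.
Proof.
by move=> e; congr (- _); apply: eq_bigr => j _; apply: eq_bigr => D _; rewrite e.
Qed.

Lemma sharpD S T F a : sharp S (fun b => T b + F b) a = sharp S T a + sharp S F a.
Proof.
rewrite !sharpE -opprD -big_split; congr (- _); apply: eq_bigr => j _ /=.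
by rewrite -big_split; apply: eq_bigr => D _; rewrite mulrDr.
Qed.

Lemma sharpZ S T r a : sharp S (fun b => r * T b) a = r * sharp S T a.
Proof.
rewrite !sharpE mulrN mulr_sumr; congr (- _); apply: eq_bigr => j _.
by rewrite mulr_sumr; apply: eq_bigr => D _; rewrite mulrCA.
Qed.

Lemma sharpN S T a : sharp S (fun b => - T b) a = - sharp S T a.
Proof. by rewrite -mulN1r -sharpZ; congr (sharp _ _ _); apply/funext => b; rewrite mulN1r. Qed.

Lemma sharpDl S S' T a :
  sharp (fun d c => S d c + S' d c) T a = sharp S T a + sharp S' T a.
Proof.
rewrite !sharpE -opprD -big_split; congr (- _); apply: eq_bigr => j _ /=.
by rewrite -big_split; apply: eq_bigr => D _; rewrite mulrDl.
Qed.

Lemma sharpNl S T a : sharp (fun d c => - S d c) T a = - sharp S T a.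
Proof.
rewrite !sharpE; congr (- _); rewrite -sumrN; apply: eq_bigr => j _.
by rewrite -sumrN; apply: eq_bigr => D _; rewrite mulNr.
Qed.

Lemma sharp_sum S (J : Type) (r : seq J) (P : pred J) (F : J -> {ffun 'I_m -> I} -> R) a :
  sharp S (fun b => \sum_(j <- r | P j) F j b) a = \sum_(j <- r | P j) sharp S (F j) a.
Proof.
rewrite sharpE; under [RHS]eq_bigr => j _ do rewrite sharpE.
rewrite [RHS]sumrN.
congr (- _); rewrite [RHS]exchange_big; apply: eq_bigr => j _ /=.
by rewrite [RHS]exchange_big; apply: eq_bigr => D _; rewrite mulr_sumr.
Qed.

Lemma sharp0 S a : sharp S (fun _ => 0) a = 0.
Proof. by rewrite sharpE !big1 ?oppr0 // => j _; rewrite big1 // => D _; rewrite mulr0. Qed.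

Lemma sharp_skewing S F a : sharp S (skewing F) a = skewing (sharp S F) a.
Proof.
rewrite skewingE [LHS]sharpZ; congr (_ * _); rewrite [LHS]sharp_sum.
apply: eq_bigr => s _; rewrite [LHS]sharpZ; congr (_ * _).
rewrite !sharpE; congr (- _); rewrite [LHS](reindex_inj (@perm_inj _ s)) /=.
by apply: eq_bigr => t _; apply: eq_bigr => D _; rewrite upd_perm ffunE.
Qed.

(** The natural action on covariant tensors is a representation of the Lie
    algebra of endomorphisms: the terms in which the two factors act at
    different positions cancel. This turns the quadratic part of the curvature
    into a commutator in the Ricci identity. *)
Lemma sharp_comm S S' T a :
  sharp S (sharp S' T) a - sharp S' (sharp S T) a =
  sharp (fun d c => \sum_e (S d e * S' e c - S' d e * S e c)) T a.
Proof.
have key (P Q : I -> I -> R) : sharp P (sharp Q T) a =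
    \sum_j (\sum_D \sum_E P D (a j) * Q E D * T (upd_ix a j E) +
     \sum_(i | i != j) \sum_D \sum_E P D (a j) * Q E (a i) * T (upd_ix (upd_ix a j D) i E)).
  rewrite sharpE -sumrN; apply: eq_bigr => j _; rewrite -sumrN.
  under eq_bigr => D _ do rewrite sharpE mulrN opprK (bigD1 j) //= mulrDr.
  rewrite big_split /=; congr (_ + _).
    apply: eq_bigr => D _; rewrite mulr_sumr; apply: eq_bigr => E _.
    by rewrite upd_same upd_upd mulrA.
  under eq_bigr => D _ do rewrite mulr_sumr.
  rewrite exchange_big /=; apply: eq_bigr => i ij; apply: eq_bigr => D _.
  by rewrite mulr_sumr; apply: eq_bigr => E _; rewrite upd_other // mulrA.
rewrite !key !big_split /=.
have -> : \sum_(i < m) \sum_(i0 < m | i0 != i)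
     \sum_D \sum_E S' D (a i) * S E (a i0) * T (upd_ix (upd_ix a i D) i0 E) =
  \sum_(i < m) \sum_(i0 < m | i0 != i)
     \sum_D \sum_E S D (a i) * S' E (a i0) * T (upd_ix (upd_ix a i D) i0 E).
  rewrite (exchange_big_dep xpredT) //=; apply: eq_bigr => i _.
  apply: eq_big => [j|j ij]; first by rewrite eq_sym.
  rewrite exchange_big; apply: eq_bigr => D _; apply: eq_bigr => E _.
  by rewrite [in RHS](updC _ _ _ ij); ring.
rewrite opprD addrACA subrr addr0 sharpE -!sumrN -big_split; apply: eq_bigr => j _ /=.
rewrite exchange_big /= [X in _ - X]exchange_big /= -!sumrN -big_split; apply: eq_bigr => D _ /=.
rewrite mulr_suml -!sumrN -big_split; apply: eq_bigr => E _ /=; ring.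
Qed.

End Sharp.

(** * The projection to the trace-free Cartan part *)

Section Projection.
Context {R : realType} {n : nat}.
Variables (G : 'rV[R]_n -> 'M[R]_n) (x : 'rV[R]_n).
Hypothesis gsym : forall a b, G x a b = G x b a.
Hypothesis gunit : G x \in unitmx.

Notation g := (G x).
Notation gi := (ginv G x).

Lemma ginvl a b : \sum_e gi a e * g e b = (a == b)%:R.
Proof.
have /matrixP/(_ a b) : gi *m g = 1%:M by rewrite mulVmx.
by rewrite !mxE.
Qed.

Lemma ginvr a b : \sum_e g a e * gi e b = (a == b)%:R.
Proof.
have /matrixP/(_ a b) : g *m gi = 1%:M by rewrite mulmxV.
by rewrite !mxE.
Qed.

Lemma ginv_sym a b : gi a b = gi b a.
Proof.
have gT : g^T = g by apply/matrixP => i j; rewrite mxE.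
have /matrixP/(_ a b) : (gi)^T = gi by rewrite /ginv trmx_inv gT.
by rewrite mxE.
Qed.

Lemma sum_delta (F : 'I_n -> R) a : \sum_e (a == e)%:R * F e = F a.
Proof.
rewrite (bigD1 a) //= eqxx mul1r big1 ?addr0 // => i; rewrite eq_sym => /negbTE ->.
by rewrite mul0r.
Qed.

Variable m : nat.
Implicit Types (S : 'I_n -> {ffun 'I_m -> 'I_n} -> R) (a : {ffun 'I_m -> 'I_n}).

Definition mtrace S a j : R := \sum_p \sum_q gi p q * S p (upd_ix a j q).

(** For S alternating in its form indices both skew-symmetrisations in the
    definition of the projection reduce to a single sum over positions, since
    only the position of the distinguished index is not yet skew. *)
Lemma cartan_projE S c a : (forall d, alternating (S d)) ->
  cartan_proj G x S c a = S c a
    - m.+1%:R^-1 * (S c a - \sum_j S (a j) (upd_ix a j c))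
    - (n - m + 1)%:R^-1 * \sum_j g c (a j) * mtrace S a j.
Proof.
move=> sS; rewrite /cartan_proj; congr (_ - _ - _).
  rewrite (@skewing_off _ _ _ _ ord0) => [|i j b i0 j0 ij]; last first.
    have [i' ei] : exists i', i = lift ord0 i' by case: (unliftP ord0 i) i0 => [i' ->|-> /eqP//]; exists i'.
    have [j' ej] : exists j', j = lift ord0 j' by case: (unliftP ord0 j) j0 => [j' ->|-> /eqP//]; exists j'.
    subst i j; rewrite ffunE tpermD 1?eq_sym // -(sS _ i' j'); last by apply: contraNN ij => /eqP->.
    by congr (S _ _); apply/ffunP => t; rewrite !ffunE -(inj_tperm _ _ _ (@lift_inj _ ord0)).
  congr (_ * (_ - _)).
    rewrite ffunE unlift_none; congr (S _ _).
    by apply/ffunP => t; rewrite !ffunE liftK.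
  rewrite big_mkcond big_ord_recl /= add0r; apply: eq_bigr => j _ /=.
  rewrite ffunE tpermL ffunE liftK; congr (S _ _).
  apply/ffunP => t; rewrite !ffunE; case: (eqVneq t j) => [->|tj].
    by rewrite tpermR unlift_none.
  by rewrite tpermD ?liftK // (inj_eq lift_inj) eq_sym.
(* Position 0 carries the trace in the definition; without positions the trace
   term is absent on both sides. *)
have [m0|mp] := posnP m.
  have noj (j : 'I_m) : False by have := ltn_ord j; rewrite [X in (_ < X)%N]m0.
  by rewrite [X in X%:R / _]m0 mul0r mul0r big1 ?mulr0 // => j; case: (noj j).
have e0 (b : {ffun 'I_m -> 'I_n}) : \sum_(j < m | j == 0 :> nat) g c (b j) * (\sum_p \sum_q gi p q * S p (upd_ix b j q))
   = g c (b (Ordinal mp)) * \sum_p \sum_q gi p q * S p (upd_ix b (Ordinal mp) q).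
  by rewrite (big_pred1 (Ordinal mp)) // => i; rewrite -(inj_eq val_inj).
rewrite (eq_skewing e0) (@skewing_off _ _ _ _ (Ordinal mp)) => [|i j b i0 j0 ij]; last first.
  have [mi mj] : Ordinal mp != i /\ Ordinal mp != j by split; rewrite eq_sym.
  rewrite -mulrN ffunE tpermD 1?[i == _]eq_sym 1?[j == _]eq_sym //; congr (_ * _).
  rewrite -sumrN; apply: eq_bigr => p _; rewrite -sumrN; apply: eq_bigr => q _.
  by rewrite upd_swap tpermD 1?[i == _]eq_sym 1?[j == _]eq_sym // sS // mulrN.
rewrite mulrA [_ / _ / _]mulrAC divff ?mul1r ?pnatr_eq0 -?lt0n //.
congr (_ * _); rewrite [in RHS](bigD1 (Ordinal mp)) //=; congr (_ + _).
rewrite -sumrN; apply: eq_bigr => j j0; rewrite ffunE tpermL -mulrN; congr (_ * _).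
rewrite -sumrN; apply: eq_bigr => p _; rewrite -sumrN; apply: eq_bigr => q _.
by rewrite upd_swap tpermL -mulrN sS ?opprK // eq_sym.
Qed.

Lemma eq_cartan_proj S S' c a : (forall d b, S d b = S' d b) ->
  cartan_proj G x S c a = cartan_proj G x S' c a.
Proof. by move=> e; congr (cartan_proj _ _ _ _ _); apply/funext => d; apply/funext => b. Qed.

Lemma cartan_projD S S' c a :
  cartan_proj G x (fun d b => S d b + S' d b) c a =
  cartan_proj G x S c a + cartan_proj G x S' c a.
Proof.
rewrite /cartan_proj skewingD.
under [X in _ - _ * X = _]eq_skewing => b.
  under eq_bigr => j _.
    under eq_bigr => p _.
      under eq_bigr => q _ do rewrite mulrDr.
      rewrite big_split /=; over.
    rewrite big_split /= mulrDr; over.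
  rewrite big_split /=; over.
rewrite skewingD; ring.
Qed.

Lemma cartan_projZ S r c a :
  cartan_proj G x (fun d b => r * S d b) c a = r * cartan_proj G x S c a.
Proof.
rewrite /cartan_proj skewingZ.
under [X in _ - _ * X = _]eq_skewing => b.
  under eq_bigr => j _.
    under eq_bigr => p _.
      under eq_bigr => q _ do rewrite mulrCA.
      rewrite -mulr_sumr; over.
    rewrite -mulr_sumr mulrCA; over.
  rewrite -mulr_sumr; over.
rewrite skewingZ; ring.
Qed.

Lemma cartan_proj0 c a : cartan_proj G x (fun _ (_ : {ffun 'I_m -> 'I_n}) => 0) c a = 0.
Proof.
by rewrite -[RHS](mul0r (cartan_proj G x (fun _ _ => 0) c a)) -cartan_projZ;
   apply: eq_cartan_proj => *; rewrite mul0r.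
Qed.

Lemma cartan_proj_sum (J : Type) (r : seq J) (P : pred J)
   (S : J -> 'I_n -> {ffun 'I_m -> 'I_n} -> R) c a :
  cartan_proj G x (fun d b => \sum_(j <- r | P j) S j d b) c a =
  \sum_(j <- r | P j) cartan_proj G x (S j) c a.
Proof.
elim: r => [|j r IH].
  by rewrite big_nil -[RHS](cartan_proj0 c a); apply: eq_cartan_proj => *; rewrite big_nil.
rewrite big_cons -IH; case: ifP => Pj; last by apply: eq_cartan_proj => *; rewrite big_cons Pj.
by rewrite -cartan_projD; apply: eq_cartan_proj => *; rewrite big_cons Pj.
Qed.

(** A tensor that is skew in all of its indices is also trace-free, because the
    metric is symmetric. *)
Lemma mtrace_skew S a j :
  (forall d (b : {ffun 'I_m -> 'I_n}) j, S (b j) (upd_ix b j d) = - S d b) ->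
  mtrace S a j = 0.
Proof.
move=> tS; have : mtrace S a j = - mtrace S a j.
  rewrite {1}/mtrace exchange_big /mtrace -sumrN /=; apply: eq_bigr => p _.
  rewrite -sumrN; apply: eq_bigr => q _; rewrite ginv_sym -mulrN -(tS _ _ j).
  by rewrite upd_same upd_upd.
lra.
Qed.

(** For a totally skew S each of the m + 1 terms equals S. *)
Lemma sum_skew S c a :
  (forall d (b : {ffun 'I_m -> 'I_n}) j, S (b j) (upd_ix b j d) = - S d b) ->
  S c a - \sum_j S (a j) (upd_ix a j c) = m.+1%:R * S c a.
Proof.
move=> tS; rewrite (eq_bigr (fun=> - S c a)) // sumr_const card_ord mulNrn opprK.
by rewrite -mulrS mulr_natl.
Qed.

(** One of the two kinds of tensors that the projection annihilates; the other
    one are the pure traces of cartan_proj_trace. *)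
Lemma cartan_proj_skew S c a : (forall d, alternating (S d)) ->
  (forall d (b : {ffun 'I_m -> 'I_n}) j, S (b j) (upd_ix b j d) = - S d b) ->
  cartan_proj G x S c a = 0.
Proof.
move=> sS tS; rewrite cartan_projE // sum_skew // mulKf ?pnatr_eq0 // big1 ?mulr0 ?subr0 ?subrr //.
by move=> j _; rewrite mtrace_skew ?mulr0.
Qed.

(** A pure trace is written as the sum over the positions j of g(c, a_j) t_j(a),
    where t_j ignores position j and the t_j agree up to the sign of moving an
    entry from one position to another. This is g(c, a_1) t(a_2, ..., a_m)
    skew-symmetrised, but no position plays a special role. *)
Section TraceFamily.
Variable t : 'I_m -> {ffun 'I_m -> 'I_n} -> R.
Hypothesis t_indep : forall j a y, t j (upd_ix a j y) = t j a.
Hypothesis t_move : forall i j a, i != j -> t i (upd_ix a j (a i)) = - t j a.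

(** A transposition of i and j exchanges the terms of i and j, and t_move gives
    the sign in the other terms after passing through their free position. *)
Lemma alt_trace_family c : alternating (fun a => \sum_j g c (a j) * t j a).
Proof.
have tj i j a : i != j -> t j (swap_ix a i j) = - t i a.
  by move=> ij; rewrite swap_ixE t_indep t_move // eq_sym.
move=> i j a ij; rewrite -sumrN (reindex_inj (@perm_inj _ (tperm i j))) /=.
apply: eq_bigr => s _; rewrite ffunE tpermK -mulrN; congr (_ * _).
have [->|si] := eqVneq s i; first by rewrite tpermL tj.
have [->|sj] := eqVneq s j; first by rewrite tpermR swap_sym tj // eq_sym.
rewrite tpermD 1?eq_sym // -[in RHS](opprK (t s a)) -(t_move a (i := i)) 1?eq_sym //.
rewrite -(t_move _ (i := j)) 1?eq_sym // -[RHS]opprK -(t_move _ (i := s)) //.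
have js : j != s by rewrite eq_sym.
rewrite opprK (upd_other _ _ js) (upd_other _ _ si) upd_same swap_ixE.
rewrite -(t_indep s _ (a i)); congr t.
apply/ffunP => z; rewrite !ffunE.
by have [->|//] := eqVneq z s; rewrite (negbTE sj) (negbTE si).
Qed.

(** The terms with i = j reproduce the sum by the symmetry of g. In the other
    ones g(a_j, a_i) is symmetric in i and j, whereas t_i(a[j -> c]) is skew. *)
Lemma trace_family_insert c a :
  \sum_j \sum_i g (a j) (upd_ix a j c i) * t i (upd_ix a j c) = \sum_j g c (a j) * t j a.
Proof.
under eq_bigr => j _ do rewrite (bigD1 j) //= upd_same t_indep gsym.
rewrite big_split /= -[RHS]addr0; congr (_ + _).
set Z := \sum_(i < m) _.
suff : Z = - Z by lra.
rewrite {1}/Z (exchange_big_dep xpredT) //= /Z -sumrN; apply: eq_bigr => i _.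
rewrite -sumrN; apply: eq_big => [j|j ij]; first by rewrite eq_sym.
have ji : j != i by rewrite eq_sym.
rewrite !upd_other // gsym -mulrN; congr (_ * _).
rewrite -(t_indep i _ c) -(t_indep j (upd_ix a i c) c) updC //.
rewrite -(t_move _ (i := i)) //.
by rewrite (upd_other _ _ ij) upd_same upd_upd.
Qed.

(** The term of position j contributes n, and each of the other m - 1 positions
    contributes -1, by moving its entry. *)
Lemma mtrace_trace_family a j : (m <= n)%N ->
  mtrace (fun d b => \sum_i g d (b i) * t i b) a j = (n - m + 1)%:R * t j a.
Proof.
move=> mn; rewrite /mtrace; under eq_bigr => p _ do under eq_bigr => q _ do rewrite mulr_sumr.
under eq_bigr => p _ do rewrite exchange_big /=.
rewrite exchange_big /= (bigD1 j) //=.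
rewrite (_ : \sum_(p < n) _ = n%:R * t j a); last first.
  under eq_bigr => p _ do under eq_bigr => q _ do rewrite upd_same t_indep mulrA gsym mulrC.
  under eq_bigr => p _ do rewrite -mulr_sumr.
  rewrite -mulr_sumr mulrC; congr (_ * _).
  rewrite exchange_big /=; under eq_bigr => p _ do under eq_bigr => q _ do rewrite mulrC.
  under eq_bigr => p _ do rewrite ginvr eqxx.
  by rewrite sumr_const card_ord.
rewrite (eq_bigr (fun=> - t j a * 1)); last first.
  move=> i ij; rewrite mulr1 -(t_move a ij).
  under eq_bigr => p _ do under eq_bigr => q _ do rewrite upd_other // mulrCA.
  rewrite (eq_bigr (fun p => \sum_q gi p q * g p (a i) * t i (upd_ix a j q))); last first.
    by move=> p _; apply: eq_bigr => q _; ring.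
  rewrite exchange_big /= -(sum_delta (fun q => t i (upd_ix a j q))).
  apply: eq_bigr => q _; rewrite -mulr_suml; congr (_ * _).
  by rewrite eq_sym -ginvl; apply: eq_bigr => p _; rewrite ginv_sym.
rewrite -mulr_sumr.
have -> : \sum_(i < m | i != j) (1 : R) = m%:R - 1.
  have -> : (m%:R : R) = \sum_(j < m) 1 by rewrite sumr_const card_ord.
  by rewrite [in RHS](bigD1 j) //= addrC addrK.
by rewrite natrD natrB //; ring.
Qed.

Lemma cartan_proj_trace c a : (m <= n)%N ->
  cartan_proj G x (fun d b => \sum_j g d (b j) * t j b) c a = 0.
Proof.
move=> mn; rewrite cartan_projE; last exact: alt_trace_family.
rewrite trace_family_insert subrr mulr0 subr0.
under [X in _ * X]eq_bigr => j _ do rewrite mtrace_trace_family // mulrCA.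
by rewrite -mulr_sumr mulKf ?subrr // pnatr_eq0 addn1.
Qed.

End TraceFamily.

(** Skew-symmetrising g(c, a_i) h(a) over a gives a pure trace: the permutations
    that send i to j sum up to t_j. *)
Lemma cartan_proj_skewing_metric (i : 'I_m) (h : {ffun 'I_m -> 'I_n} -> R) c a :
  (m <= n)%N -> (forall b y, h (upd_ix b i y) = h b) ->
  cartan_proj G x (fun d => skewing (fun b => g d (b i) * h b)) c a = 0.
Proof.
move=> mn hi.
pose t j a := (m`!%:R)^-1 * \sum_(s : 'S_m | s i == j) (-1) ^+ s * h (perm_ix a s).
rewrite -(@cartan_proj_trace t _ _ c a mn).
- apply: eq_cartan_proj => d b; rewrite skewingE.
  under [RHS]eq_bigr => j _ do rewrite mulrCA mulr_sumr.
  rewrite -mulr_sumr; congr (_ * _).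
  rewrite (exchange_big_dep xpredT) //=; apply: eq_bigr => s _.
  by rewrite (big_pred1 (s i)) ?ffunE 1?mulrCA // => j; rewrite eq_sym.
- move=> j b y; congr (_ * _); apply: eq_bigr => s /eqP <-; rewrite -upd_perm hi //.
- move=> j' j b jj; rewrite /t -mulrN; congr (_ * _); rewrite -sumrN.
  rewrite (reindex_inj (mulIg (tperm j j'))) /=.
  apply: eq_big => s; first by rewrite permM -[X in _ == X](tpermL j j') (inj_eq perm_inj).
  rewrite permM => /eqP sj; have {}sj : s i = j by rewrite -[s i](tpermK j j') sj tpermR.
  rewrite odd_permM odd_tperm eq_sym jj signr_addb mulrN1 mulNr; congr (- (_ * _)).
  transitivity (h (perm_ix (upd_ix b j (b j')) s)); last by rewrite -sj -upd_perm hi.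
  congr h; apply/ffunP => z; rewrite ![in LHS]ffunE permM.
  rewrite [RHS]ffunE [RHS]ffunE; case: tpermP => [->|->|/eqP/negbTE -> //].
    by rewrite eqxx if_same.
  by rewrite eqxx if_same.
Qed.

(** Up to a factor, the operation f |-> f - sum_j f(a_j, a[j -> c]) skews f over
    the new index and the indices at the positions in P; so its result changes
    sign when the new index is exchanged with one of these. *)
Lemma skew_diff_move (P : pred 'I_m) (f : 'I_n -> {ffun 'I_m -> 'I_n} -> R) d
    (b : {ffun 'I_m -> 'I_n}) i :
  (forall e j b', P i -> P j -> i != j -> f e (swap_ix b' i j) = - f e b') -> P i ->
  f (b i) (upd_ix b i d) - \sum_(j | P j) f (upd_ix b i d j) (upd_ix (upd_ix b i d) j (b i)) =
  - (f d b - \sum_(j | P j) f (b j) (upd_ix b j d)).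
Proof.
move=> sf Pi.
rewrite (bigD1 i) //= [in RHS](bigD1 i) //= upd_same upd_upd upd_self.
rewrite (eq_bigr (fun j => - f (b j) (upd_ix b j d))); first by rewrite sumrN; ring.
move=> j /andP[Pj ji]; have ij : i != j by rewrite eq_sym.
rewrite upd_other // -(sf (b j) j (upd_ix b j d)) // swap_ixE upd_same upd_other //.
by congr f; rewrite (updC b d (b i) ij) [RHS]updC // upd_upd.
Qed.

Lemma cartan_proj_skew_diff (f : 'I_n -> {ffun 'I_m -> 'I_n} -> R) c a :
  (forall d, alternating (f d)) ->
  cartan_proj G x (fun d b => f d b - \sum_j f (b j) (upd_ix b j d)) c a = 0.
Proof.
move=> sf; apply: cartan_proj_skew => [d i j b ij|d b i].
  rewrite sf // opprB addrC; congr (_ + _); rewrite -sumrN.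
  rewrite (reindex_inj (@perm_inj _ (tperm i j))) /=; apply: eq_bigr => s _.
  by rewrite ffunE tpermK upd_swap tpermK sf // opprK.
by apply: (skew_diff_move (P := xpredT)) => // e j b' _ _; apply: sf.
Qed.

Section ProjectionProperties.
Variable S : 'I_n -> {ffun 'I_m -> 'I_n} -> R.
Hypothesis Salt : forall d, alternating (S d).
Hypothesis mn : (m <= n)%N.

Lemma mtrace_indep j a y : mtrace S (upd_ix a j y) j = mtrace S a j.
Proof. by apply: eq_bigr => p _; apply: eq_bigr => q _; rewrite upd_upd. Qed.

Lemma mtrace_move i j a : i != j -> mtrace S (upd_ix a j (a i)) i = - mtrace S a j.
Proof.
move=> ij; rewrite -sumrN; apply: eq_bigr => p _; rewrite -sumrN; apply: eq_bigr => q _.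
by rewrite alt_move // mulrN.
Qed.

Lemma skew_diff_total d (b : {ffun 'I_m -> 'I_n}) j :
  S (b j) (upd_ix b j d) - \sum_i S (upd_ix b j d i) (upd_ix (upd_ix b j d) i (b j)) =
  - (S d b - \sum_i S (b i) (upd_ix b i d)).
Proof. by apply: (skew_diff_move (P := xpredT)) => // e i b' _ _; apply: Salt. Qed.

Lemma alt_skew_diff d : alternating (fun b => S d b - \sum_j S (b j) (upd_ix b j d)).
Proof.
move=> i j b ij; rewrite Salt // opprB addrC; congr (_ + _); rewrite -sumrN.
rewrite (reindex_inj (@perm_inj _ (tperm i j))) /=; apply: eq_bigr => s _.
by rewrite ffunE tpermK upd_swap tpermK Salt // opprK.
Qed.

Lemma alt_cartan_proj c : alternating (cartan_proj G x S c).
Proof.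
move=> i j a ij; rewrite !cartan_projE // alt_skew_diff //.
have -> : \sum_t g c (swap_ix a i j t) * mtrace S (swap_ix a i j) t =
   - \sum_t g c (a t) * mtrace S a t.
  exact: (alt_trace_family mtrace_indep mtrace_move) ij.
by rewrite Salt //; ring.
Qed.

(** The skew-symmetrisation of the projection over all m + 1 indices vanishes:
    trace terms do not contribute by trace_family_insert, and on the skew part
    the operation is multiplication by m + 1. *)
Lemma cartan_proj_unskew c a :
  cartan_proj G x S c a = \sum_j cartan_proj G x S (a j) (upd_ix a j c).
Proof.
apply/eqP; rewrite -subr_eq0; apply/eqP.
under eq_bigr => j _ do rewrite cartan_projE //.
rewrite cartan_projE // !sumrB -!mulr_sumr.
rewrite (trace_family_insert mtrace_indep mtrace_move c a).
have := sum_skew c a skew_diff_total; rewrite sumrB.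
set u := S c a; set v := \sum_j S _ _; set v' := \sum_j \sum_i _.
set z := \sum_j _ * _.
move=> E; have arith (r s : R) : u - r * (u - v) - s * z - (v - r * (v - v') - s * z) =
  u - v - r * (u - v - (v - v')) by ring.
by rewrite arith E mulKf ?subrr // pnatr_eq0.
Qed.

Lemma mtrace_cartan_proj a j : mtrace (cartan_proj G x S) a j = 0.
Proof.
transitivity (mtrace S a j - m.+1%:R^-1 * mtrace (fun d b => S d b - \sum_j S (b j) (upd_ix b j d)) a j
   - (n - m + 1)%:R^-1 * mtrace (fun d b => \sum_j g d (b j) * mtrace S b j) a j).
  rewrite /mtrace !mulr_sumr -!sumrB; apply: eq_bigr => p _.
  rewrite !mulr_sumr -!sumrB; apply: eq_bigr => q _; rewrite cartan_projE //.
  by rewrite !mulrBr ![_ * (gi p q * _)]mulrCA.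
rewrite [X in _ - _ * X - _]mtrace_skew ?mulr0 ?subr0; last exact: skew_diff_total.
rewrite (mtrace_trace_family mtrace_indep mtrace_move) //.
by rewrite mulKf ?subrr // pnatr_eq0 addn1.
Qed.

End ProjectionProperties.

(** Insertion of c at every position commutes with the permutation of positions. *)
Lemma skewing_insert (F : 'I_n -> {ffun 'I_m -> 'I_n} -> R) c a :
  \sum_j skewing (F (a j)) (upd_ix a j c) =
  skewing (fun b => \sum_j F (b j) (upd_ix b j c)) a.
Proof.
rewrite skewingE; under eq_bigr => j _ do rewrite skewingE.
rewrite -mulr_sumr exchange_big /=; congr (_ * _); apply: eq_bigr => s _.
rewrite mulr_sumr (reindex_inj (@perm_inj _ s)) /=; apply: eq_bigr => j _.
by rewrite ffunE upd_perm.
Qed.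

End Projection.

(** * Partial derivatives of smooth functions *)

Section PartialDerivatives.
Context {R : realType} {n : nat}.
Implicit Types (f h : 'rV[R]_n -> R) (x y : 'rV[R]_n).

(** Only the coordinate directions matter, and an inductive wrapper prevents the
    definition from being unfolded in conversion tests. *)
Variant pderivable f x : Prop :=
  PDerivable of forall a : 'I_n, derivable f x (delta_mx 0 a : 'rV[R]_n).

Lemma pderivableP f x a : pderivable f x -> derivable f x (delta_mx 0 a : 'rV[R]_n).
Proof. by case. Qed.

Lemma pd_near (O : set 'rV[R]_n) f h a x : open O -> O x ->
  (forall y, O y -> f y = h y) -> pd a f x = pd a h x.
Proof.
move=> oO Ox e; apply: near_eq_derive.
by have : nbhs x O by [exact: open_nbhs_nbhs]; apply: filterS => y /e.
Qed.

Lemma pderivable_near (O : set 'rV[R]_n) f h x : open O -> O x ->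
  (forall y, O y -> f y = h y) -> pderivable f x -> pderivable h x.
Proof.
move=> oO Ox e [df]; split=> a; apply: near_eq_derivable (df a).
by have : nbhs x O by [exact: open_nbhs_nbhs]; apply: filterS => y /e.
Qed.

Lemma pderivable_cst (r : R) x : pderivable (fun=> r) x.
Proof. by split=> a; apply: derivable_cst. Qed.

Lemma pderivableD f h x : pderivable f x -> pderivable h x ->
  pderivable (fun y => f y + h y) x.
Proof. by case=> df [dh]; split=> a; apply: derivableD. Qed.

Lemma pderivableN f x : pderivable f x -> pderivable (fun y => - f y) x.
Proof. by case=> df; split=> a; apply: derivableN. Qed.

Lemma pderivableB f h x : pderivable f x -> pderivable h x ->
  pderivable (fun y => f y - h y) x.
Proof. by move=> df dh; apply/pderivableD/pderivableN. Qed.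

Lemma pderivableM f h x : pderivable f x -> pderivable h x ->
  pderivable (fun y => f y * h y) x.
Proof. by case=> df [dh]; split=> a; apply: derivableM. Qed.

Lemma pderivableV f x : f x != 0 -> pderivable f x ->
  pderivable (fun y => (f y)^-1) x.
Proof. by move=> f0 [df]; split=> a; apply: derivableV. Qed.

Lemma pderivable_sum (J : Type) (r : seq J) (P : pred J) (F : J -> 'rV[R]_n -> R) x :
  (forall j, P j -> pderivable (F j) x) ->
  pderivable (fun y => \sum_(j <- r | P j) F j y) x.
Proof.
move=> dF; elim: r => [|j r IH].
  by under eq_fun do rewrite big_nil; apply: pderivable_cst.
under eq_fun do rewrite big_cons.
by case: (boolP (P j)) => [/dF Pj|_ //]; apply: pderivableD.
Qed.

Lemma pderivable_prod (J : Type) (r : seq J) (P : pred J) (F : J -> 'rV[R]_n -> R) x :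
  (forall j, P j -> pderivable (F j) x) ->
  pderivable (fun y => \prod_(j <- r | P j) F j y) x.
Proof.
move=> dF; elim: r => [|j r IH].
  by under eq_fun do rewrite big_nil; apply: pderivable_cst.
under eq_fun do rewrite big_cons.
by case: (boolP (P j)) => [/dF Pj|_ //]; apply: pderivableM.
Qed.

Lemma pd_cst a (r : R) x : pd a (fun=> r) x = 0.
Proof. exact: derive_cst. Qed.

Lemma pdD a f h x : pderivable f x -> pderivable h x ->
  pd a (fun y => f y + h y) x = pd a f x + pd a h x.
Proof. by case=> df [dh]; apply: deriveD. Qed.

Lemma pdN a f x : pderivable f x -> pd a (fun y => - f y) x = - pd a f x.
Proof. by case=> df; apply: deriveN. Qed.

Lemma pdB a f h x : pderivable f x -> pderivable h x ->
  pd a (fun y => f y - h y) x = pd a f x - pd a h x.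
Proof. by move=> df dh; rewrite (pdD a df (pderivableN dh)) (pdN a dh). Qed.

Lemma pdM a f h x : pderivable f x -> pderivable h x ->
  pd a (fun y => f y * h y) x = pd a f x * h x + f x * pd a h x.
Proof.
case=> df [dh]; rewrite /pd [LHS](deriveM (df a) (dh a)) addrC.
by rewrite /GRing.scale /= [h x * _]mulrC.
Qed.

Lemma pdZ a (r : R) f x : pderivable f x -> pd a (fun y => r * f y) x = r * pd a f x.
Proof. by move=> df; rewrite pdM // ?pd_cst ?mul0r ?add0r //; apply: pderivable_cst. Qed.

Lemma pd_sum a (J : Type) (r : seq J) (P : pred J) (F : J -> 'rV[R]_n -> R) x :
  (forall j, P j -> pderivable (F j) x) ->
  pd a (fun y => \sum_(j <- r | P j) F j y) x = \sum_(j <- r | P j) pd a (F j) x.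
Proof.
move=> dF; elim: r => [|j r IH].
  by under eq_fun do rewrite big_nil; rewrite pd_cst big_nil.
under eq_fun do rewrite big_cons; rewrite big_cons.
case: (boolP (P j)) => [/dF Pj|_ //]; rewrite pdD ?IH //.
exact: pderivable_sum.
Qed.

Lemma pd_prod a (J : finType) (P : pred J) (F : J -> 'rV[R]_n -> R) x :
  (forall j, P j -> pderivable (F j) x) ->
  pd a (fun y => \prod_(j | P j) F j y) x =
  \sum_(j | P j) pd a (F j) x * \prod_(i | P i && (i != j)) F i x.
Proof.
move=> dF.
suff key (r : seq J) : uniq r -> pd a (fun y => \prod_(j <- r | P j) F j y) x =
    \sum_(j <- r | P j) pd a (F j) x * \prod_(i <- r | P i && (i != j)) F i x.
  exact: (key _ (index_enum_uniq J)).
elim: r => [|j r IH] /=.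
  by move=> _; under eq_fun do rewrite big_nil; rewrite pd_cst big_nil.
move=> /andP[jr ur]; under eq_fun do rewrite big_cons; rewrite big_cons.
have sumE : \sum_(i <- r | P i) pd a (F i) x * \prod_(i0 <- j :: r | P i0 && (i0 != i)) F i0 x =
   (if P j then F j x else 1) * \sum_(i <- r | P i) pd a (F i) x * \prod_(i0 <- r | P i0 && (i0 != i)) F i0 x.
  rewrite mulr_sumr big_seq_cond [RHS]big_seq_cond; apply: eq_bigr => i /andP[ir _].
  rewrite big_cons; have -> : j != i by apply: contraNneq jr => ->.
  by rewrite andbT; case: ifP => _; rewrite ?mul1r // mulrCA.
case: (boolP (P j)) => [Pj|nPj]; last first.
  rewrite [LHS](_ : _ = pd a (fun y => \prod_(j0 <- r | P j0) F j0 y) x) //.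
  by rewrite IH // sumE (negbTE nPj) mul1r.
rewrite pdM; [|exact: dF|exact: pderivable_prod].
rewrite sumE Pj IH //; congr (_ * _ + _).
rewrite big_cons eqxx andbF /= big_seq_cond [RHS]big_seq_cond; apply: eq_bigl => i.
case: (boolP (i \in r)) => //= ir; suff -> : i != j by rewrite andbT.
by apply: contraNneq jr => <-.
Qed.

Lemma smooth_pderivable (O : set 'rV[R]_n) f s x :
  smooth_on O f -> O x -> pderivable (iter_pd s f) x.
Proof. by move=> sf /(sf s)[_ df]; split. Qed.

Lemma smooth_pd (O : set 'rV[R]_n) f a : smooth_on O f -> smooth_on O (pd a f).
Proof. by move=> sf s x Ox; have := sf (rcons s a) x Ox; rewrite /iter_pd foldr_rcons. Qed.

Lemma is_derive_line f (p v : 'rV[R]_n) (s : R) : derivable f (p + s *: v) v ->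
  is_derive s 1 (fun r => f (p + r *: v)) ('D_v f (p + s *: v)).
Proof.
move=> df.
have e : (fun h : R => h^-1 *: (((fun r => f (p + r *: v)) \o shift s) (h *: (1 : R)) - f (p + s *: v))) =
         (fun h : R => h^-1 *: ((f \o shift (p + s *: v)) (h *: v) - f (p + s *: v))).
  apply/funext => h /=; congr (_ *: (f _ - _)).
  by rewrite [h *: (1 : R)]mulr1 scalerDl addrCA.
by apply: DeriveDef; [rewrite /derivable e|rewrite /derive e].
Qed.

(** The mean value theorem is applied first to the difference
    f(x + s w + r v) - f(x + r v) as a function of r, then to the derivative of
    f along v as a function of the other parameter. *)
Lemma mixed_difference (O : set 'rV[R]_n) f (a b : 'I_n) x (s : R) (v w : 'rV[R]_n) :
  v = delta_mx 0 a -> w = delta_mx 0 b ->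
  (forall y, O y -> pderivable f y) -> (forall y, O y -> pderivable (pd a f) y) ->
  0 < s ->
  (forall r r', 0 <= r <= s -> 0 <= r' <= s -> O (x + r *: v + r' *: w)) ->
  exists2 r, 0 <= r.1 <= s /\ 0 <= r.2 <= s &
   f (x + s *: v + s *: w) - f (x + s *: v) - f (x + s *: w) + f x =
   pd b (pd a f) (x + r.1 *: v + r.2 *: w) * s * s.
Proof.
move=> ev ew df ddf s0 Os.
have O0 r : 0 <= r <= s -> O (x + r *: v).
  by move=> rs; have := Os r 0 rs; rewrite scale0r addr0; apply; rewrite lexx ltW.
pose phi (r : R) := f (x + s *: w + r *: v) - f (x + r *: v).
have Ow r : 0 <= r <= s -> O (x + s *: w + r *: v).
  by move=> rs; rewrite addrAC; apply: Os => //; rewrite lexx ltW.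
have dphi (r : R) : 0 <= r <= s ->
  is_derive r 1 phi (pd a f (x + s *: w + r *: v) - pd a f (x + r *: v)).
  move=> rs; rewrite /pd -ev; apply: is_deriveB; apply: is_derive_line; rewrite ev; apply: pderivableP; apply: df; rewrite -ev;
    [exact: Ow|exact: O0].
have oo (r : R) : r \in `]0, s[ -> 0 <= r <= s.
  by rewrite in_itv /= => /andP[/ltW -> /ltW ->].
have cc (r : R) : r \in `[0, s] -> 0 <= r <= s by rewrite in_itv.
have [r /cc rs er] := @MVT_segment R phi _ 0 s (ltW s0)
   (fun r rs => dphi r (oo r rs))
   (derivable_within_continuous (fun r rs => @ex_derive _ _ _ _ _ _ _ (dphi r (cc r rs)))).
have dpsi (r' : R) : 0 <= r' <= s ->
  is_derive r' 1 (fun r' => pd a f (x + r *: v + r' *: w)) (pd b (pd a f) (x + r *: v + r' *: w)).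
  move=> r's; rewrite {2}/pd -ew; apply: is_derive_line; rewrite ew; apply: pderivableP; apply: ddf.
  by rewrite -ew; apply: Os.
have [r' /cc r's er'] := @MVT_segment R (fun r' => pd a f (x + r *: v + r' *: w)) _ 0 s (ltW s0)
   (fun r rs => dpsi r (oo r rs))
   (derivable_within_continuous (fun r rs => @ex_derive _ _ _ _ _ _ _ (dpsi r (cc r rs)))).
exists (r, r') => //=; rewrite !scale0r !addr0 !subr0 in er er'.
rewrite -er' [x + r *: v + _]addrAC -er /phi !scale0r !addr0 [x + s *: w + s *: v]addrAC; ring.
Qed.

(** Both orders of differentiation are limits of the same mixed second
    difference, divided by s^2, as s tends to 0. *)
Lemma pd_comm (O : set 'rV[R]_n) f (a b : 'I_n) x : open O -> O x -> smooth_on O f ->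
  pd a (pd b f) x = pd b (pd a f) x.
Proof.
move=> oO Ox sf.
set v := delta_mx 0 a : 'rV[R]_n; set w := delta_mx 0 b : 'rV[R]_n.
have cba : {for x, continuous (pd b (pd a f))} by have [] := sf [:: b; a] x Ox.
have cab : {for x, continuous (pd a (pd b f))} by have [] := sf [:: a; b] x Ox.
apply/eqP; rewrite -subr_eq0 -normr_eq0 -[X in _ == X]/(0 : R) eq_le normr_ge0 andbT.
apply/ler_addgt0Pl => e e0; rewrite addr0.
have e2 : 0 < e / 2 by rewrite divr_gt0.
have [/= d d0 hd] : exists2 d : R, 0 < d & forall y, ball x d y ->
   [/\ O y, `|pd b (pd a f) x - pd b (pd a f) y| < e / 2 &
     `|pd a (pd b f) x - pd a (pd b f) y| < e / 2].
  have h1 : nbhs x O by exact: open_nbhs_nbhs.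
  have /cvgrPdist_lt/(_ _ e2) h2 := cba.
  have /cvgrPdist_lt/(_ _ e2) h3 := cab.
  have [d d0 hd] := proj1 (nbhs_ballP x _) (filterI h1 (filterI h2 h3)).
  exists d; first exact: d0.
  by move=> y yd; case: (hd y yd) => H1 [H2 H3]; split; [exact: H1|exact: H2|exact: H3].
(* K bounds the distance from x, in units of s, of the points at which the mean
   value theorem evaluates the derivatives. *)
pose K : R := `|v| + `|w| + 1.
have K0 : 0 < K by rewrite ltr_wpDl // addr_ge0.
pose s := d / 2 / K.
have s0 : 0 < s by rewrite !divr_gt0.
have near (r r' : R) : 0 <= r <= s -> 0 <= r' <= s -> ball x d (x + r *: v + r' *: w).
  move=> /andP[r0 rs] /andP[r'0 r's]; rewrite -ball_normE /ball_ /= -addrA opprD addrA subrr sub0r normrN.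
  apply: le_lt_trans (ler_normD _ _) _; rewrite !normrZ (ger0_norm r0) (ger0_norm r'0).
  apply: (@le_lt_trans _ _ (s * K)); last first.
    by rewrite /s divfK ?gt_eqF // ltr_pdivrMr // ltr_pMr // ltr1n.
  rewrite /K !mulrDr mulr1 -[leLHS]addr0; apply: lerD; last exact: ltW.
  by apply: lerD; apply: ler_wpM2r.
have dO g : smooth_on O g -> forall y, O y -> pderivable g y.
  by move=> sg y Oy; apply: (@smooth_pderivable O g [::] y).
have Ox' r r' (h : 0 <= r <= s) (h' : 0 <= r' <= s) : O (x + r *: v + r' *: w).
  by case: (hd _ (near r r' h h')).
have [r [r1 r2] er] := @mixed_difference O f a b x s v w erefl erefl (dO _ sf) (dO _ (smooth_pd a sf)) s0 Ox'.
have near' (t t' : R) : 0 <= t <= s -> 0 <= t' <= s -> ball x d (x + t *: w + t' *: v).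
  by move=> h h'; rewrite addrAC; apply: near.
have Ox'' t t' (h : 0 <= t <= s) (h' : 0 <= t' <= s) : O (x + t *: w + t' *: v).
  by case: (hd _ (near' t t' h h')).
have [q [q1 q2] eq'] := @mixed_difference O f b a x s w v erefl erefl (dO _ sf) (dO _ (smooth_pd b sf)) s0 Ox''.
have [_ h1 _] := hd _ (near _ _ r1 r2).
have [_ _ h2] := hd _ (near' _ _ q1 q2).
have E : pd b (pd a f) (x + r.1 *: v + r.2 *: w) = pd a (pd b f) (x + q.1 *: w + q.2 *: v).
  have sn0 : s != 0 by rewrite gt_eqF.
  have e3 : f (x + s *: v + s *: w) - f (x + s *: v) - f (x + s *: w) + f x =
            f (x + s *: w + s *: v) - f (x + s *: w) - f (x + s *: v) + f x.
    by rewrite (addrAC x (s *: w)); congr (_ + _); apply: addrAC.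
  have EE := etrans (esym er) (etrans e3 eq').
  exact: (mulIf sn0 (mulIf sn0 EE)).
rewrite E in h1.
move: h1 h2; set D := pd a (pd b f) (x + _ + _) => h1 h2.
rewrite (_ : pd a (pd b f) x - pd b (pd a f) x =
  (pd a (pd b f) x - D) - (pd b (pd a f) x - D)); last by rewrite opprB addrA subrK.
apply: (le_trans (ler_normB _ _)); apply: ltW; rewrite [e]splitr.
by apply: ltrD; [exact: h2|exact: h1].
Qed.

End PartialDerivatives.

(** * Levi-Civita connection and curvature *)

Section Geometry.
Context {R : realType} {n : nat}.
Variables (G : 'rV[R]_n -> 'M[R]_n) (O : set 'rV[R]_n).
Hypothesis oO : open O.
Hypothesis Gsym : forall x, O x -> forall a b, G x a b = G x b a.
Hypothesis Gunit : forall x, O x -> G x \in unitmx.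
Hypothesis Gsmooth : forall a b, smooth_on O (fun x => G x a b).

Notation gi := (ginv G).
Notation Gam := (christoffel G).

Lemma pderivable_metric x a b : O x -> pderivable (fun y => G y a b) x.
Proof. exact: (@smooth_pderivable _ _ O _ [::]). Qed.

Lemma pderivable_pd_metric x c a b : O x -> pderivable (pd c (fun y => G y a b)) x.
Proof. exact: (@smooth_pderivable _ _ O _ [:: c]). Qed.

Lemma pderivable_det m (A : 'rV[R]_n -> 'M[R]_m) x :
  (forall i j, pderivable (fun y => A y i j) x) -> pderivable (fun y => \det (A y)) x.
Proof.
move=> dA; apply: pderivable_sum => s _; apply: pderivableM; first exact: pderivable_cst.
by apply: pderivable_prod => i _; apply: dA.
Qed.

(** By the adjugate formula the entries of the inverse are rational in those of
    the metric. *)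
Lemma pderivable_ginv x a b : O x -> pderivable (fun y => gi y a b) x.
Proof.
move=> Ox; apply: (@pderivable_near _ _ O (fun y => (\det (G y))^-1 * cofactor (G y) b a)) => //.
  by move=> y Oy; rewrite /ginv /invmx Gunit // !mxE.
have dG := fun i j => pderivable_metric i j Ox.
apply: pderivableM.
  apply: pderivableV; last exact: pderivable_det.
  by have := Gunit Ox; rewrite unitmxE unitfE.
apply: pderivableM; first exact: pderivable_cst.
apply: pderivable_det => i j.
by under eq_fun do rewrite !mxE; apply: dG.
Qed.

Lemma pderivable_christoffel x d a b : O x -> pderivable (Gam d a b) x.
Proof.
move=> Ox; apply: pderivableM; first exact: pderivable_cst.
apply: pderivable_sum => e _; apply: pderivableM; first exact: pderivable_ginv.
by apply: pderivableB; [apply: pderivableD|]; apply: pderivable_pd_metric.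
Qed.

Lemma christoffel_sym x d a b : O x -> Gam d a b x = Gam d b a x.
Proof.
move=> Ox; congr (_ * _); apply: eq_bigr => e _; congr (_ * _).
rewrite [X in X - _ = _]addrC; congr (_ - _).
by apply: (pd_near _ oO Ox) => y Oy; apply: Gsym.
Qed.

Lemma christoffel_low x f a b : O x ->
  \sum_d G x f d * Gam d a b x = 2^-1 * (pd a (fun y => G y f b) x
     + pd b (fun y => G y f a) x - pd f (fun y => G y a b) x).
Proof.
move=> Ox; rewrite /christoffel; under eq_bigr do rewrite mulrCA mulr_sumr.
rewrite -mulr_sumr; congr (_ * _); rewrite exchange_big /=.
under eq_bigr => e _ do under eq_bigr => d _ do rewrite mulrA.
under eq_bigr => e _ do rewrite -mulr_suml (ginvr (Gunit Ox)).
exact: (sum_delta (fun e => _ + _ - _)).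
Qed.

(** In the sum of the two lowered Christoffel symbols all derivatives of the metric
    but one cancel. *)
Lemma metric_compat x c a b : O x -> pd c (fun y => G y a b) x =
  \sum_e (Gam e c a x * G x e b + Gam e c b x * G x a e).
Proof.
move=> Ox; rewrite big_split /=.
under eq_bigr do rewrite mulrC (Gsym Ox).
under [X in _ + X]eq_bigr do rewrite mulrC.
rewrite !christoffel_low //.
have sw d e f : pd d (fun y => G y e f) x = pd d (fun y => G y f e) x.
  by apply: (pd_near _ oO Ox) => y Oy; apply: Gsym.
rewrite (sw c b a) (sw b c a) (sw a c b) (sw a b c); lra.
Qed.

(** Obtained by differentiating the relation between the metric and its inverse. *)
Lemma ginv_compat x c a b : O x -> pd c (fun y => gi y a b) x =
  - \sum_e (Gam a c e x * gi x e b + Gam b c e x * gi x a e).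
Proof.
move=> Ox.
have key d : \sum_e pd c (fun y => gi y a e) x * G x e d =
   - \sum_e gi x a e * pd c (fun y => G y e d) x.
  apply/eqP; rewrite -addr_eq0 -big_split /=; apply/eqP.
  transitivity (pd c (fun y => \sum_e gi y a e * G y e d) x).
    rewrite pd_sum => [|e _]; last first.
      by apply: pderivableM; [exact: pderivable_ginv|exact: pderivable_metric].
    apply: eq_bigr => e _; rewrite pdM //; [exact: pderivable_ginv|exact: pderivable_metric].
  rewrite (pd_near (h := fun=> (a == d)%:R) _ oO Ox) ?pd_cst // => y Oy.
  by rewrite ginvl // Gunit.
have U := Gunit Ox.
transitivity (\sum_d (\sum_e pd c (fun y => gi y a e) x * G x e d) * gi x d b).
  under eq_bigr => d _ do rewrite mulr_suml.
  rewrite exchange_big /=; under eq_bigr => e _ do under eq_bigr => d _ do rewrite -mulrA.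
  under eq_bigr => e _ do rewrite -mulr_sumr ginvr // mulrC eq_sym.
  by rewrite sum_delta.
under eq_bigr => d _ do rewrite key mulNr.
rewrite sumrN; congr (- _).
under eq_bigr => d _ do under eq_bigr => e _ do rewrite metric_compat //.
transitivity (\sum_d \sum_e \sum_f (gi x a e * Gam f c e x * (G x f d * gi x d b) +
   gi x a e * G x e f * (Gam f c d x * gi x d b))).
  apply: eq_bigr => d _; rewrite mulr_suml; apply: eq_bigr => e _.
  by rewrite mulr_sumr mulr_suml; apply: eq_bigr => f _; ring.
under eq_bigr => d _ do under eq_bigr => e _ do rewrite big_split.
under eq_bigr => d _ do rewrite big_split.
rewrite big_split /= addrC [RHS]big_split /=; congr (_ + _).
  under eq_bigr => d _ do rewrite exchange_big /=.
  under eq_bigr => d _ do under eq_bigr => f _ do rewrite -mulr_suml ginvl //.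
  by under eq_bigr => d _ do rewrite sum_delta.
rewrite exchange_big /=; apply: eq_bigr => e _; rewrite exchange_big /=.
under eq_bigr => f _ do rewrite -mulr_sumr ginvr // mulrC eq_sym.
by rewrite sum_delta mulrC.
Qed.

Section CovariantDerivatives.
Variable m : nat.
Implicit Types (T : 'rV[R]_n -> {ffun 'I_m -> 'I_n} -> R) (a : {ffun 'I_m -> 'I_n}).

Lemma nablaE T c x a : nabla_tensor G T c x a =
  pd c (fun y => T y a) x + sharp (fun d b => Gam d c b x) (T x) a.
Proof. by []. Qed.

(** The components of nabla_d (nabla_c T), where the outer derivative acts on
    the index c as well. *)
Definition nabla2 T d c x a : R :=
  pd d (fun y => nabla_tensor G T c y a) x
  - \sum_e Gam e d c x * nabla_tensor G T e x a
  + sharp (fun e b => Gam e d b x) (nabla_tensor G T c x) a.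

Lemma pderivable_sharp (S : 'rV[R]_n -> 'I_n -> 'I_n -> R) T x a :
  (forall d c, pderivable (fun y => S y d c) x) -> (forall b, pderivable (T^~ b) x) ->
  pderivable (fun y => sharp (S y) (T y) a) x.
Proof.
move=> dS dT; apply: pderivableN; apply: pderivable_sum => j _.
by apply: pderivable_sum => D _; apply: pderivableM.
Qed.

Lemma pd_sharp c (S : 'rV[R]_n -> 'I_n -> 'I_n -> R) T x a :
  (forall d e, pderivable (fun y => S y d e) x) -> (forall b, pderivable (T^~ b) x) ->
  pd c (fun y => sharp (S y) (T y) a) x =
  sharp (fun d e => pd c (fun y => S y d e) x) (T x) a +
  sharp (S x) (fun b => pd c (T^~ b) x) a.
Proof.
move=> dS dT; rewrite pdN; last first.
  by apply: pderivable_sum => j _; apply: pderivable_sum => D _; apply: pderivableM.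
rewrite !sharpE -opprD -big_split; congr (- _).
rewrite pd_sum => [|j _]; last by apply: pderivable_sum => D _; apply: pderivableM.
apply: eq_bigr => j _ /=; rewrite -big_split pd_sum => [|D _]; last exact: pderivableM.
by apply: eq_bigr => D _; rewrite pdM.
Qed.

Lemma pderivable_nabla T c x a : O x -> (forall b, smooth_on O (T^~ b)) ->
  pderivable (fun y => nabla_tensor G T c y a) x.
Proof.
move=> Ox sT; apply: pderivableD; first exact: (smooth_pderivable [:: c] (sT a)).
apply: pderivable_sharp => [d e|b]; first exact: pderivable_christoffel.
exact: (smooth_pderivable [::] (sT b)).
Qed.

(** The second partial derivatives commute and the torsion term drops out, so
    only the derivatives of the Christoffel symbols and the commutator of their
    actions remain; together these form the curvature. *)
Lemma ricci_identity T d c x a : O x -> (forall b, smooth_on O (T^~ b)) ->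
  nabla2 T d c x a - nabla2 T c d x a =
  sharp (fun D C => riemann_up G d c D C x) (T x) a.
Proof.
move=> Ox sT.
have dT b : pderivable (T^~ b) x by exact: (smooth_pderivable [::] (sT b)).
have ddT e b : pderivable (pd e (T^~ b)) x by exact: (smooth_pderivable [:: e] (sT b)).
have dGam := fun e => pderivable_christoffel e _ _ Ox.
have e1 e f : pd e (fun y => nabla_tensor G T f y a) x =
    pd e (pd f (T^~ a)) x + sharp (fun D C => pd e (fun y => Gam D f C y) x) (T x) a +
    sharp (fun D C => Gam D f C x) (fun b => pd e (T^~ b) x) a.
  rewrite pdD ?pd_sharp ?addrA //; apply: pderivable_sharp => //.
have e2 e f : sharp (fun D C => Gam D e C x) (nabla_tensor G T f x) a =
    sharp (fun D C => Gam D e C x) (fun b => pd f (T^~ b) x) a +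
    sharp (fun D C => Gam D e C x) (sharp (fun D C => Gam D f C x) (T x)) a.
  exact: sharpD.
rewrite /nabla2 !e1 !e2 (pd_comm _ _ oO Ox (sT a)).
rewrite (eq_bigr (fun e => Gam e c d x * nabla_tensor G T e x a)); last first.
  by move=> e _; rewrite christoffel_sym.
have -> : sharp (fun D C => riemann_up G d c D C x) (T x) a =
    sharp (fun D C => pd d (fun y => Gam D c C y) x) (T x) a -
    sharp (fun D C => pd c (fun y => Gam D d C y) x) (T x) a +
    (sharp (fun D C => Gam D d C x) (sharp (fun D C => Gam D c C x) (T x)) a -
     sharp (fun D C => Gam D c C x) (sharp (fun D C => Gam D d C x) (T x)) a).
  by rewrite sharp_comm -sharpNl -!sharpDl.
have arith (p u1 u2 m1 m2 g c1 c2 : R) :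
  (p + u1 + m1 - g + (m2 + c1)) - (p + u2 + m2 - g + (m1 + c2)) = u1 - u2 + (c1 - c2).
  by ring.
exact: arith.
Qed.

Lemma alt_nabla T c x : O x -> (forall y, O y -> alternating (T y)) ->
  (forall b, smooth_on O (T^~ b)) -> alternating (nabla_tensor G T c x).
Proof.
move=> Ox aT sT i j a ij; rewrite !nablaE alt_sharp //; last exact: aT.
rewrite (pd_near (h := fun y => - T y a) _ oO Ox); last by move=> y Oy; rewrite aT.
by rewrite pdN ?opprD //; apply: (smooth_pderivable [::] (sT _)).
Qed.

Lemma alt_nabla2 T d c x : O x -> (forall y, O y -> alternating (T y)) ->
  (forall b, smooth_on O (T^~ b)) -> alternating (nabla2 T d c x).
Proof.
move=> Ox aT sT i j a ij; rewrite /nabla2 alt_sharp //; last by apply: alt_nabla.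
rewrite (pd_near (h := fun y => - nabla_tensor G T c y a) _ oO Ox); last first.
  by move=> y Oy; rewrite alt_nabla.
rewrite pdN; last exact: pderivable_nabla.
rewrite (eq_bigr (fun e => - (Gam e d c x * nabla_tensor G T e x a))); last first.
  by move=> e _; rewrite alt_nabla // mulrN.
rewrite sumrN; ring.
Qed.

End CovariantDerivatives.

Lemma sum_ord2 (F : 'I_2 -> R) : \sum_j F j = F ord0 + F ord_max.
Proof. by rewrite big_ord_recl big_ord1; congr (_ + F _); apply: val_inj. Qed.

(** The Ricci identity for the metric, regarded as a 2-tensor, whose covariant
    derivative vanishes. *)
Lemma riemann_skew x a b c d : O x -> riemann G a b c d x = - riemann G a b d c x.
Proof.
move=> Ox; pose T y (i : {ffun 'I_2 -> 'I_n}) := G y (i ord0) (i ord_max).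
have sT i : smooth_on O (T^~ i) by exact: Gsmooth.
have T0 y e i : O y -> nabla_tensor G T e y i = 0.
  move=> Oy; rewrite nablaE sharpE sum_ord2 /T /= metric_compat // big_split /=.
  apply/eqP; rewrite subr_eq0; apply/eqP.
  by congr (_ + _); apply: eq_bigr => D _; rewrite upd_same upd_other.
have T20 e f : nabla2 T e f x (ix2 c d) = 0.
  rewrite /nabla2 (pd_near (h := fun=> 0) _ oO Ox); last by move=> y /T0 ->.
  rewrite pd_cst big1 ?subr0 ?add0r; last by move=> *; rewrite T0 ?mulr0.
  by rewrite -[RHS](sharp0 (fun e0 b => Gam e0 e b x) (ix2 c d)); congr (sharp _ _ _); apply/funext => i; rewrite T0.
have := ricci_identity a b (ix2 c d) Ox sT; rewrite !T20 subrr sharpE sum_ord2 /T.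
have e1 : \sum_D riemann_up G a b D (ix2 c d ord0) x *
    G x (upd_ix (ix2 c d) ord0 D ord0) (upd_ix (ix2 c d) ord0 D ord_max) =
    riemann G a b d c x.
  by apply: eq_bigr => D _; rewrite upd_same upd_other // !ffunE /= mulrC (Gsym Ox).
have e2 : \sum_D riemann_up G a b D (ix2 c d ord_max) x *
    G x (upd_ix (ix2 c d) ord_max D ord0) (upd_ix (ix2 c d) ord_max D ord_max) =
    riemann G a b c d x.
  by apply: eq_bigr => D _; rewrite upd_same upd_other // !ffunE /= mulrC.
by rewrite e1 e2 => /eqP; rewrite eq_sym oppr_eq0 addrC addr_eq0 => /eqP.
Qed.

(** The torsion-free identity: with symmetric Christoffel symbols all terms
    cancel in pairs. *)
Lemma bianchi x a b c d : O x ->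
  riemann_up G a b c d x + riemann_up G b d c a x + riemann_up G d a c b x = 0.
Proof.
move=> Ox; have sw e f h i : pd e (Gam f h i) x = pd e (Gam f i h) x.
  by apply: (pd_near _ oO Ox) => y Oy; apply: christoffel_sym.
have e1 f h i : \sum_e Gam c f e x * Gam e h i x = \sum_e Gam c f e x * Gam e i h x.
  by apply: eq_bigr => e _; congr (_ * _); apply: christoffel_sym.
have arith (p1 p2 p3 q1 q2 q3 s1 s2 s3 t1 t2 t3 : R) :
  p1 = q1 -> p2 = q2 -> p3 = q3 -> s1 = t1 -> s2 = t2 -> s3 = t3 ->
  (p1 - p2 + (s1 - s2)) + (q2 - p3 + (t2 - s3)) + (q3 - q1 + (t3 - t1)) = 0.
  by move=> -> -> -> -> -> ->; ring.
rewrite /riemann_up !sumrB.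
exact: arith (sw a c b d) (sw b c a d) (sw d c b a) (e1 a b d) (e1 b a d) (e1 d b a).
Qed.

Lemma riemann_upN x a b c d : riemann_up G a b c d x = - riemann_up G b a c d x.
Proof.
rewrite /riemann_up !sumrB.
have arith (p1 p2 s1 s2 : R) : p1 - p2 + (s1 - s2) = - (p2 - p1 + (s2 - s1)) by ring.
exact: arith.
Qed.

Lemma riemann_upE x a b c d : O x ->
  riemann_up G a b c d x = \sum_e gi x c e * riemann G a b e d x.
Proof.
move=> Ox; rewrite /riemann; under eq_bigr do rewrite mulr_sumr.
rewrite exchange_big /=; under eq_bigr => e _ do under eq_bigr => f _ do rewrite mulrA.
under eq_bigr do rewrite -mulr_suml ginvl ?Gunit //.
by rewrite sum_delta.
Qed.

(** Trace of the first Bianchi identity; the trace of the curvature over its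
    last two indices vanishes by riemann_skew. *)
Lemma ricci_sym x a b : O x -> ricci G a b x = ricci G b a x.
Proof.
move=> Ox; have : \sum_e (riemann_up G e a e b x + riemann_up G a b e e x + riemann_up G b e e a x) = 0.
  by rewrite big1 // => e _; rewrite bianchi.
have split3 (f g h : 'I_n -> R) : \sum_e (f e + g e + h e) = \sum_e f e + \sum_e g e + \sum_e h e.
  by rewrite !big_split.
rewrite split3.
have -> : \sum_e riemann_up G a b e e x = 0.
  set Z := \sum_e _; suff : Z = - Z by lra.
  rewrite {1}/Z /Z; under eq_bigr do rewrite riemann_upE //.
  rewrite [LHS]exchange_big -sumrN /=; apply: eq_bigr => e _; rewrite -sumrN; apply: eq_bigr => f _.
  rewrite (ginv_sym (Gsym Ox) f e) -mulrN; congr (_ * _); exact: riemann_skew.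
under [X in _ + 0 + X]eq_bigr do rewrite riemann_upN.
by rewrite sumrN addr0 => /eqP; rewrite subr_eq0 => /eqP.
Qed.

Lemma schouten_sym x a b : O x -> schouten G a b x = schouten G b a x.
Proof. by move=> Ox; rewrite /schouten ricci_sym // (Gsym Ox). Qed.

Definition weyl_up a b c d x : R := \sum_e gi x c e * weyl G a b e d x.
Definition schouten_up c a x : R := \sum_e gi x c e * schouten G a e x.

Lemma weyl_skew x a b c d : O x -> weyl G a b c d x = - weyl G a b d c x.
Proof.
move=> Ox; rewrite /weyl riemann_skew //.
have arith (r p1 p2 p3 p4 : R) : - r - (p1 - p2) - (p3 - p4) = - (r - (p4 - p3) - (p2 - p1)) by ring.
exact: arith.
Qed.

Lemma riemann_up_weyl x a b c d : O x -> riemann_up G a b c d x =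
  weyl_up a b c d x + ((c == a)%:R * schouten G b d x - (c == b)%:R * schouten G a d x
    + G x d b * schouten_up c a x - G x d a * schouten_up c b x).
Proof.
move=> Ox; rewrite riemann_upE // -!(ginvl (Gunit Ox)) /weyl_up /schouten_up !mulr_suml !mulr_sumr.
rewrite -sumrB -big_split -sumrB -big_split /=; apply: eq_bigr => e _.
rewrite /weyl.
have arith (i r g1 g2 g3 g4 p1 p2 p3 p4 : R) : i * r =
  i * (r - (g1 * p1 - g2 * p2) - (g3 * p3 - g4 * p4)) +
  (i * g1 * p1 - i * g2 * p2 + g3 * (i * p3) - g4 * (i * p4)) by ring.
exact: arith.
Qed.

End Geometry.

(** * Components of the modified tractor connection *)

(** The hypotheses on T are what the two extensions have in common: they are skew
    in their slots, and a component with a slot Y or with two slots X vanishes. *)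
Section TractorComponents.
Context {R : realType} {n : nat}.
Variables (G : 'rV[R]_n -> 'M[R]_n) (O : set 'rV[R]_n) (x : 'rV[R]_n).
Hypothesis oO : open O.
Hypothesis Ox : O x.
Hypothesis gsym : forall a b, G x a b = G x b a.

Notation gi := (ginv G).
Notation Gam := (christoffel G).

Lemma sum_tix (F : tix n -> R) : \sum_E F E = F tY + F tX + \sum_d F (tZ d).
Proof. by rewrite big_sumType big_bool. Qed.

Lemma Zt_tZ (d e : 'I_n) : Zt (tZ d) e = (d == e)%:R :> R.
Proof. by []. Qed.

Variables (m l : nat) (T : @ttfield R n m l).
Implicit Types (a : {ffun 'I_m -> 'I_n}) (b : {ffun 'I_l -> 'I_n}) (B : {ffun 'I_l -> tix n}).

(** The index of a component in which all slots are Z. *)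
Definition zword b : {ffun 'I_l -> tix n} := [ffun i => tZ (b i)].

Lemma upd_zword b j d : upd_ix (zword b) j (tZ d) = zword (upd_ix b j d).
Proof. by apply/ffunP => i; rewrite !ffunE; case: eqP. Qed.

Hypothesis TY : forall y a B i, O y -> B i = tY -> T y a B = 0.
Hypothesis TXX : forall y a B i j, O y -> i != j -> B i = tX -> B j = tX -> T y a B = 0.
Hypothesis Talt : forall y a, O y -> alternating (T y a).
Hypothesis Tder : forall a B, pderivable (fun y => T y a B) x.

Lemma alt_nabla_x r c a : alternating (nabla_x G r T c x a).
Proof.
move=> i j B ij; rewrite /nabla_x.
have e1 : nabla_tractor G T c x a (swap_ix B i j) = - nabla_tractor G T c x a B.
  rewrite /nabla_tractor alt_sharp //; last exact: Talt.
  rewrite (pd_near (h := fun y => - T y a B) _ oO Ox); last by move=> y Oy; rewrite Talt.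
  rewrite pdN //.
  have -> : (fun a' : {ffun 'I_m -> 'I_n} => T x a' (swap_ix B i j)) = (fun a' => - T x a' B).
    by apply/funext => a'; rewrite Talt.
  by rewrite sharpN !opprD.
have e2 : kappa_sharp G T c x a (swap_ix B i j) = - kappa_sharp G T c x a B.
  by apply: alt_sharp_gen => // D C; apply: alt_sharp; apply: Talt.
have e3 : omega_sharp G T c x a (swap_ix B i j) = - omega_sharp G T c x a B.
  apply: alt_sharp_gen => // D C i' j' B' ij'.
  rewrite (_ : (fun a' : {ffun 'I_m -> 'I_n} => _) = (fun a' => - T x a' B')) ?sharpN //.
  by apply/funext => a'; rewrite Talt.
rewrite e1 e2 e3; ring.
Qed.

(** With E0 raised, the endomorphism X_[E0 Z_E1]^e maps the middle slot to the
    bottom one and the top slot to the middle one; as top slots vanish, only the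
    former is seen. *)
Lemma XZ_action (W : 'I_n -> {ffun 'I_l -> tix n} -> R) B :
  (forall e B' i, B' i = tY -> W e B' = 0) ->
  sharp_gen (fun E0 E1 B' => \sum_A tractor_metric G x E0 A * \sum_e XZ A E1 e * W e B') B =
  2^-1 * \sum_(j | B j == tX) \sum_d \sum_e gi x d e * W e (upd_ix B j (tZ d)).
Proof.
move=> WY; rewrite /sharp_gen -mulN1r [in RHS]big_mkcond !mulr_sumr; apply: eq_bigr => j _ /=.
have tYE A : \sum_e XZ A (B j) e * W e (upd_ix B j tY) = 0.
  by rewrite big1 // => e _; rewrite (WY _ _ j) ?mulr0 // upd_same.
have tXE D : \sum_(e < n) XZ tY (B j) e * W e (upd_ix B j D) = 0.
  by rewrite big1 // => e _; rewrite /XZ /Xt /Zt /= !mul0r mulr0 subrr mulr0 mul0r.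
have tZE d d' : \sum_(e < n) XZ (tZ d') (B j) e * W e (upd_ix B j (tZ d)) =
   - (2^-1 * ((B j == tX)%:R * W d' (upd_ix B j (tZ d)))).
  rewrite (bigD1 d') //= [X in _ + X]big1 ?addr0 => [|e ed]; last first.
    by rewrite /XZ Zt_tZ [d' == e]eq_sym (negbTE ed) /Xt /= mul0r mulr0 subrr mulr0 mul0r.
  rewrite /XZ /Xt /Zt /= eqxx mul0r mulr1 sub0r; ring.
rewrite sum_tix [X in -1 * (X + _ + _)]big1 => [|A _]; last by rewrite tYE mulr0.
rewrite add0r [X in -1 * (X + _)](_ : _ = 0) ?add0r; last first.
  by rewrite sum_tix tXE mulr0 /= !mul0r !add0r big1 // => d _; rewrite mul0r.
rewrite mulN1r -sumrN; case: ifP => BX; last first.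
  rewrite mulr0 big1 // => d _; rewrite sum_tix /= !mul0r !add0r big1 ?oppr0 // => e _.
  by rewrite tZE BX mul0r mulr0 oppr0 mulr0.
rewrite mulr_sumr; apply: eq_bigr => d _; rewrite sum_tix /= !mul0r !add0r -sumrN mulr_sumr.
by apply: eq_bigr => e _; rewrite tZE BX mul1r mulrN opprK mulrCA.
Qed.

Definition tractor_curv_up c e F0 F1 : R :=
  \sum_B tractor_metric G x F0 B * tractor_curv G c e B F1 x.

Lemma tractor_curv_Y c e F0 : tractor_curv G c e F0 tY x = 0.
Proof.
rewrite /tractor_curv big1 ?sub0r => [|d _]; last by rewrite big1 // => f _; rewrite mulr0 mul0r.
by rewrite big1 ?oppr0 // => d _; rewrite /Zt /Xt /= mulr0 mul0r subrr mul0r.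
Qed.

Lemma tractor_curv_Yl c e F1 : tractor_curv G c e tY F1 x = 0.
Proof.
rewrite /tractor_curv big1 ?sub0r => [|d _]; last by rewrite big1 // => f _; rewrite !mul0r.
by rewrite big1 ?oppr0 // => d _; rewrite /Zt /Xt /= mulr0 mul0r subrr mul0r.
Qed.

Lemma tractor_curv_ZZ c e f g : tractor_curv G c e (tZ f) (tZ g) x = weyl G c e f g x.
Proof.
rewrite /tractor_curv [X in _ - X]big1 ?subr0 => [|d _]; last first.
  by rewrite /Xt /= !mul0r subrr mul0r.
rewrite (bigD1 f) //= [X in _ + X]big1 ?addr0 => [|d df]; last first.
  by rewrite big1 // => h _; rewrite Zt_tZ [f == d]eq_sym (negbTE df) !mul0r.
rewrite (bigD1 g) //= [X in _ + X]big1 ?addr0 => [|d df]; last first.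
  by rewrite [Zt (tZ g) d]Zt_tZ [g == d]eq_sym (negbTE df) mulr0 mul0r.
by rewrite !Zt_tZ !eqxx !mul1r.
Qed.

Lemma curv_action_Y c e a B i : B i = tY ->
  sharp (tractor_curv_up c e) (T x a) B = 0.
Proof.
move=> Bi; rewrite sharpE big1 ?oppr0 // => j _; rewrite big1 // => D _.
have [->|ji] := eqVneq j i.
  by rewrite Bi /tractor_curv_up big1 ?mul0r // => F _; rewrite tractor_curv_Y mulr0.
by rewrite (@TY _ _ _ i) ?mulr0 // upd_other // eq_sym.
Qed.

(** The Cotton part of the tractor curvature only multiplies components with a
    slot Y, which vanish; what remains is the Weyl tensor. *)
Lemma curv_action_Z c e a b :
  sharp (tractor_curv_up c e) (T x a) (zword b) =
  sharp (fun f g => weyl_up G c e f g x) (fun b' => T x a (zword b')) b.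
Proof.
rewrite !sharpE; congr (- _); apply: eq_bigr => j _; rewrite sum_tix.
rewrite (@TY _ _ _ j) ?mulr0 ?add0r // ?upd_same //.
rewrite ffunE [tractor_curv_up _ _ tX _]/tractor_curv_up sum_tix tractor_curv_Yl /= mulr0 mul0r !add0r.
rewrite big1 ?mul0r ?add0r => [|d _]; last by rewrite mul0r.
apply: eq_bigr => f _; rewrite -upd_zword; congr (_ * _).
rewrite /tractor_curv_up sum_tix /= !mul0r !add0r /weyl_up; apply: eq_bigr => d _.
by rewrite tractor_curv_ZZ.
Qed.

(** The factor X_[E0 Z_E1]^e of kappa and of omega commutes with the action of
    their other factor, a curvature tensor V with its index lowered by h. *)
Lemma sharp_XZ (J : finType) p (h : J -> J -> R) (V : 'I_n -> J -> J -> R) E0 E1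
    (F : {ffun 'I_p -> J} -> R) u :
  sharp (fun F0 F1 => \sum_A \sum_B
    tractor_metric G x E0 A * h F0 B * \sum_e XZ A E1 e * V e B F1) F u =
  \sum_A tractor_metric G x E0 A *
    \sum_e XZ A E1 e * sharp (fun F0 F1 => \sum_B h F0 B * V e B F1) F u.
Proof.
rewrite sharpE -mulN1r; under [RHS]eq_bigr => A _ do
   [under eq_bigr => e _ do rewrite sharpE mulrN -mulN1r; rewrite -mulr_sumr mulrCA].
rewrite -mulr_sumr; congr (_ * _).
under [RHS]eq_bigr => A _.
  under eq_bigr => e _ do rewrite mulr_sumr.
  rewrite exchange_big mulr_sumr /=; over.
rewrite [RHS]exchange_big /=; apply: eq_bigr => j _.
under [RHS]eq_bigr => A _.
  under eq_bigr => e _ do rewrite mulr_sumr.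
  rewrite exchange_big mulr_sumr /=; over.
rewrite [RHS]exchange_big /=; apply: eq_bigr => D _.
rewrite mulr_suml; apply: eq_bigr => A _.
rewrite mulr_suml mulr_sumr.
under [RHS]eq_bigr => e _ do rewrite mulr_suml mulr_sumr mulr_sumr.
rewrite [RHS]exchange_big /=; apply: eq_bigr => B _.
rewrite mulr_sumr mulr_suml; apply: eq_bigr => e _; ring.
Qed.

Lemma kappa_sharpE c a B : kappa_sharp G T c x a B =
  2^-1 * \sum_(j | B j == tX) \sum_d \sum_e gi x d e *
    sharp (tractor_curv_up c e) (T x a) (upd_ix B j (tZ d)).
Proof.
rewrite -(XZ_action (W := fun e B' => sharp (tractor_curv_up c e) (T x a) B')); last first.
  by move=> e B' i; apply: curv_action_Y.
apply: eq_sharp_gen => E0 E1 B'.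
exact: (sharp_XZ (tractor_metric G x) (fun e f g => tractor_curv G c e f g x)).
Qed.

Lemma omega_sharpE c a B : omega_sharp G T c x a B =
  2^-1 * \sum_(j | B j == tX) \sum_d \sum_e gi x d e *
    sharp (fun f g => weyl_up G c e f g x) (fun a' => T x a' (upd_ix B j (tZ d))) a.
Proof.
rewrite -(XZ_action (W := fun e B' => sharp (fun f g => weyl_up G c e f g x) (fun a' => T x a' B') a));
  last first.
  move=> e B' i BY; rewrite -[RHS](sharp0 (fun f g => weyl_up G c e f g x) a).
  by congr (sharp _ _ _); apply/funext => a'; apply: TY BY.
apply: eq_sharp_gen => E0 E1 B'.
exact: (sharp_XZ (gi x) (fun e f g => weyl G c e f g x)).
Qed.

(** The curvature terms of nabla^x only feed components that have a slot X. *)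
Lemma curvature_noX c a B : (forall j, B j != tX) ->
  omega_sharp G T c x a B = 0 /\ kappa_sharp G T c x a B = 0.
Proof.
move=> BX; rewrite omega_sharpE kappa_sharpE !big_pred0 ?mulr0 // => j; exact: negbTE.
Qed.

Lemma curvature_Y c a B i : B i = tY ->
  omega_sharp G T c x a B = 0 /\ kappa_sharp G T c x a B = 0.
Proof.
move=> BY; rewrite omega_sharpE kappa_sharpE.
have key j d : B j == tX -> upd_ix B j (tZ d) i = tY.
  by move=> BX; rewrite upd_other //; apply: contraTneq BX => <-; rewrite BY.
split; (rewrite big1 ?mulr0 // => j BX; rewrite big1 // => d _; rewrite big1 // => e _).
  rewrite (_ : (fun a' : {ffun 'I_m -> 'I_n} => _) = (fun=> 0)) ?sharp0 ?mulr0 //.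
  by apply/funext => a'; apply: TY Ox (key j d BX).
by rewrite (curv_action_Y _ _ _ (key j d BX)) mulr0.
Qed.

Lemma sharpT_Y S a B i : B i = tY -> sharp S (fun a' : {ffun 'I_m -> 'I_n} => T x a' B) a = 0.
Proof.
move=> BY; rewrite -[RHS](sharp0 S a); congr (sharp _ _ _).
by apply/funext => a'; apply: TY BY.
Qed.

Lemma pdT_Y c a B i : B i = tY -> pd c (fun y => T y a B) x = 0.
Proof.
move=> BY; rewrite (pd_near (h := fun=> 0) _ oO Ox) ?pd_cst // => y Oy; exact: TY BY.
Qed.

Lemma nabla_x_Z r c a b : nabla_x G r T c x a (zword b) =
  pd c (fun y => T y a (zword b)) x
  + sharp (fun d e => Gam d c e x) (fun a' => T x a' (zword b)) a
  + sharp (fun d e => Gam d c e x) (fun b' => T x a (zword b')) b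
  + \sum_j G x c (b j) * T x a (upd_ix (zword b) j tX).
Proof.
rewrite /nabla_x.
have [|-> ->] := @curvature_noX c a (zword b); first by move=> j; rewrite ffunE.
rewrite addr0 mulr0 addr0 /nabla_tractor -[RHS]addrA; congr (_ + _).
rewrite !sharpE -sumrN -[X in _ = X + _]sumrN -big_split /=; apply: eq_bigr => j _.
rewrite sum_tix (@TY _ _ _ j) ?mulr0 ?add0r // ?upd_same // ffunE /= mulNr opprD opprK addrC.
congr (_ - _); apply: eq_bigr => d _.
by rewrite upd_zword.
Qed.

Lemma nabla_x_Y r c a b j :
  nabla_x G r T c x a (upd_ix (zword b) j tY) = - T x a (zword (upd_ix b j c)).
Proof.
rewrite /nabla_x.
have BY : upd_ix (zword b) j tY j = tY by rewrite upd_same.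
have [-> ->] := curvature_Y c a BY.
rewrite addr0 mulr0 addr0 /nabla_tractor (pdT_Y _ _ BY) (sharpT_Y _ _ BY) !add0r.
rewrite sharpE (bigD1 j) //= [X in _ + X]big1 ?addr0 => [|i ij]; last first.
  rewrite big1 // => D _; rewrite (@TY _ _ _ j) ?mulr0 // upd_other ?upd_same // eq_sym //.
rewrite upd_same sum_tix /= !mul0r !add0r; congr (- _).
rewrite -(sum_delta (fun d => T x a (zword (upd_ix b j d)))); apply: eq_bigr => d _.
by rewrite upd_upd upd_zword eq_sym.
Qed.

Lemma nabla_x_XY r c a b i j : i != j ->
  nabla_x G r T c x a (upd_ix (upd_ix (zword b) i tX) j tY) =
  - T x a (upd_ix (zword (upd_ix b j c)) i tX).
Proof.
move=> ij; rewrite /nabla_x; set B := upd_ix _ j tY.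
have BY : B j = tY by rewrite upd_same.
have [-> ->] := curvature_Y c a BY.
rewrite addr0 mulr0 addr0 /nabla_tractor (pdT_Y _ _ BY) (sharpT_Y _ _ BY) !add0r.
rewrite sharpE (bigD1 j) //= [X in _ + X]big1 ?addr0 => [|i' ij']; last first.
  rewrite big1 // => D _; rewrite (@TY _ _ _ j) ?mulr0 // upd_other ?upd_same // eq_sym //.
rewrite BY sum_tix /= !mul0r !add0r; congr (- _).
rewrite -(sum_delta (fun d => T x a (upd_ix (zword (upd_ix b j d)) i tX))); apply: eq_bigr => d _.
by rewrite upd_upd -upd_zword updC // eq_sym.
Qed.

(** The tractor connection feeds a slot X from a slot Z through the Schouten
    tensor, and the curvature terms feed it through the Weyl tensor, acting on
    the tensor indices and on the slots Z alike; the factor 1/2 stems from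
    X_[E0 Z_E1]. *)
Lemma nabla_x_X r c a b j : nabla_x G r T c x a (upd_ix (zword b) j tX) =
  pd c (fun y => T y a (upd_ix (zword b) j tX)) x
  + sharp (fun d e => Gam d c e x) (fun a' => T x a' (upd_ix (zword b) j tX)) a
  - \sum_(i | i != j) \sum_d Gam d c (b i) x * T x a (upd_ix (zword (upd_ix b i d)) j tX)
  - \sum_d schouten_up G d c x * T x a (zword (upd_ix b j d))
  + r / 2 * \sum_d \sum_e gi x d e *
     (sharp (fun f g => weyl_up G c e f g x) (fun a' => T x a' (zword (upd_ix b j d))) a
      + sharp (fun f g => weyl_up G c e f g x) (fun b' => T x a (zword b')) (upd_ix b j d)).
Proof.
rewrite /nabla_x omega_sharpE kappa_sharpE; set B := upd_ix _ j tX.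
have Bj i : (B i == tX) = (i == j) by rewrite /B ffunE; case: (eqVneq i j) => _; rewrite ?eqxx // ffunE.
rewrite !(big_pred1 _ Bj).
have -> : \sum_d \sum_e gi x d e *
     sharp (fun f g => weyl_up G c e f g x) (fun a' => T x a' (upd_ix B j (tZ d))) a =
   \sum_d \sum_e gi x d e *
     sharp (fun f g => weyl_up G c e f g x) (fun a' => T x a' (zword (upd_ix b j d))) a.
  by apply: eq_bigr => d _; rewrite upd_upd upd_zword.
have -> : \sum_d \sum_e gi x d e * sharp (tractor_curv_up c e) (T x a) (upd_ix B j (tZ d)) =
   \sum_d \sum_e gi x d e *
     sharp (fun f g => weyl_up G c e f g x) (fun b' => T x a (zword b')) (upd_ix b j d).
  by apply: eq_bigr => d _; apply: eq_bigr => e _; rewrite upd_upd upd_zword curv_action_Z.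
congr (_ + _); last first.
  rewrite -mulrDr mulrA; congr (_ * _); rewrite -big_split; apply: eq_bigr => d _ /=.
  by rewrite -big_split; apply: eq_bigr => e _; rewrite mulrDr.
rewrite /nabla_tractor -!addrA; congr (_ + (_ + _)).
rewrite -opprD sharpE (bigD1 j) //= addrC; congr (- (_ + _)).
  apply: eq_bigr => i ij; rewrite upd_other // ffunE sum_tix /=.
  rewrite (@TY _ _ _ i) ?upd_same // (@TXX _ _ _ i j) ?upd_same //; last first.
    by rewrite upd_other ?upd_same // eq_sym.
  rewrite !mulr0 !add0r; apply: eq_bigr => d _; rewrite -upd_zword updC //.
rewrite upd_same sum_tix /= !mul0r !add0r; apply: eq_bigr => d _.
rewrite upd_upd upd_zword; congr (_ * _); apply: eq_bigr => e _.
by rewrite (ginv_sym gsym).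
Qed.

(** Components with two slots X or with two slots Y vanish by skew symmetry, which
    leaves four kinds. On those with a slot Y the derivative is algebraic, since T
    itself has no such components. *)
Lemma cartan_proj_nabla_x r :
  (forall b c a, cartan_proj G x (fun c a => nabla_x G r T c x a (zword b)) c a = 0) ->
  (forall b j c a, cartan_proj G x (fun c a => nabla_x G r T c x a (upd_ix (zword b) j tX)) c a = 0) ->
  (forall b j c a, cartan_proj G x (fun c a => T x a (zword (upd_ix b j c))) c a = 0) ->
  (forall b i j c a, i != j ->
     cartan_proj G x (fun c a => T x a (upd_ix (zword (upd_ix b j c)) i tX)) c a = 0) ->
  forall B c a, cartan_proj G x (fun c a => nabla_x G r T c x a B) c a = 0.
Proof.
move=> HZ HX HY HXY B c a.
have [/existsP[i /existsP[j /and3P[ij /eqP Bij Bi]]]|] :=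
  boolP [exists i, exists j, [&& i != j, B i == B j & (B i == tX) || (B i == tY)]].
  rewrite -[RHS](cartan_proj0 G x c a); apply: eq_cartan_proj => d a'.
  exact: alt_eq0 (alt_nabla_x r d a') ij Bij.
move=> /existsPn h; have {}h i j : (B i == tX) || (B i == tY) -> B j = B i -> i = j.
  move=> Bi Bj; apply/eqP; have /existsPn/(_ j) := h i.
  by rewrite Bj eqxx Bi !andbT negbK.
pose b := [ffun t => if B t is inr d then d else c].
have BZ t : B t != tX -> B t != tY -> B t = tZ (b t).
  by rewrite ffunE; case: (B t) => [[]|d].
have [i /eqP BiX|noX] := pickP (fun t => B t == tX); have [j /eqP BjY|noY] := pickP (fun t => B t == tY).
- have ij : i != j by apply/eqP => e; move: BjY; rewrite -e BiX.
  have -> : B = upd_ix (upd_ix (zword b) i tX) j tY.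
    apply/ffunP => t; rewrite [RHS]ffunE; case: (eqVneq t j) => [->//|tj].
    rewrite [RHS]ffunE; case: (eqVneq t i) => [->//|ti]; rewrite [RHS]ffunE; apply: BZ.
      by apply: contraNneq ti => e; apply/eqP/esym/h; rewrite ?BiX ?eqxx.
    by apply: contraNneq tj => e; apply/eqP/esym/h; rewrite ?BjY ?eqxx ?orbT.
  under eq_cartan_proj => d a' do rewrite nabla_x_XY // -mulN1r.
  by rewrite cartan_projZ HXY // mulr0.
- have -> : B = upd_ix (zword b) i tX.
    apply/ffunP => t; rewrite [RHS]ffunE; case: (eqVneq t i) => [->//|ti]; rewrite [RHS]ffunE; apply: BZ.
      by apply: contraNneq ti => e; apply/eqP/esym/h; rewrite ?BiX ?eqxx.
    by rewrite noY.
  exact: HX.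
- have -> : B = upd_ix (zword b) j tY.
    apply/ffunP => t; rewrite [RHS]ffunE; case: (eqVneq t j) => [->//|tj]; rewrite [RHS]ffunE; apply: BZ.
      by rewrite noX.
    by apply: contraNneq tj => e; apply/eqP/esym/h; rewrite ?BjY ?eqxx ?orbT.
  under eq_cartan_proj => d a' do rewrite nabla_x_Y // -mulN1r.
  by rewrite cartan_projZ HY // mulr0.
have -> : B = zword b by apply/ffunP => t; rewrite [RHS]ffunE; apply: BZ; rewrite ?noX ?noY.
exact: HZ.
Qed.

End TractorComponents.

(** * Differentiation of the conformal Killing equation *)

Section SecondDerivatives.
Context {R : realType} {n : nat}.
Variables (G : 'rV[R]_n -> 'M[R]_n) (O : set 'rV[R]_n).
Hypothesis oO : open O.
Hypothesis Gsym : forall x, O x -> forall a b, G x a b = G x b a.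
Hypothesis Gunit : forall x, O x -> G x \in unitmx.
Hypothesis Gsmooth : forall a b, smooth_on O (fun x => G x a b).

Notation gi := (ginv G).
Notation Gam := (christoffel G).

Section CovariantOneForms.
Variable m : nat.
Implicit Types (S : 'I_n -> 'rV[R]_n -> {ffun 'I_m -> 'I_n} -> R) (a : {ffun 'I_m -> 'I_n}).

(** The covariant derivative of a tensor with one index separated from the
    others, as it is the case for the derivative of a form. *)
Definition nabla_form S d c x a : R :=
  pd d (fun y => S c y a) x - \sum_e Gam e d c x * S e x a
  + sharp (fun e b => Gam e d b x) (S c x) a.

Lemma nabla_formB S S' d c x a :
  (forall c a, pderivable (fun y => S c y a) x) -> (forall c a, pderivable (fun y => S' c y a) x) ->
  nabla_form (fun c y a => S c y a - S' c y a) d c x a =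
  nabla_form S d c x a - nabla_form S' d c x a.
Proof.
move=> dS dS'; rewrite /nabla_form pdB // sharpD sharpN.
have -> : \sum_e Gam e d c x * (S e x a - S' e x a) =
  \sum_e Gam e d c x * S e x a - \sum_e Gam e d c x * S' e x a.
  by rewrite -sumrB; apply: eq_bigr => e _; rewrite mulrBr.
have arith (p p' g g' s s' : R) : p - p' - (g - g') + (s - s') = p - g + s - (p' - g' + s') by ring.
exact: arith.
Qed.

Lemma nabla_formZ S (r : R) d c x a :
  (forall c a, pderivable (fun y => S c y a) x) ->
  nabla_form (fun c y a => r * S c y a) d c x a = r * nabla_form S d c x a.
Proof.
move=> dS; rewrite /nabla_form pdZ // sharpZ.
under eq_bigr do rewrite mulrCA.
by rewrite -mulr_sumr -mulrBr -mulrDr.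
Qed.

Lemma nabla_form_sum (F : 'I_m -> 'I_n -> 'rV[R]_n -> {ffun 'I_m -> 'I_n} -> R) d c x a :
  (forall j c a, pderivable (fun y => F j c y a) x) ->
  nabla_form (fun c y a => \sum_j F j c y a) d c x a = \sum_j nabla_form (F j) d c x a.
Proof.
move=> dF; rewrite /nabla_form pd_sum // sharp_sum.
under [X in _ - X + _]eq_bigr do rewrite mulr_sumr.
rewrite [X in _ - X + _]exchange_big /= -sumrB -big_split /=.
by apply: eq_bigr => j _.
Qed.

Lemma eq_nabla_form S S' d c x a : O x ->
  (forall c y a, O y -> S c y a = S' c y a) -> nabla_form S d c x a = nabla_form S' d c x a.
Proof.
move=> Ox e; rewrite /nabla_form (pd_near (h := fun y => S' c y a) _ oO Ox); last by move=> y; apply: e.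
congr (_ - _ + _); first by apply: eq_bigr => f _; rewrite e.
by congr (sharp _ _ _); apply/funext => b; rewrite e.
Qed.

(** Which of the indices is separated is irrelevant to the covariant derivative. *)
Lemma nabla_form_insert S j d c x a :
  nabla_form (fun c y a => S (a j) y (upd_ix a j c)) d c x a =
  nabla_form S d (a j) x (upd_ix a j c).
Proof.
rewrite /nabla_form -!addrA; congr (_ + _).
rewrite !sharpE (bigD1 j) //= [in RHS](bigD1 j) //= upd_same.
have -> : \sum_D Gam D d (a j) x * S (upd_ix a j D j) x (upd_ix (upd_ix a j D) j c) =
          \sum_D Gam D d (a j) x * S D x (upd_ix a j c).
  by apply: eq_bigr => D _; rewrite upd_same upd_upd.
have -> : \sum_D Gam D d c x * S (a j) x (upd_ix (upd_ix a j c) j D) =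
          \sum_D Gam D d c x * S (a j) x (upd_ix a j D).
  by apply: eq_bigr => D _; rewrite upd_upd.
have -> : \sum_(i < m | i != j) \sum_D Gam D d (a i) x * S (upd_ix a i D j) x (upd_ix (upd_ix a i D) j c) =
    \sum_(i < m | i != j) \sum_D Gam D d (upd_ix a j c i) x * S (a j) x (upd_ix (upd_ix a j c) i D).
  apply: eq_bigr => i ij; apply: eq_bigr => D _.
  have ji : j != i by rewrite eq_sym.
  by rewrite (upd_other _ _ ij) (upd_other _ _ ji) (updC a D c ij).
have arith (p q r : R) : - p - (q + r) = - q - (p + r) by ring.
exact: arith.
Qed.

(** The inverse metric is parallel, so contraction with it commutes with covariant
    derivatives. *)
Lemma pd_contract (F : 'I_n -> 'I_n -> 'rV[R]_n -> R) d x : O x ->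
  (forall p q, pderivable (F p q) x) ->
  pd d (fun y => \sum_p \sum_q gi y p q * F p q y) x =
  \sum_p \sum_q gi x p q *
    (pd d (F p q) x - \sum_e Gam e d p x * F e q x - \sum_e Gam e d q x * F p e x).
Proof.
move=> Ox dF; have dgi p q := pderivable_ginv oO Gunit Gsmooth p q Ox.
rewrite pd_sum => [|p _]; last by apply: pderivable_sum => q _; apply: pderivableM.
transitivity (\sum_p \sum_q (pd d (fun y => gi y p q) x * F p q x + gi x p q * pd d (F p q) x)).
  apply: eq_bigr => p _; rewrite pd_sum => [|q _]; last exact: pderivableM.
  by apply: eq_bigr => q _; rewrite pdM.
have e1 : \sum_p \sum_q gi x p q * (\sum_e Gam e d p x * F e q x) =
          \sum_p \sum_q (\sum_e Gam p d e x * gi x e q) * F p q x.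
  under eq_bigr => p _ do under eq_bigr => q _ do rewrite mulr_sumr.
  under eq_bigr => p _ do rewrite exchange_big /=.
  rewrite exchange_big /=; apply: eq_bigr => p _; rewrite exchange_big /=; apply: eq_bigr => q _.
  by rewrite mulr_suml; apply: eq_bigr => e _; ring.
have e2 : \sum_p \sum_q gi x p q * (\sum_e Gam e d q x * F p e x) =
          \sum_p \sum_q (\sum_e Gam q d e x * gi x p e) * F p q x.
  apply: eq_bigr => p _; under eq_bigr => q _ do rewrite mulr_sumr.
  rewrite exchange_big /=; apply: eq_bigr => q _.
  by rewrite mulr_suml; apply: eq_bigr => e _; ring.
under [RHS]eq_bigr => p _ do under eq_bigr => q _ do rewrite !mulrBr.
under [RHS]eq_bigr => p _ do rewrite !sumrB.
rewrite !sumrB e1 e2 -!sumrB; apply: eq_bigr => p _; rewrite -!sumrB; apply: eq_bigr => q _.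
rewrite (ginv_compat oO Gsym Gunit Gsmooth) // big_split /=; ring.
Qed.

(** By pd_contract; on the left-hand side, the connection acts only on the positions
    that survive the trace. *)
Lemma nabla_mtrace S j d x a : O x ->
  (forall c a, pderivable (fun y => S c y a) x) ->
  pd d (fun y => mtrace G y (fun p => S p y) a j) x
  - \sum_(i | i != j) \sum_D Gam D d (a i) x * mtrace G x (fun p => S p x) (upd_ix a i D) j =
  mtrace G x (fun p => nabla_form S d p x) a j.
Proof.
move=> Ox dS; rewrite /mtrace (pd_contract (F := fun p q y => S p y (upd_ix a j q))) //.
have -> : \sum_(i < m | i != j) \sum_D Gam D d (a i) x *
      \sum_p \sum_q gi x p q * S p x (upd_ix (upd_ix a i D) j q) =
   \sum_p \sum_q gi x p q * \sum_(i < m | i != j) \sum_D Gam D d (a i) x *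
       S p x (upd_ix (upd_ix a i D) j q).
  under [RHS]eq_bigr => p _ do under eq_bigr => q _ do
    [rewrite mulr_sumr; under eq_bigr => i _ do rewrite mulr_sumr].
  under [RHS]eq_bigr => p _ do rewrite exchange_big /=.
  rewrite [RHS]exchange_big /=; apply: eq_bigr => i _.
  under [RHS]eq_bigr => p _ do rewrite exchange_big /=.
  rewrite [RHS]exchange_big /=; apply: eq_bigr => D _.
  rewrite mulr_sumr; apply: eq_bigr => p _; rewrite mulr_sumr; apply: eq_bigr => q _.
  exact: mulrCA.
rewrite -sumrB; apply: eq_bigr => p _; rewrite -sumrB; apply: eq_bigr => q _.
rewrite -mulrBr; congr (_ * _); rewrite /nabla_form sharpE [in RHS](bigD1 j) //= upd_same opprD addrA.
congr (_ - _ - _).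
  by apply: eq_bigr => e _; rewrite upd_upd.
apply: eq_bigr => i ij; apply: eq_bigr => D _.
by rewrite (upd_other _ _ ij) (updC a D q ij).
Qed.

Lemma pderivable_mtrace S j x a : O x -> (forall c a, pderivable (fun y => S c y a) x) ->
  pderivable (fun y => mtrace G y (fun p => S p y) a j) x.
Proof.
move=> Ox dS; apply: pderivable_sum => p _; apply: pderivable_sum => q _.
apply: pderivableM => //; exact: (pderivable_ginv oO Gunit Gsmooth).
Qed.

Lemma nabla_form_trace S j d c x a : O x ->
  (forall c a, pderivable (fun y => S c y a) x) ->
  nabla_form (fun c y a => G y c (a j) * mtrace G y (fun p => S p y) a j) d c x a =
  G x c (a j) * mtrace G x (fun p => nabla_form S d p x) a j.
Proof.
move=> Ox dS; rewrite -nabla_mtrace // /nabla_form.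
rewrite pdM; [|exact: pderivable_metric|exact: pderivable_mtrace].
rewrite (metric_compat oO Gsym Gunit) // big_split /=.
rewrite sharpE (bigD1 j) //=.
have trI b e : mtrace G x (fun p => S p x) (upd_ix b j e) j = mtrace G x (fun p => S p x) b j.
  by apply: eq_bigr => p _; apply: eq_bigr => q _; rewrite upd_upd.
have -> : \sum_D Gam D d (a j) x * (G x c (upd_ix a j D j) *
     mtrace G x (fun p => S p x) (upd_ix a j D) j) =
   (\sum_D Gam D d (a j) x * G x c D) * mtrace G x (fun p => S p x) a j.
  by rewrite mulr_suml; apply: eq_bigr => D _; rewrite upd_same trI mulrA.
have -> : \sum_(i < m | i != j) \sum_D Gam D d (a i) x * (G x c (upd_ix a i D j) *
     mtrace G x (fun p => S p x) (upd_ix a i D) j) =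
   G x c (a j) * \sum_(i < m | i != j) \sum_D Gam D d (a i) x *
      mtrace G x (fun p => S p x) (upd_ix a i D) j.
  rewrite mulr_sumr; apply: eq_bigr => i ij; rewrite mulr_sumr; apply: eq_bigr => D _.
  by rewrite (upd_other a D) 1?eq_sym // mulrCA.
have -> : \sum_e Gam e d c x * (G x e (a j) * mtrace G x (fun p => S p x) a j) =
   (\sum_e Gam e d c x * G x e (a j)) * mtrace G x (fun p => S p x) a j.
  by rewrite mulr_suml; apply: eq_bigr => D _; rewrite mulrA.
have arith (u v t g p q : R) : (u + v) * t + g * p - u * t - (v * t + g * q) = g * (p - q) by ring.
exact: arith.
Qed.

End CovariantOneForms.

Section ConformalKilling.
Variables (k : nat) (sigma : 'rV[R]_n -> {ffun 'I_k -> 'I_n} -> R).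
Hypothesis salt : forall y, O y -> alternating (sigma y).
Hypothesis ssmooth : forall b, smooth_on O (sigma^~ b).
Hypothesis ckf : forall y, O y -> forall c a,
  cartan_proj G y (fun c a => nabla_tensor G sigma c y a) c a = 0.

Notation H := (nabla2 G sigma).

(** The covariant derivative of the conformal Killing equation, in the form given
    by cartan_projE; the metric and its inverse are parallel. *)
Lemma killing_second d c x a : O x ->
  k.+1%:R^-1 * (H d c x a - \sum_j H d (a j) x (upd_ix a j c)) =
  H d c x a - (n - k + 1)%:R^-1 * \sum_j G x c (a j) * mtrace G x (fun p => H d p x) a j.
Proof.
move=> Ox; pose S c y a := nabla_tensor G sigma c y a.
have dS e b : pderivable (fun y => S e y b) x by apply: (pderivable_nabla oO Gunit Gsmooth).
have dtr j e (b : {ffun 'I_k -> 'I_n}) : pderivable (fun y => G y e (b j) * mtrace G y (fun p => S p y) b j) x.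
  by apply: pderivableM; [exact: pderivable_metric|exact: pderivable_mtrace].
have dsum e (b : {ffun 'I_k -> 'I_n}) : pderivable (fun y => \sum_j S (b j) y (upd_ix b j e)) x.
  by apply: pderivable_sum => j _.
have dtrs e (b : {ffun 'I_k -> 'I_n}) : pderivable (fun y => \sum_j G y e (b j) * mtrace G y (fun p => S p y) b j) x.
  by apply: pderivable_sum => j _.
have dE e (b : {ffun 'I_k -> 'I_n}) : pderivable (fun y => S e y b - \sum_j S (b j) y (upd_ix b j e)) x.
  exact: pderivableB.
have e1 : nabla_form (fun c y a => k.+1%:R^-1 * (S c y a - \sum_j S (a j) y (upd_ix a j c))) d c x a =
  nabla_form (fun c y a => S c y a -
    (n - k + 1)%:R^-1 * \sum_j G y c (a j) * mtrace G y (fun p => S p y) a j) d c x a.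
  apply: eq_nabla_form => // e y b Oy; have := ckf Oy e b.
  rewrite cartan_projE; last by move=> f; apply: (alt_nabla _ oO).
  have arith (s u t : R) : s - u - t = 0 -> u = s - t by move=> h; lra.
  exact: arith.
rewrite nabla_formZ // nabla_formB // nabla_form_sum // in e1.
have dZ e (b : {ffun 'I_k -> 'I_n}) : pderivable (fun y => (n - k + 1)%:R^-1 *
    \sum_j G y e (b j) * mtrace G y (fun p => S p y) b j) x.
  by apply: pderivableM; first exact: pderivable_cst.
rewrite (nabla_formB d c a dS dZ) in e1.
rewrite nabla_formZ // nabla_form_sum // in e1.
transitivity (k.+1%:R^-1 * (nabla_form S d c x a -
   \sum_j nabla_form (fun c y a => S (a j) y (upd_ix a j c)) d c x a)).
  by congr (_ * (_ - _)); apply: eq_bigr => j _; rewrite nabla_form_insert.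
rewrite e1; congr (_ - _ * _); apply: eq_bigr => j _; exact: nabla_form_trace.
Qed.

End ConformalKilling.

End SecondDerivatives.

(** * Metric contractions and the action of the curvature on forms *)

Section MetricTrace.
Context {R : realType} {n : nat}.
Variables (G : 'rV[R]_n -> 'M[R]_n) (x : 'rV[R]_n).
Hypothesis gsym : forall a b, G x a b = G x b a.
Hypothesis gunit : G x \in unitmx.
Implicit Types F : 'I_n -> 'I_n -> R.

Definition contr F : R := \sum_p \sum_q ginv G x p q * F p q.

Lemma eq_contr F F' : (forall p q, F p q = F' p q) -> contr F = contr F'.
Proof. by move=> e; apply: eq_bigr => p _; apply: eq_bigr => q _; rewrite e. Qed.

Lemma contrD F F' : contr (fun p q => F p q + F' p q) = contr F + contr F'.
Proof.
rewrite -big_split; apply: eq_bigr => p _ /=; rewrite -big_split.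
by apply: eq_bigr => q _; rewrite mulrDr.
Qed.

Lemma contrZ r F : contr (fun p q => r * F p q) = r * contr F.
Proof.
rewrite mulr_sumr; apply: eq_bigr => p _; rewrite mulr_sumr.
by apply: eq_bigr => q _; rewrite mulrCA.
Qed.

Lemma contrN F : contr (fun p q => - F p q) = - contr F.
Proof. by rewrite -mulN1r -contrZ; apply: eq_contr => p q; rewrite mulN1r. Qed.

Lemma contrB F F' : contr (fun p q => F p q - F' p q) = contr F - contr F'.
Proof. by rewrite contrD contrN. Qed.

Lemma contr_sum (J : Type) (r : seq J) (P : pred J) (F : J -> 'I_n -> 'I_n -> R) :
  contr (fun p q => \sum_(j <- r | P j) F j p q) = \sum_(j <- r | P j) contr (F j).
Proof.
rewrite exchange_big /=; apply: eq_bigr => p _; rewrite exchange_big /=.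
by apply: eq_bigr => q _; rewrite mulr_sumr.
Qed.

Lemma contr0 F : (forall p q, F p q = 0) -> contr F = 0.
Proof. by move=> F0; rewrite /contr big1 // => p _; rewrite big1 // => q _; rewrite F0 mulr0. Qed.

Lemma contr_sym F : contr F = contr (fun p q => F q p).
Proof.
rewrite /contr exchange_big /=; apply: eq_bigr => p _; apply: eq_bigr => q _.
by rewrite (ginv_sym gsym).
Qed.

Lemma contr_alt F : (forall p q, F q p = - F p q) -> contr F = 0.
Proof. by move=> aF; have := contr_sym F; rewrite (eq_contr aF) contrN; lra. Qed.

Lemma contr_exch (F : 'I_n -> 'I_n -> 'I_n -> 'I_n -> R) :
  contr (fun p q => contr (F p q)) = contr (fun p' q' => contr (fun p q => F p q p' q')).
Proof.
rewrite [RHS]contr_sum; apply: eq_bigr => p _; rewrite [RHS]contr_sum; apply: eq_bigr => q _.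
by rewrite [RHS]contrZ.
Qed.

Lemma contr_metric (F : 'I_n -> R) c : contr (fun p q => G x c q * F p) = F c.
Proof.
rewrite /contr -[RHS](sum_delta F); apply: eq_bigr => p _.
under eq_bigr do rewrite mulrA.
rewrite -mulr_suml; congr (_ * _); rewrite eq_sym -(ginvl gunit).
by apply: eq_bigr => q _; rewrite gsym.
Qed.

Lemma contr_dim r : contr (fun p q => G x q p * r) = n%:R * r.
Proof.
rewrite /contr; under eq_bigr => p _ do under eq_bigr => q _ do rewrite mulrA.
under eq_bigr => p _ do rewrite -mulr_suml (ginvl gunit) eqxx mul1r.
by rewrite sumr_const card_ord mulr_natl.
Qed.

Lemma sum_sym_alt (M A : 'I_n -> 'I_n -> R) : (forall p q, M p q = M q p) ->
  (forall p q, A p q = - A q p) -> \sum_p \sum_q M p q * A p q = 0.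
Proof.
move=> sM aA; set Z := \sum_p _; suff : Z = - Z by lra.
rewrite {1}/Z exchange_big /Z -sumrN /=; apply: eq_bigr => p _; rewrite -sumrN; apply: eq_bigr => q _.
by rewrite aA sM mulrN.
Qed.

(** Since A is invariant under cyclic permutations, the sum equals a third of
    that of the cyclic sum of K. *)
Lemma sum_cyclic_alt (K A : 'I_n -> 'I_n -> 'I_n -> R) :
  (forall p q r, A q p r = - A p q r) -> (forall p q r, A p r q = - A p q r) ->
  (forall p q r, K p q r + K q r p + K r p q = 0) ->
  \sum_p \sum_q \sum_r K p q r * A p q r = 0.
Proof.
move=> A1 A2 cK; set Z := \sum_p _.
have Z1 : Z = \sum_p \sum_q \sum_r K q r p * A p q r.
  rewrite /Z [RHS]exchange_big; apply: eq_bigr => p _ /=; rewrite [RHS]exchange_big.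
  by apply: eq_bigr => q _; apply: eq_bigr => r _; rewrite (A1 p r q) (A2 p q r) opprK.
have Z2 : Z = \sum_p \sum_q \sum_r K r p q * A p q r.
  under [RHS]eq_bigr => p _ do rewrite exchange_big.
  rewrite [RHS]exchange_big; apply: eq_bigr => p _; apply: eq_bigr => q _.
  by apply: eq_bigr => r _; rewrite (A2 q p r) (A1 p q r) opprK.
have : Z + Z + Z = 0.
  rewrite {1}/Z {1}Z1 {1}Z2 -!big_split big1 // => p _ /=.
  rewrite -!big_split big1 // => q _ /=; rewrite -!big_split big1 // => r _ /=.
  by rewrite -!mulrDl cK mul0r.
lra.
Qed.

End MetricTrace.

Section CurvatureAction.
Context {R : realType} {n : nat}.
Variables (G : 'rV[R]_n -> 'M[R]_n) (O : set 'rV[R]_n).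
Hypothesis oO : open O.
Hypothesis Gsym : forall x, O x -> forall a b, G x a b = G x b a.
Hypothesis Gunit : forall x, O x -> G x \in unitmx.
Hypothesis Gsmooth : forall a b, smooth_on O (fun x => G x a b).
Variables (x : 'rV[R]_n) (k : nat) (s : {ffun 'I_k -> 'I_n} -> R).
Hypothesis Ox : O x.
Hypothesis salt : alternating s.

Notation gi := (ginv G).
Notation P := (schouten G).

Lemma ricci_contract p D :
  contr G x (fun d q => riemann_up G d p D q x) = - \sum_e gi x D e * ricci G p e x.
Proof.
transitivity (contr G x (fun d q => - \sum_e gi x D e * riemann G d p q e x)).
  apply: eq_contr => d q; rewrite (riemann_upE Gunit) // -sumrN; apply: eq_bigr => e _.
  by rewrite (riemann_skew oO Gsym Gunit Gsmooth) // mulrN.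
rewrite contrN contr_sum; congr (- _); apply: eq_bigr => e _; rewrite contrZ; congr (_ * _).
by apply: eq_bigr => d _; rewrite (riemann_upE Gunit).
Qed.

(** This is the commutator term in the double divergence of a form. At the two
    contracted positions the curvature turns into the Ricci tensor, which is
    symmetric, while s is skew; at any other position one meets a contraction
    over three skew indices, to which the first Bianchi identity applies. *)
Lemma riemann_contract2 (i j : 'I_k) a : i != j ->
  contr G x (fun d q => contr G x (fun p r =>
    sharp (fun D C => riemann_up G d p D C x) s (upd_ix (upd_ix a j q) i r))) = 0.
Proof.
move=> ij; have ji : j != i by rewrite eq_sym.
have ricM (i' j' : 'I_k) : i' != j' ->
   contr G x (fun p r => \sum_D (\sum_e gi x D e * ricci G p e x) *
     s (upd_ix (upd_ix a j' D) i' r)) = 0.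
  move=> ij'; rewrite /contr exchange_big /=.
  transitivity (\sum_r \sum_D (\sum_p \sum_e gi x p r * gi x D e * ricci G p e x) *
      s (upd_ix (upd_ix a j' D) i' r)).
    apply: eq_bigr => r _; under eq_bigr => p _ do rewrite mulr_sumr.
    rewrite exchange_big /=; apply: eq_bigr => D _; rewrite mulr_suml; apply: eq_bigr => p _.
    rewrite mulrA mulr_sumr; congr (_ * _); apply: eq_bigr => e _; exact: mulrA.
  apply: sum_sym_alt => p q.
    rewrite exchange_big /=; apply: eq_bigr => e _; apply: eq_bigr => f _.
    rewrite (ricci_sym oO Gsym Gunit Gsmooth f e Ox) (ginv_sym (Gsym Ox) f) (ginv_sym (Gsym Ox) q e).
    by rewrite [gi x p f * _]mulrC.
  by rewrite alt_upd2 // eq_sym.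
transitivity (- \sum_t contr G x (fun d q => contr G x (fun p r =>
   \sum_D riemann_up G d p D (upd_ix (upd_ix a j q) i r t) x *
     s (upd_ix (upd_ix (upd_ix a j q) i r) t D)))).
  rewrite -contr_sum -contrN; apply: eq_contr => d q; rewrite -contr_sum -contrN.
  by apply: eq_contr => p r.
apply/eqP; rewrite oppr_eq0; apply/eqP; rewrite big1 // => t _.
(* The curvature acts at the position that is contracted with its first index. *)
have [->|tj] := eqVneq t j.
  rewrite contr_exch.
  transitivity (- contr G x (fun p r => \sum_D (\sum_e gi x D e * ricci G p e x) *
     s (upd_ix (upd_ix a j D) i r))); last by rewrite ricM // oppr0.
  rewrite -contrN; apply: eq_contr => p r.
  transitivity (\sum_D contr G x (fun d q => riemann_up G d p D q x) * s (upd_ix (upd_ix a j D) i r)).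
    rewrite contr_sum; apply: eq_bigr => D _; rewrite mulrC -contrZ; apply: eq_contr => d q.
    by rewrite (upd_other _ _ ji) upd_same mulrC -(updC (upd_ix a j q) D r ji) upd_upd.
  by rewrite -sumrN; apply: eq_bigr => D _; rewrite ricci_contract mulNr.
(* The curvature acts at the position that is contracted with its second index. *)
have [->|ti] := eqVneq t i.
  transitivity (contr G x (fun d q => \sum_D (\sum_e gi x D e * ricci G d e x) *
     s (upd_ix (upd_ix a i D) j q))); last exact: ricM.
  apply: eq_contr => d q.
  transitivity (\sum_D (- contr G x (fun p r => riemann_up G p d D r x)) * s (upd_ix (upd_ix a j q) i D)).
    rewrite contr_sum; apply: eq_bigr => D _; rewrite -contrN mulrC -contrZ; apply: eq_contr => p r.
    by rewrite upd_same riemann_upN mulrC upd_upd.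
  apply: eq_bigr => D _; rewrite ricci_contract opprK; congr (_ * s _).
  by rewrite updC.
(* At any other position, the metric contractions and s make up a tensor V that is
   skew in three indices. *)
have [jt it] : j != t /\ i != t by rewrite ![_ == t]eq_sym.
pose U q r D := upd_ix (upd_ix (upd_ix a j q) i r) t D.
have U1 q r D : s (U r q D) = - s (U q r D).
  have UE q' r' : U q' r' D = upd_ix (upd_ix (upd_ix a t D) j q') i r'.
    by rewrite /U (updC _ r' D it) (updC a q' D jt).
  by rewrite !UE alt_upd2.
have U2 q r D : s (U q D r) = - s (U q r D) by rewrite /U alt_upd2.
pose V d p e := \sum_q \sum_r \sum_D gi x d q * gi x p r * gi x e D * s (U q r D).
transitivity (- \sum_d \sum_p \sum_e riemann G d p (a t) e x * V d p e); last first.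
  rewrite (sum_cyclic_alt (K := fun d p e => riemann G d p (a t) e x)) ?oppr0 //.
  - move=> d p e; rewrite /V exchange_big -sumrN; apply: eq_bigr => q _.
    rewrite -sumrN; apply: eq_bigr => r _; rewrite -sumrN; apply: eq_bigr => D _.
    by rewrite U1 mulrN [gi x p r * _]mulrC.
  - move=> d p e; rewrite /V -sumrN; apply: eq_bigr => q _.
    rewrite exchange_big -sumrN; apply: eq_bigr => r _; rewrite -sumrN; apply: eq_bigr => D _.
    by rewrite (U2 q r D) mulrN; congr (- (_ * _)); exact: mulrAC.
  - move=> d p e; rewrite /riemann -!big_split big1 // => f _ /=.
    by rewrite -!mulrDr (bianchi oO Gsym) // mulr0.
rewrite /contr -sumrN; apply: eq_bigr => d _.
under eq_bigr => q _ do rewrite mulr_sumr.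
rewrite exchange_big -sumrN; apply: eq_bigr => p _ /=.
under [X in _ = - X]eq_bigr => e _ do rewrite /V mulr_sumr.
rewrite [X in _ = - X]exchange_big -sumrN; apply: eq_bigr => q _ /=; rewrite mulr_sumr.
under [X in _ = - X]eq_bigr => e _ do rewrite mulr_sumr.
rewrite [X in _ = - X]exchange_big -sumrN; apply: eq_bigr => r _ /=.
under [X in _ = - X]eq_bigr => e _ do rewrite mulr_sumr.
rewrite [X in _ = - X]exchange_big -sumrN !mulr_sumr; apply: eq_bigr => D _ /=.
rewrite (upd_other _ _ ti) (upd_other _ _ tj) (riemann_upE Gunit) // mulr_suml !mulr_sumr -sumrN.
apply: eq_bigr => e _; rewrite (riemann_skew oO Gsym Gunit Gsmooth) // (ginv_sym (Gsym Ox) D e).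
have arith (u v w y z : R) : u * (v * (w * - y * z)) = - (y * (u * v * w * z)) by ring.
exact: arith.
Qed.

(** The Schouten tensor, as an endomorphism, acting at position t only. *)
Definition schouten_shift c t a : R := \sum_D schouten_up G D c x * s (upd_ix a t D).

Lemma sharp_riemann_weyl c d a :
  sharp (fun D C => riemann_up G c d D C x) s a =
  sharp (fun D C => weyl_up G c d D C x) s a
  - \sum_t (P d (a t) x * s (upd_ix a t c) - P c (a t) x * s (upd_ix a t d)
     + G x (a t) d * schouten_shift c t a - G x (a t) c * schouten_shift d t a).
Proof.
transitivity (sharp (fun D C => weyl_up G c d D C x +
   ((D == c)%:R * P d C x - (D == d)%:R * P c C x
    + G x C d * schouten_up G D c x - G x C c * schouten_up G D d x)) s a).
  by congr (sharp _ _ _); apply/funext => D; apply/funext => C; rewrite -(riemann_up_weyl Gunit).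
rewrite sharpDl; congr (_ + _); rewrite sharpE; congr (- _); apply: eq_bigr => t _.
have dl (f : 'I_n -> R) e : \sum_D (D == e)%:R * f D = f e.
  by rewrite -[RHS](sum_delta f); apply: eq_bigr => D _; rewrite eq_sym.
rewrite -(dl (fun D => P d (a t) x * s (upd_ix a t D)) c) -(dl (fun D => P c (a t) x * s (upd_ix a t D)) d).
rewrite /schouten_shift !mulr_sumr -sumrB -big_split -sumrB; apply: eq_bigr => D _ /=.
have arith (e1 e2 p1 p2 g1 g2 q1 q2 z : R) :
  (e1 * p1 - e2 * p2 + g1 * q1 - g2 * q2) * z =
  e1 * (p1 * z) - e2 * (p2 * z) + g1 * (q1 * z) - g2 * (q2 * z) by ring.
exact: arith.
Qed.

Lemma schouten_upE d c : \sum_q gi x d q * P c q x = schouten_up G d c x.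
Proof. by []. Qed.

(** In the term of position j the contraction meets a trace of the metric, whence
    n - 2; every other position contributes -1 and a term with c and a_i exchanged. *)
Lemma contr_riemann c (j : 'I_k) a :
  contr G x (fun d q => sharp (fun D C => riemann_up G c d D C x) s (upd_ix a j q)) =
  contr G x (fun d q => sharp (fun D C => weyl_up G c d D C x) s (upd_ix a j q))
  - (contr G x (fun d q => P d q x) * s (upd_ix a j c) + (n%:R - 2) * schouten_shift c j a
     + \sum_(i | i != j) (schouten_shift (a i) j (upd_ix a i c) - schouten_shift c j a)).
Proof.
under eq_contr => d q do rewrite sharp_riemann_weyl.
rewrite contrB; congr (_ - _); rewrite contr_sum (bigD1 j) //=; congr (_ + _).
  rewrite contrB contrD contrB.
  have -> : contr G x (fun d q => P d (upd_ix a j q j) x * s (upd_ix (upd_ix a j q) j c)) =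
      contr G x (fun d q => P d q x) * s (upd_ix a j c).
    by rewrite mulrC -contrZ; apply: eq_contr => d q; rewrite upd_same upd_upd mulrC.
  have -> : contr G x (fun d q => P c (upd_ix a j q j) x * s (upd_ix (upd_ix a j q) j d)) =
      schouten_shift c j a.
    rewrite /contr; apply: eq_bigr => d _; rewrite -schouten_upE mulr_suml.
    by apply: eq_bigr => q _; rewrite upd_same upd_upd mulrA.
  have shI b q : schouten_shift b j (upd_ix a j q) = schouten_shift b j a.
    by apply: eq_bigr => D _; rewrite upd_upd.
  have -> : contr G x (fun d q => G x (upd_ix a j q j) d * schouten_shift c j (upd_ix a j q)) =
      n%:R * schouten_shift c j a.
    by rewrite -(contr_dim (Gunit Ox)); apply: eq_contr => d q; rewrite upd_same shI.
  have -> : contr G x (fun d q => G x (upd_ix a j q j) c * schouten_shift d j (upd_ix a j q)) =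
      schouten_shift c j a.
    rewrite -(contr_metric (Gsym Ox) (Gunit Ox) (fun d => schouten_shift d j a)).
    by apply: eq_contr => d q; rewrite upd_same shI (Gsym Ox).
  have arith (u v w : R) : u - v + w * v - v = u + (w - 2) * v by ring.
  exact: arith.
apply: eq_bigr => t tj; have jt : j != t by rewrite eq_sym.
rewrite contrB contrD contrB.
have -> : contr G x (fun d q => P d (upd_ix a j q t) x * s (upd_ix (upd_ix a j q) t c)) =
    schouten_shift (a t) j (upd_ix a t c).
  rewrite contr_sym; last exact: Gsym.
  apply: eq_bigr => D _; rewrite -schouten_upE mulr_suml; apply: eq_bigr => q _.
  rewrite (upd_other _ _ tj) (schouten_sym oO Gsym Gunit Gsmooth _ _ Ox) (updC a D c jt).
  exact: mulrA.
have -> : contr G x (fun d q => P c (upd_ix a j q t) x * s (upd_ix (upd_ix a j q) t d)) = 0.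
  apply: contr_alt; first exact: Gsym.
  by move=> p q; rewrite !(upd_other _ _ tj) (alt_upd2 _ _ _ salt jt) mulrN.
have -> : contr G x (fun d q => G x (upd_ix a j q t) d * schouten_shift c t (upd_ix a j q)) =
    - schouten_shift c j a.
  rewrite contr_sym; last exact: Gsym.
  under eq_contr => d q do rewrite (upd_other _ _ tj).
  rewrite (contr_metric (Gsym Ox) (Gunit Ox) (fun d => schouten_shift c t (upd_ix a j d))).
  by rewrite -sumrN; apply: eq_bigr => D _; rewrite (updC a (a t) D jt) -mulrN -(alt_move _ _ salt tj) updC.
have -> : contr G x (fun d q => G x (upd_ix a j q t) c * schouten_shift d t (upd_ix a j q)) = 0.
  under eq_contr => d q do rewrite (upd_other _ _ tj).
  rewrite contrZ (_ : contr _ _ _ = 0) ?mulr0 //.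
  transitivity (\sum_q \sum_D (\sum_d \sum_e gi x d q * gi x D e * P d e x) *
     s (upd_ix (upd_ix a j q) t D)).
    rewrite /contr exchange_big; apply: eq_bigr => q _ /=.
    under eq_bigr => d _ do rewrite /schouten_shift mulr_sumr.
    rewrite exchange_big; apply: eq_bigr => D _ /=; rewrite mulr_suml; apply: eq_bigr => d _.
    rewrite /schouten_up mulrA mulr_sumr; congr (_ * _); apply: eq_bigr => e _; exact: mulrA.
  apply: sum_sym_alt => p q; last by rewrite (alt_upd2 _ _ _ salt jt).
  rewrite exchange_big; apply: eq_bigr => d _; apply: eq_bigr => e _ /=.
  rewrite (schouten_sym oO Gsym Gunit Gsmooth _ _ Ox) (ginv_sym (Gsym Ox) e p) (ginv_sym (Gsym Ox) q d).
  by rewrite [gi x p e * _]mulrC.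
have arith (u v : R) : u - 0 + - v - 0 = u - v by ring.
exact: arith.
Qed.

End CurvatureAction.

(** * Second-order consequences of the conformal Killing equation *)

(** Skew-symmetrisation against a fixed weight w. If w is invariant under a
    transposition, the transposition acts on the other factor by a sign. *)
Section WeightedSkewing.
Context {R : realType} {I : finType} {m : nat}.
Variable w : {ffun 'I_m -> I} -> R.
Implicit Types (F : {ffun 'I_m -> I} -> R) (a b : {ffun 'I_m -> I}).

Definition wskew F a : R := skewing (fun b => w b * F b) a.

Lemma eq_wskew F F' a : (forall b, F b = F' b) -> wskew F a = wskew F' a.
Proof. by move=> e; apply: eq_skewing => b; rewrite e. Qed.

Lemma wskewD F F' a : wskew (fun b => F b + F' b) a = wskew F a + wskew F' a.
Proof. by rewrite -skewingD; apply: eq_skewing => b; rewrite mulrDr. Qed.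

Lemma wskewZ r F a : wskew (fun b => r * F b) a = r * wskew F a.
Proof. by rewrite -skewingZ; apply: eq_skewing => b; rewrite mulrCA. Qed.

Lemma wskewN F a : wskew (fun b => - F b) a = - wskew F a.
Proof. by rewrite -skewingN; apply: eq_skewing => b; rewrite mulrN. Qed.

Lemma wskewB F F' a : wskew (fun b => F b - F' b) a = wskew F a - wskew F' a.
Proof. by rewrite wskewD wskewN. Qed.

Lemma wskew_sum (J : Type) (r : seq J) (P : pred J) (F : J -> {ffun 'I_m -> I} -> R) a :
  wskew (fun b => \sum_(j <- r | P j) F j b) a = \sum_(j <- r | P j) wskew (F j) a.
Proof. by rewrite -skewing_sum; apply: eq_skewing => b; rewrite mulr_sumr. Qed.

Lemma wskew_swap F a p q : p != q -> (forall b, w (swap_ix b p q) = w b) ->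
  wskew (fun b => F (swap_ix b p q)) a = - wskew F a.
Proof.
move=> pq wpq; rewrite -(skewing_swap (fun b => w b * F b) a pq).
by apply: eq_skewing => b; rewrite wpq.
Qed.

Lemma wskew_sym0 F a p q : p != q -> (forall b, w (swap_ix b p q) = w b) ->
  (forall b, F (swap_ix b p q) = F b) -> wskew F a = 0.
Proof. by move=> pq wpq Fpq; have := wskew_swap F a pq wpq; rewrite (eq_wskew a Fpq); lra. Qed.

Lemma wskew_half F a p q : p != q -> (forall b, w (swap_ix b p q) = w b) ->
  wskew F a = 2^-1 * wskew (fun b => F b - F (swap_ix b p q)) a.
Proof. by move=> pq wpq; rewrite wskewB wskew_swap //; lra. Qed.

End WeightedSkewing.

Section Prolongation.
Context {R : realType} {n : nat}.
Variables (G : 'rV[R]_n -> 'M[R]_n) (O : set 'rV[R]_n).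
Hypothesis oO : open O.
Hypothesis Gsym : forall x, O x -> forall a b, G x a b = G x b a.
Hypothesis Gunit : forall x, O x -> G x \in unitmx.
Hypothesis Gsmooth : forall a b, smooth_on O (fun x => G x a b).
Variables (k : nat) (sigma : 'rV[R]_n -> {ffun 'I_k -> 'I_n} -> R).
Hypothesis kn : (k < n)%N.
Hypothesis salt : forall y, O y -> alternating (sigma y).
Hypothesis ssmooth : forall b, smooth_on O (sigma^~ b).
Hypothesis ckf : forall y, O y -> forall c a,
  cartan_proj G y (fun c a => nabla_tensor G sigma c y a) c a = 0.
Variable x : 'rV[R]_n.
Hypothesis Ox : O x.
Implicit Types (a b : {ffun 'I_k -> 'I_n}).

Notation H := (nabla2 G sigma).
Notation N := ((n - k + 1)%:R : R).
Notation gi := (ginv G).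
Notation P := (schouten G).
Notation shift := (schouten_shift G x (sigma x)).
Notation weyl_act c d := (sharp (fun D C => weyl_up G c d D C x) (sigma x)).
Notation riem_act c d := (sharp (fun D C => riemann_up G c d D C x) (sigma x)).

Lemma alt_second d c : alternating (H d c x).
Proof. exact: (alt_nabla2 oO Gunit Gsmooth). Qed.

Lemma second_comm d c a : H d c x a = H c d x a + riem_act d c a.
Proof.
have := ricci_identity oO Gsym Gunit Gsmooth d c a Ox ssmooth.
by move=> <-; rewrite addrC subrK.
Qed.

Lemma dimN : N = (n - k)%:R + 1.
Proof. by rewrite natrD. Qed.

Lemma dim_neq0 : ((n - k)%:R : R) != 0.
Proof. by rewrite pnatr_eq0 -lt0n subn_gt0. Qed.

Lemma N_neq0 : N != 0.
Proof. by rewrite pnatr_eq0 addn1. Qed.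

(** N times the second derivative, without its trace part. By killing_second it
    is skew in c and the form indices. *)
Definition trace_free_second d c a : R :=
  N * H d c x a - \sum_j G x c (a j) * mtrace G x (fun p => H d p x) a j.

Lemma trace_free_second_move d c a i :
  trace_free_second d (a i) (upd_ix a i c) = - trace_free_second d c a.
Proof.
have E e b : trace_free_second d e b =
    N / k.+1%:R * (H d e x b - \sum_j H d (b j) x (upd_ix b j e)).
  rewrite -mulrA (killing_second oO Gsym Gunit Gsmooth salt ssmooth ckf) //.
  by rewrite mulrBr mulrA mulfV ?N_neq0 // mul1r.
rewrite !E -mulrN; congr (_ * _).
apply: (skew_diff_move (P := xpredT) (f := fun e b => H d e x b)) => // e j b' _ _.
exact: alt_second.
Qed.

(** Exchanging the two derivatives and the two contracted positions changes the
    sign of the form but not the contraction, so the double divergence is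
    opposite to itself up to the commutator term of riemann_contract2. *)
Lemma div_div (i j : 'I_k) a : i != j ->
  contr G x (fun d q => contr G x (fun p r => H d p x (upd_ix (upd_ix a j q) i r))) = 0.
Proof.
move=> ij; set Z := contr _ _ _; suff : Z = - Z by lra.
transitivity (contr G x (fun d q => contr G x (fun p r =>
    - H p d x (upd_ix (upd_ix a j q) i r)))).
  rewrite /Z contr_exch; apply: eq_contr => d q; apply: eq_contr => p r.
  by rewrite alt_upd2 //; [exact: alt_second|rewrite eq_sym].
transitivity (contr G x (fun d q => - contr G x (fun p r => H d p x (upd_ix (upd_ix a j q) i r))
   + contr G x (fun p r => riem_act d p (upd_ix (upd_ix a j q) i r)))).
  apply: eq_contr => d q; rewrite -contrN -contrD; apply: eq_contr => p r.
  have arith (u v w : R) : u = v + w -> - v = - u + w by move=> ->; ring.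
  exact: arith (second_comm _ _ _).
by rewrite contrD contrN (riemann_contract2 oO Gsym Gunit Gsmooth Ox (salt Ox)) ?addr0.
Qed.

Section Codifferential.
Variable j : 'I_k.

(** The Schouten terms of contr_riemann that are themselves skew in c and the form
    indices other than j: the first one by the skew symmetry of sigma, the others
    by skew_diff_move. *)
Definition schouten_trace c a : R :=
  contr G x (fun d q => P d q x) * sigma x (upd_ix a j c)
  - (shift c j a - \sum_(i | i != j) shift (a i) j (upd_ix a i c)).

(** The contraction of d with the form index j inherits the skew symmetry. *)
Definition second_trace c a : R := contr G x (fun d q => trace_free_second d c (upd_ix a j q)).

Lemma second_trace_move c a i : i != j -> second_trace (a i) (upd_ix a i c) = - second_trace c a.
Proof.
move=> ij; rewrite /second_trace -[RHS]contrN; apply: eq_contr => d q.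
by rewrite (updC a c q ij) -(trace_free_second_move d c (upd_ix a j q) i) (upd_other _ _ ij).
Qed.

(** The first part is N times the divergence of the derivative, in which the
    derivatives are commuted; the trace part subtracts the derivative of the
    divergence once, by div_div, so that N - 1 = n - k remains. *)
Lemma second_traceE c a : second_trace c a = (n - k)%:R * mtrace G x (fun p => H c p x) a j
  - N * (contr G x (fun d q => weyl_act c d (upd_ix a j q))
         - ((n - k)%:R * shift c j a + schouten_trace c a)).
Proof.
rewrite /second_trace /trace_free_second contrB contrZ.
have -> : contr G x (fun d q => H d c x (upd_ix a j q)) =
   mtrace G x (fun p => H c p x) a j - contr G x (fun d q => riem_act c d (upd_ix a j q)).
  rewrite -[mtrace _ _ _ _ _]/(contr G x (fun p q => H c p x (upd_ix a j q))) -contrB.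
  by apply: eq_contr => d q; rewrite (second_comm c) addrK.
rewrite (contr_riemann oO Gsym Gunit Gsmooth Ox (salt Ox)).
have -> : contr G x (fun d q => \sum_i G x c (upd_ix a j q i) *
     mtrace G x (fun p => H d p x) (upd_ix a j q) i) = mtrace G x (fun p => H c p x) a j.
  rewrite contr_sum (bigD1 j) //= big1 ?addr0 => [|i ij]; last first.
    transitivity (G x c (a i) * contr G x (fun d q => mtrace G x (fun p => H d p x) (upd_ix a j q) i)).
      by rewrite -contrZ; apply: eq_contr => d q; rewrite upd_other.
    by rewrite [contr _ _ _](div_div a ij) mulr0.
  rewrite -[RHS](contr_metric (Gsym Ox) (Gunit Ox) (fun d => mtrace G x (fun p => H d p x) a j)).
  apply: eq_contr => d q; rewrite upd_same; congr (_ * _).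
  by apply: eq_bigr => p _; apply: eq_bigr => r _; rewrite upd_upd.
rewrite /schouten_trace sumrB.
have -> : \sum_(i < k | i != j) shift c j a = (k%:R - 1) * shift c j a.
  have -> : (k%:R : R) = \sum_(i < k) 1 by rewrite sumr_const card_ord.
  by rewrite [in RHS](bigD1 j) //= addrC addrK mulr_suml; apply: eq_bigr => i _; rewrite mul1r.
rewrite dimN natrB; last exact: ltnW.
set t1 := mtrace _ _ _ _ _; set t2 := contr _ _ _; set t3 := contr _ _ _.
set t4 := schouten_shift _ _ _ _ _ _; set t5 := \sum_(i < k | _) _; set t6 := sigma _ _.
ring.
Qed.

Lemma schouten_trace_move c a i : i != j -> schouten_trace (a i) (upd_ix a i c) = - schouten_trace c a.
Proof.
move=> ij; rewrite /schouten_trace.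
have shalt e (i1 j1 : 'I_k) b' : i1 != j -> j1 != j -> i1 != j1 ->
    shift e j (swap_ix b' i1 j1) = - shift e j b'.
  move=> i1j j1j i1j1; rewrite -sumrN; apply: eq_bigr => D _; rewrite upd_swap tpermD //.
  by rewrite (salt Ox) // mulrN.
rewrite (skew_diff_move (P := fun i => i != j) (f := fun e b => shift e j b)) // => [|e j1 b' _ j1j i1j1]; last first.
  exact: shalt.
have -> : sigma x (upd_ix (upd_ix a i c) j (a i)) = - sigma x (upd_ix a j c).
  by rewrite updC // alt_move //; apply: salt.
have arith (t u v : R) : t * - u - - v = - (t * u - v) by ring.
exact: arith.
Qed.

(** Up to sign, the derivative of the divergence of sigma over position j, with the
    Schouten and Weyl terms that nabla^x adds to it in a slot X. *)
Definition codifferential_defect c a : R :=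
  - mtrace G x (fun p => H c p x) a j - N * shift c j a
  + N / (n - k)%:R * contr G x (fun d q => weyl_act c d (upd_ix a j q)).

(** Up to factors this is a combination of second_trace and schouten_trace, and
    both are skew; the coefficient N/(n-k) of the Weyl term is forced by
    eliminating the derivative of the divergence. *)
Lemma codifferential_defect_move c a i : i != j ->
  codifferential_defect (a i) (upd_ix a i c) = - codifferential_defect c a.
Proof.
have E e b : codifferential_defect e b = - (n - k)%:R^-1 * second_trace e b + N / (n - k)%:R * schouten_trace e b.
  rewrite second_traceE /codifferential_defect; have := dim_neq0.
  set t1 := mtrace _ _ _ _ _; set t2 := contr _ _ _.
  set t3 := schouten_shift _ _ _ _ _ _; set t4 := schouten_trace _ _.
  move: ((n - k)%:R : R) (N) => r1 r2 r0; by field.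
by move=> ij; rewrite !E second_trace_move // schouten_trace_move // !mulrN -opprD.
Qed.

Lemma codifferential_defect_alt c a i i' : i != j -> i' != j -> i != i' ->
  codifferential_defect c (swap_ix a i i') = - codifferential_defect c a.
Proof.
move=> ij ij' ii; rewrite /codifferential_defect.
have up q : upd_ix (swap_ix a i i') j q = swap_ix (upd_ix a j q) i i' by rewrite upd_swap tpermD.
have -> : mtrace G x (fun p => H c p x) (swap_ix a i i') j = - mtrace G x (fun p => H c p x) a j.
  rewrite -[RHS]contrN; apply: eq_contr => p q; rewrite up; exact: alt_second.
have -> : shift c j (swap_ix a i i') = - shift c j a.
  by rewrite -sumrN; apply: eq_bigr => D _; rewrite up (salt Ox) // mulrN.
have -> : contr G x (fun d q => weyl_act c d (upd_ix (swap_ix a i i') j q)) =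
    - contr G x (fun d q => weyl_act c d (upd_ix a j q)).
  rewrite -contrN; apply: eq_contr => d q; rewrite up; apply: alt_sharp => //; exact: salt.
by rewrite !mulrN opprK !opprD !opprK.
Qed.

End Codifferential.

(** The skew-symmetrisation runs over the position jj, which carries the inner
    derivative, the positions in the image of pos, which carry the indices of
    sigma, and further positions, on which only the weight w depends. *)
Section Differential.
Variables (m : nat) (pos : 'I_k -> 'I_m) (jj : 'I_m) (w : {ffun 'I_m -> 'I_n} -> R).
Hypothesis pos_inj : injective pos.
Hypothesis pos_jj : forall i, pos i != jj.
Hypothesis w_pos : forall i (b : {ffun 'I_m -> 'I_n}) y, w (upd_ix b (pos i) y) = w b.
Hypothesis w_jj : forall (b : {ffun 'I_m -> 'I_n}) y, w (upd_ix b jj y) = w b.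
Hypothesis k0 : (0 < k)%N.
Implicit Types (e : {ffun 'I_m -> 'I_n}).

Definition pull_ix e : {ffun 'I_k -> 'I_n} := [ffun i => e (pos i)].

Lemma pull_upd e i y : pull_ix (upd_ix e (pos i) y) = upd_ix (pull_ix e) i y.
Proof. by apply/ffunP => t; rewrite !ffunE (inj_eq pos_inj). Qed.

Lemma pull_upd_jj e y : pull_ix (upd_ix e jj y) = pull_ix e.
Proof. by apply/ffunP => t; rewrite !ffunE (negbTE (pos_jj t)). Qed.

Lemma pull_swap_jj e i : pull_ix (swap_ix e (pos i) jj) = upd_ix (pull_ix e) i (e jj).
Proof. by rewrite swap_ixE pull_upd_jj pull_upd. Qed.

Lemma swap_jj e i : swap_ix e (pos i) jj jj = pull_ix e i.
Proof. by rewrite !ffunE tpermR. Qed.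

Lemma pull_swap e i t : pull_ix (swap_ix e (pos i) (pos t)) = swap_ix (pull_ix e) i t.
Proof. by apply/ffunP => z; rewrite !ffunE -(inj_tperm _ _ _ pos_inj). Qed.

Lemma swap_pos e i t : swap_ix e (pos i) (pos t) jj = e jj.
Proof. by rewrite ffunE tpermD. Qed.

Lemma w_swap_jj i e : w (swap_ix e (pos i) jj) = w e.
Proof. by rewrite swap_ixE w_jj w_pos. Qed.

Lemma w_swap i t e : w (swap_ix e (pos i) (pos t)) = w e.
Proof. by rewrite swap_ixE !w_pos. Qed.

Notation sk := (wskew w).

(** Both derivatives are along indices over which one skews, so half of their
    commutator remains. *)
Lemma wskew_second c i e0 :
  sk (fun e => H (e jj) (pull_ix e i) x (upd_ix (pull_ix e) i c)) e0 =
  2^-1 * sk (fun e => riem_act (e jj) (pull_ix e i) (upd_ix (pull_ix e) i c)) e0.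
Proof.
rewrite (wskew_half _ _ (pos_jj i)); last exact: w_swap_jj.
congr (_ * _); apply: eq_wskew => e.
rewrite swap_jj pull_swap_jj upd_same upd_upd.
have arith (u v z : R) : u = v + z -> u - v = z by move=> ->; rewrite addrC addKr.
exact: arith (second_comm _ _ _).
Qed.

(** Of the four Schouten terms two are symmetric in indices over which one
    skews, one reproduces the Schouten term of the connection k times, and one
    is a trace. *)
Lemma wskew_riemann_weyl c e0 :
  sk (fun e => riem_act c (e jj) (pull_ix e)) e0 =
  sk (fun e => weyl_act c (e jj) (pull_ix e)) e0
  - k%:R * sk (fun e => P c (e jj) x * sigma x (pull_ix e)) e0
  + \sum_i sk (fun e => G x c (pull_ix e i) * shift (e jj) i (pull_ix e)) e0.
Proof.
have shI c' t b y : shift c' t (upd_ix b t y) = shift c' t b.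
  by apply: eq_bigr => D _; rewrite upd_upd.
under eq_wskew => e do rewrite (sharp_riemann_weyl Gunit) //.
rewrite wskewB -addrA; congr (_ + _); rewrite wskew_sum -sumrN.
have -> : (k%:R : R) = \sum_(i < k) 1 by rewrite sumr_const card_ord.
rewrite mulr_suml -sumrN -big_split; apply: eq_bigr => t _ /=; rewrite mul1r.
rewrite wskewB wskewD wskewB.
have -> : sk (fun e => P (e jj) (pull_ix e t) x * sigma x (upd_ix (pull_ix e) t c)) e0 = 0.
  apply: (wskew_sym0 _ (pos_jj t)) => [e|e]; first exact: w_swap_jj.
  by rewrite swap_jj pull_swap_jj upd_same upd_upd (schouten_sym oO Gsym Gunit Gsmooth _ _ Ox).
have -> : sk (fun e => P c (pull_ix e t) x * sigma x (upd_ix (pull_ix e) t (e jj))) e0 =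
   - sk (fun e => P c (e jj) x * sigma x (pull_ix e)) e0.
  rewrite -(wskew_swap _ e0 (pos_jj t) (w_swap_jj t)).
  by apply: eq_wskew => e; rewrite swap_jj pull_swap_jj.
have -> : sk (fun e => G x (pull_ix e t) (e jj) * shift c t (pull_ix e)) e0 = 0.
  apply: (wskew_sym0 _ (pos_jj t)) => [e|e]; first exact: w_swap_jj.
  by rewrite swap_jj pull_swap_jj upd_same shI (Gsym Ox).
have -> : sk (fun e => G x (pull_ix e t) c * shift (e jj) t (pull_ix e)) e0 =
  sk (fun e => G x c (pull_ix e t) * shift (e jj) t (pull_ix e)) e0.
  by apply: eq_wskew => e; rewrite (Gsym Ox).
have arith (u v : R) : - (0 - - u + 0 - v) = - u + v by ring.
exact: arith.
Qed.

(** Skew-symmetrised over three indices, each of the three terms of the Bianchi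
    identity has the same value. *)
Lemma wskew_bianchi3 c i t e0 : i != t ->
  sk (fun e => \sum_D riemann_up G (e jj) (pull_ix e i) D (pull_ix e t) x *
    sigma x (upd_ix (upd_ix (pull_ix e) i c) t D)) e0 = 0.
Proof.
have arith (u u1 u2 u3 : R) : u1 = - u -> u2 = - u1 -> u3 = - u1 -> u + u2 + u3 = 0 -> u = 0.
  by move=> -> -> ->; lra.
move=> it; have ti : t != i by rewrite eq_sym.
pose K p q r e := \sum_D riemann_up G p q D r x * sigma x (upd_ix (upd_ix (pull_ix e) i c) t D).
have K1 p q r e y : K p q r (upd_ix e (pos i) y) = K p q r e.
  by apply: eq_bigr => D _; rewrite pull_upd upd_upd.
have K2 p q r e y : K p q r (upd_ix e (pos t) y) = K p q r e.
  by apply: eq_bigr => D _; rewrite pull_upd (updC _ _ _ ti) upd_upd.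
have K3 p q r e y : K p q r (upd_ix e jj y) = K p q r e.
  by apply: eq_bigr => D _; rewrite pull_upd_jj.
pose F e := K (e jj) (pull_ix e i) (pull_ix e t) e.
pose F1 e := K (pull_ix e i) (e jj) (pull_ix e t) e.
pose F2 e := K (pull_ix e i) (pull_ix e t) (e jj) e.
pose F3 e := K (pull_ix e t) (e jj) (pull_ix e i) e.
have f1 : sk F1 e0 = - sk F e0.
  rewrite -(wskew_swap _ e0 (pos_jj i) (w_swap_jj i)).
  apply: eq_wskew => e; rewrite /F swap_jj pull_swap_jj upd_same (upd_other _ _ ti).
  by rewrite swap_ixE K3 K1.
have f2 : sk F2 e0 = - sk F1 e0.
  rewrite -(wskew_swap _ e0 (pos_jj t) (w_swap_jj t)).
  apply: eq_wskew => e; rewrite /F1 swap_jj pull_swap_jj upd_same (upd_other _ _ it).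
  by rewrite swap_ixE K3 K2.
have f3 : sk F3 e0 = - sk F1 e0.
  have pit : pos i != pos t by rewrite (inj_eq pos_inj).
  rewrite -(wskew_swap _ e0 pit (w_swap i t)).
  apply: eq_wskew => e; rewrite /F1 swap_pos pull_swap [swap_ix (pull_ix e) i t i]ffunE tpermL
    [swap_ix (pull_ix e) i t t]ffunE tpermR.
  by rewrite swap_ixE K2 K1.
have f0 : sk F e0 + sk F2 e0 + sk F3 e0 = 0.
  rewrite -!wskewD; transitivity (sk (fun=> 0) e0); last first.
    by rewrite -[RHS](mul0r (sk (fun=> 0) e0)) -wskewZ; apply: eq_wskew => e; rewrite mul0r.
  apply: eq_wskew => e; rewrite -!big_split big1 // => D _ /=.
  by rewrite -!mulrDl (bianchi oO Gsym) // mul0r.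
exact: arith f1 f2 f3 f0.
Qed.

(** At position i, where c has been inserted, the Bianchi identity relates the
    curvature with last index c to the curvature with c in its first pair; at the
    other positions wskew_bianchi3 applies. *)
Lemma wskew_bianchi c e0 :
  sk (fun e => riem_act c (e jj) (pull_ix e)) e0
  + 2^-1 * \sum_i sk (fun e => riem_act (e jj) (pull_ix e i) (upd_ix (pull_ix e) i c)) e0 = 0.
Proof.
pose T1 i e := \sum_D riemann_up G c (e jj) D (pull_ix e i) x * sigma x (upd_ix (pull_ix e) i D).
pose T2 i e := \sum_D riemann_up G (e jj) (pull_ix e i) D c x * sigma x (upd_ix (pull_ix e) i D).
have -> : sk (fun e => riem_act c (e jj) (pull_ix e)) e0 = - \sum_i sk (T1 i) e0.
  by rewrite -wskew_sum -wskewN; apply: eq_wskew => e.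
have e2 i : sk (fun e => riem_act (e jj) (pull_ix e i) (upd_ix (pull_ix e) i c)) e0 = - sk (T2 i) e0.
  pose T3 t e := \sum_D riemann_up G (e jj) (pull_ix e i) D (pull_ix e t) x *
    sigma x (upd_ix (upd_ix (pull_ix e) i c) t D).
  transitivity (sk (fun e => - (T2 i e + \sum_(t | t != i) T3 t e)) e0).
    apply: eq_wskew => e; rewrite sharpE [X in - X = _](bigD1 i isT); congr (- (_ + _)).
      by apply: eq_bigr => D _; rewrite upd_same upd_upd.
    by apply: eq_bigr => t ti; apply: eq_bigr => D _; rewrite (upd_other _ _ ti).
  rewrite wskewN wskewD.
  have -> : sk (fun e => \sum_(t | t != i) T3 t e) e0 = 0.
    by rewrite wskew_sum big1 // => t ti; apply: wskew_bianchi3; rewrite eq_sym.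
  by rewrite addr0.
rewrite mulr_sumr -sumrN -big_split big1 // => i _ /=; rewrite e2.
rewrite (wskew_half (T1 i) _ (pos_jj i)); last exact: w_swap_jj.
rewrite mulrN -opprD -mulrDr -wskewD.
transitivity (- (2^-1 * sk (fun=> 0) e0)).
  congr (- (_ * _)); apply: eq_wskew => e.
  rewrite /T1 /T2 swap_jj pull_swap_jj upd_same -sumrB -big_split big1 // => D _ /=.
  rewrite upd_upd -mulrBl -mulrDl.
  have arith (u v z r : R) : u + z + - v = 0 -> (u - v + z) * r = 0.
    by move=> h; rewrite (_ : u - v + z = 0) ?mul0r //; lra.
  apply: arith; rewrite -riemann_upN; exact: (bianchi oO Gsym).
have -> : sk (fun=> 0) e0 = 0.
  by rewrite -[RHS](mul0r (sk (fun=> 0) e0)) -wskewZ; apply: eq_wskew => e; rewrite mul0r.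
by rewrite mulr0 oppr0.
Qed.

(** Up to a factor, the derivative of the exterior derivative of sigma, multiplied
    by the weight, with the Schouten and Weyl terms that nabla^x adds to it in a
    slot X. *)
Definition differential_defect c e0 : R :=
  sk (fun e => H c (e jj) x (pull_ix e)
     + k.+1%:R * (P c (e jj) x * sigma x (pull_ix e))
     - k.+1%:R / k%:R * weyl_act c (e jj) (pull_ix e)) e0.

(** Solve killing_second for the derivative along c and skew: the curvature terms
    combine by wskew_riemann_weyl and wskew_bianchi, and what remains carries c
    in a metric factor. *)
Lemma differential_defectE c e0 : differential_defect c e0 =
  \sum_i sk (fun e => G x c (e (pos i)) *
     (k.+1%:R / k%:R / N * mtrace G x (fun p => H (e jj) p x) (pull_ix e) i
      + k.+1%:R / k%:R * shift (e jj) i (pull_ix e))) e0.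
Proof.
have arith (r r' r1 W1 W2 W3 S1 S2 S3 S4 : R) : r != 0 -> r1 != 0 -> r' = r + 1 ->
    W1 = W2 - r * W3 + S1 -> W1 + 2^-1 * S2 = 0 -> S3 = 2^-1 * S2 ->
    W1 - r^-1 * S3 + r' / r / r1 * S4 + r' * W3 - r' / r * W2 = r' / r / r1 * S4 + r' / r * S1.
  move=> r0 r10 -> e h ->; have -> : 2^-1 * S2 = - W1 by lra.
  by rewrite e; field; rewrite r0 r10.
have kn0 : (k%:R : R) != 0 by rewrite pnatr_eq0 -lt0n.
have k1 : (k.+1%:R : R) != 0 by rewrite pnatr_eq0.
(* Commute the derivatives and solve killing_second for the one along c. *)
have HE e : H c (e jj) x (pull_ix e) = riem_act c (e jj) (pull_ix e)
    - k%:R^-1 * (\sum_i H (e jj) (pull_ix e i) x (upd_ix (pull_ix e) i c))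
    + k.+1%:R / k%:R / N * \sum_i G x c (pull_ix e i) * mtrace G x (fun p => H (e jj) p x) (pull_ix e) i.
  rewrite second_comm.
  have := killing_second oO Gsym Gunit Gsmooth salt ssmooth ckf (e jj) c (pull_ix e) Ox.
  have kS : (k.+1%:R : R) = k%:R + 1 by rewrite -natr1.
  move: N_neq0 k1; rewrite kS.
  set h := H (e jj) c x _; set s1 := \sum_j _; set s2 := \sum_j _; set rr := sharp _ _ _.
  move: N (k%:R : R) kn0 => r1 r2 r20 r10 r21 E.
  have {}E : h - s1 = (r2 + 1) * (h - r1^-1 * s2) by rewrite -E mulrA mulfV // mul1r.
  have -> : h = r2^-1 * ((r2 + 1) * (r1^-1 * s2) - s1).
    apply: (mulfI r20); rewrite mulrA mulfV // mul1r.
    have -> : r2 * h = (r2 + 1) * h - h by ring.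
    have -> : (r2 + 1) * h = h - s1 + (r2 + 1) * (r1^-1 * s2) by rewrite E; ring.
    ring.
  by field; rewrite r10 r20.
rewrite [RHS](_ : _ = k.+1%:R / k%:R / N *
      (\sum_i sk (fun e => G x c (pull_ix e i) * mtrace G x (fun p => H (e jj) p x) (pull_ix e) i) e0)
    + k.+1%:R / k%:R * \sum_i sk (fun e => G x c (pull_ix e i) * shift (e jj) i (pull_ix e)) e0); last first.
  rewrite !mulr_sumr -big_split; apply: eq_bigr => i _ /=; rewrite -!wskewZ -wskewD.
  apply: eq_wskew => e; rewrite ffunE.
  by rewrite mulrDr mulrCA [_ * (_ / _ * _)]mulrCA.
rewrite /differential_defect wskewB wskewD !wskewZ.
under eq_wskew => e do rewrite HE.
rewrite wskewD wskewB !wskewZ !wskew_sum.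
under eq_bigr => i _ do rewrite wskew_second.
apply: (arith _ _ _ _ _ _ _ _ _ _ kn0 N_neq0 _ (wskew_riemann_weyl c e0) (wskew_bianchi c e0)).
  by rewrite -natr1.
by rewrite mulr_sumr.
Qed.

Lemma cartan_proj_differential_defect c e0 : (m <= n)%N ->
  cartan_proj G x differential_defect c e0 = 0.
Proof.
move=> mn; under eq_cartan_proj => d b do rewrite differential_defectE.
rewrite cartan_proj_sum big1 // => i _.
pose hh (b : {ffun 'I_m -> 'I_n}) := w b * (k.+1%:R / k%:R / N * mtrace G x (fun p => H (b jj) p x) (pull_ix b) i
      + k.+1%:R / k%:R * shift (b jj) i (pull_ix b)).
rewrite -[RHS](@cartan_proj_skewing_metric _ _ G x (Gsym Ox) (Gunit Ox) m (pos i) hh c e0 mn).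
  by apply: eq_cartan_proj => d b; apply: eq_skewing => e; rewrite /hh mulrCA.
move=> b y; rewrite /hh w_pos pull_upd (upd_other b) 1?eq_sym //.
congr (_ * (_ * _ + _ * _)).
  by apply: eq_bigr => p _; apply: eq_bigr => q _; rewrite upd_upd.
by apply: eq_bigr => D _; rewrite upd_upd.
Qed.

End Differential.

End Prolongation.

(** * Tractor words and concatenated indices *)

Section Concatenation.
Context {R : realType} {I : finType} {k l : nat}.
Hypothesis lk : (l <= k)%N.
Implicit Types (a : {ffun 'I_(k - l) -> I}) (b : {ffun 'I_l -> I}).

(** The positions of the tensor indices and of the tractor slots in a
    concatenated multi-index. *)
Definition posl (s : 'I_(k - l)) : 'I_k := cast_ord (subnK lk) (lshift l s).
Definition posr (t : 'I_l) : 'I_k := cast_ord (subnK lk) (rshift (k - l) t).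

Lemma cat_posl a b s : cat_ix a b (posl s) = a s.
Proof.
rewrite ffunE (_ : widen_ord _ _ = lshift l s); last exact: val_inj.
by rewrite (unsplitK (inl s)).
Qed.

Lemma cat_posr a b t : cat_ix a b (posr t) = b t.
Proof.
rewrite ffunE (_ : widen_ord _ _ = rshift (k - l) t); last exact: val_inj.
by rewrite (unsplitK (inr t)).
Qed.

Lemma pos_cases i : (exists s, i = posl s) \/ (exists t, i = posr t).
Proof.
case: (split_ordP (cast_ord (esym (subnK lk)) i)) => s e; [left|right]; exists s;
  by rewrite -[LHS](cast_ordKV (subnK lk)) e.
Qed.

Lemma posl_inj : injective posl.
Proof. by move=> s s' /cast_ord_inj /lshift_inj. Qed.

Lemma posr_inj : injective posr.
Proof. by move=> s s' /cast_ord_inj /rshift_inj. Qed.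

Lemma posl_posr s t : posl s != posr t.
Proof. by rewrite /posl /posr (inj_eq (@cast_ord_inj _ _ _)) eq_lrshift. Qed.

Lemma sum_pos (F : 'I_k -> R) : \sum_i F i = \sum_s F (posl s) + \sum_t F (posr t).
Proof.
rewrite (reindex (cast_ord (subnK lk))); last first.
  by exists (cast_ord (esym (subnK lk))) => i _; rewrite ?cast_ordK ?cast_ordKV.
by rewrite big_split_ord.
Qed.

Lemma cat_updl a b s y : cat_ix (upd_ix a s y) b = upd_ix (cat_ix a b) (posl s) y.
Proof.
apply/ffunP => i; have [[s' ->]|[t ->]] := pos_cases i.
  have [->|ss] := eqVneq s' s; first by rewrite cat_posl !upd_same.
  by rewrite cat_posl !upd_other ?cat_posl // (inj_eq posl_inj).
by rewrite cat_posr upd_other ?cat_posr // eq_sym posl_posr.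
Qed.

Lemma cat_updr a b t y : cat_ix a (upd_ix b t y) = upd_ix (cat_ix a b) (posr t) y.
Proof.
apply/ffunP => i; have [[s ->]|[t' ->]] := pos_cases i.
  by rewrite cat_posl upd_other ?cat_posl // posl_posr.
have [->|tt] := eqVneq t' t; first by rewrite cat_posr !upd_same.
by rewrite cat_posr !upd_other ?cat_posr // (inj_eq posr_inj).
Qed.

Lemma cat_swapl a b s s' : cat_ix (swap_ix a s s') b = swap_ix (cat_ix a b) (posl s) (posl s').
Proof. by rewrite !swap_ixE !cat_updl !cat_posl. Qed.

Lemma cat_swapr a b t t' : cat_ix a (swap_ix b t t') = swap_ix (cat_ix a b) (posr t) (posr t').
Proof. by rewrite !swap_ixE !cat_updr !cat_posr. Qed.

Lemma alt_catl (F : {ffun 'I_k -> I} -> R) b : alternating F -> alternating (fun a => F (cat_ix a b)).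
Proof. by move=> aF s s' a ss; rewrite cat_swapl aF // (inj_eq posl_inj). Qed.

Lemma alt_catr (F : {ffun 'I_k -> I} -> R) a : alternating F -> alternating (fun b => F (cat_ix a b)).
Proof. by move=> aF s s' b ss; rewrite cat_swapr aF // (inj_eq posr_inj). Qed.

Lemma sharp_cat (S : I -> I -> R) (F : {ffun 'I_k -> I} -> R) a b :
  sharp S F (cat_ix a b) =
  sharp S (fun a' => F (cat_ix a' b)) a + sharp S (fun b' => F (cat_ix a b')) b.
Proof.
rewrite ![in RHS]sharpE -[RHS]opprD [LHS]sharpE; congr (- _).
rewrite [LHS]sum_pos; congr (_ + _).
  by apply: eq_bigr => s _; apply: eq_bigr => D _; rewrite cat_updl cat_posl.
by apply: eq_bigr => s _; apply: eq_bigr => D _; rewrite cat_updr cat_posr.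
Qed.

End Concatenation.

(** Under a uniformly distributed permutation every value of s(i0) is equally
    likely. *)
Lemma sum_perm_at (R : realType) l (i0 : 'I_l) (f : 'I_l -> R) :
  (l`!%:R)^-1 * \sum_(s : 'S_l) f (s i0) = l%:R^-1 * \sum_j f j.
Proof.
have l0 : (l%:R : R) != 0 by rewrite pnatr_eq0 -lt0n (leq_ltn_trans _ (ltn_ord i0)).
have e i : \sum_(s : 'S_l) f (s i) = \sum_(s : 'S_l) f (s i0).
  rewrite (reindex_inj (mulgI (tperm i0 i))) /=.
  by apply: eq_bigr => s _; rewrite permM tpermR.
apply: (mulfI l0); rewrite [RHS]mulrA mulfV // mul1r [LHS]mulrCA.
have -> : l%:R * \sum_(s : 'S_l) f (s i0) = \sum_i \sum_(s : 'S_l) f (s i).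
  by under [RHS]eq_bigr => i _ do rewrite e; rewrite sumr_const card_ord mulr_natl.
rewrite exchange_big /=.
rewrite (eq_bigr (fun=> \sum_j f j)) => [|s _]; last by rewrite [RHS](reindex_inj (@perm_inj _ s)).
by rewrite sumr_const card_Sn -[X in _ * X]mulr_natl mulKf // fact_neq0.
Qed.

Section TractorWords.
Context {R : realType} {n l : nat}.
Implicit Types (b : {ffun 'I_l -> 'I_n}) (B : {ffun 'I_l -> tix n}).

(** Contraction with a form makes the skew-symmetrisation of the Z-factors
    superfluous, by relabelling the summation index. *)
Lemma sum_ZZ (phi : {ffun 'I_l -> 'I_n} -> R) B : alternating phi ->
  \sum_(b : {ffun 'I_l -> 'I_n}) ZZ B b * phi b = \sum_(b : {ffun 'I_l -> 'I_n}) (\prod_i Zt (B i) (b i)) * phi b.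
Proof.
move=> aphi; rewrite /ZZ; under eq_bigr => b _ do rewrite skewingE -mulrA mulr_suml.
rewrite -mulr_sumr exchange_big /=.
rewrite (eq_bigr (fun=> \sum_(b : {ffun 'I_l -> 'I_n}) (\prod_i Zt (B i) (b i)) * phi b)); last first.
  move=> s _; rewrite (reindex_inj (h := fun b => perm_ix b s)) /=; last first.
    move=> b b' e; apply/ffunP => i.
    by have /ffunP/(_ ((s^-1)%g i)) := e; rewrite !ffunE permKV.
  apply: eq_bigr => b _; rewrite alt_perm // mulrACA -expr2 sqrr_sign mul1r; congr (_ * _).
  by rewrite [RHS](reindex_inj (@perm_inj _ s)) /=; apply: eq_bigr => i _; rewrite !ffunE.
by rewrite sumr_const card_Sn -[X in _ * X]mulr_natl mulKf // fact_neq0.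
Qed.

Definition prodX (j : 'I_l) B b : R := \prod_(i < l) (if i == j then Xt (B i) else Zt (B i) (b i)).

(** After relabelling the summation index, the factor X sits at the image of the
    first position, which by sum_perm_at is distributed uniformly over all
    positions. This replaces the preferred first slot by a symmetric sum. *)
Lemma sum_XX (phi : 'I_l -> {ffun 'I_l -> 'I_n} -> R) (i0 : 'I_l) B : i0 = 0 :> nat ->
  (forall b (s : 'S_l) i, phi i (perm_ix b s) = (-1) ^+ s * phi (s i) b) ->
  l%:R * \sum_(b : {ffun 'I_l -> 'I_n}) XX B b * phi i0 b = \sum_j \sum_(b : {ffun 'I_l -> 'I_n}) prodX j B b * phi j b.
Proof.
move=> i00 aphi; rewrite /XX.
have l0 : (l%:R : R) != 0 by rewrite pnatr_eq0 -lt0n (leq_ltn_trans _ (ltn_ord i0)).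
under eq_bigr => b _ do rewrite skewingE -mulrA mulr_suml.
rewrite -mulr_sumr exchange_big /=.
rewrite (eq_bigr (fun s : 'S_l => \sum_(b : {ffun 'I_l -> 'I_n}) prodX (s i0) B b * phi (s i0) b)); last first.
  move=> s _; rewrite (reindex_inj (h := fun b => perm_ix b s)) /=; last first.
    move=> b b' e; apply/ffunP => i.
    by have /ffunP/(_ ((s^-1)%g i)) := e; rewrite !ffunE permKV.
  apply: eq_bigr => b _; rewrite aphi.
  rewrite mulrACA -expr2 sqrr_sign mul1r; congr (_ * _).
  rewrite [prodX _ _ _](reindex_inj (@perm_inj _ s)) /=; apply: eq_bigr => i _.
  have -> : (s i == s i0) = (i == 0 :> nat) by rewrite (inj_eq perm_inj) -(inj_eq val_inj) /= i00.
  by rewrite !ffunE.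
by rewrite (sum_perm_at i0 (fun j => \sum_(b : {ffun 'I_l -> 'I_n}) prodX j B b * phi j b)) mulrA mulfV ?mul1r.
Qed.

Lemma prod_Zt_zword b0 b : \prod_i Zt (zword b0 i) (b i) = (b0 == b)%:R :> R.
Proof.
have [->|nb] := eqVneq b0 b; first by rewrite big1 // => i _; rewrite ffunE Zt_tZ eqxx.
have [i bi] : exists i, b0 i != b i.
  apply/existsP; rewrite -negb_forall; apply: contraNN nb => /forallP e.
  by apply/eqP/ffunP => i; apply/eqP.
by rewrite (bigD1 i) //= ffunE Zt_tZ (negbTE bi) mul0r.
Qed.

Lemma prod_Zt0 B b i : (forall d, B i != tZ d) -> \prod_i Zt (B i) (b i) = 0 :> R.
Proof. by move=> Bi; rewrite (bigD1 i) //= /Zt (negbTE (Bi _)) mul0r. Qed.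

Lemma prodX0 j B b i : i != j -> (forall d, B i != tZ d) -> prodX j B b = 0.
Proof. by move=> ij Bi; rewrite /prodX (bigD1 i) //= (negbTE ij) /Zt (negbTE (Bi _)) mul0r. Qed.

Lemma prodX_notX j B b : B j != tX -> prodX j B b = 0.
Proof. by move=> Bj; rewrite /prodX (bigD1 j) //= eqxx /Xt (negbTE Bj) mul0r. Qed.

Lemma sum_prodX (phi : {ffun 'I_l -> 'I_n} -> R) j b0 :
  \sum_(b : {ffun 'I_l -> 'I_n}) prodX j (upd_ix (zword b0) j tX) b * phi b = \sum_p phi (upd_ix b0 j p).
Proof.
rewrite (partition_big (fun b => b j) xpredT) //=; apply: eq_bigr => p _.
rewrite (bigD1 (upd_ix b0 j p)) ?upd_same //= [X in _ + X]big1 ?addr0 => [|b /andP[/eqP bj nb]]; last first.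
  have [i /andP[ij bi]] : exists i, (i != j) && (b0 i != b i).
    apply/existsP; rewrite -[[exists i, _]]negbK negb_exists; apply: contraNN nb => /forallP e.
    apply/eqP/ffunP => i; have [->|ij] := eqVneq i j; first by rewrite upd_same.
    by have := e i; rewrite ij negbK upd_other // => /eqP.
  by rewrite /prodX (bigD1 i) //= (negbTE ij) upd_other // ffunE Zt_tZ (negbTE bi) !mul0r.
rewrite /prodX big1 ?mul1r // => i _; have [->|ij] := eqVneq i j.
  by rewrite upd_same /Xt eqxx.
by rewrite !upd_other // ffunE Zt_tZ eqxx.
Qed.

End TractorWords.

(** * The first extension *)

Section SkewProjection.
Context {R : realType} {n m : nat}.
Variables (G : 'rV[R]_n -> 'M[R]_n) (x : 'rV[R]_n) (S : 'I_n -> {ffun 'I_m -> 'I_n} -> R).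
Hypothesis gsym : forall a b, G x a b = G x b a.
Hypothesis Salt : forall d, alternating (S d).

Notation K := (cartan_proj G x S).

(** Skewness in the first index and a single form index propagates to all
    indices, since the form indices are skew among themselves; and the
    projection has no totally skew part. *)
Lemma cartan_proj_eq0 (p : 'I_m) : (forall c (u : {ffun 'I_m -> 'I_n}), K (u p) (upd_ix u p c) = - K c u) ->
  forall c u, K c u = 0.
Proof.
move=> Kp; have Ki i c (u : {ffun 'I_m -> 'I_n}) : K (u i) (upd_ix u i c) = - K c u.
  have [->//|ip] := eqVneq i p.
  have := Kp c (swap_ix u i p); rewrite (alt_cartan_proj G x Salt c u ip) opprK => <-.
  rewrite upd_swap tpermR (alt_cartan_proj G x Salt _ _ ip) ffunE tpermR opprK.
  by [].
move=> c u; have : K c u = \sum_(j < m) - K c u.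
  by rewrite {1}(cartan_proj_unskew gsym Salt); apply: eq_bigr => j _; rewrite Ki.
rewrite sumr_const card_ord mulNrn => e.
have {e} : m.+1%:R * K c u = 0 by rewrite mulr_natl mulrS {1}e addNr.
by move/eqP; rewrite mulf_eq0 pnatr_eq0 => /eqP.
Qed.

End SkewProjection.

Section Overline.
Context {R : realType} {n : nat}.
Variables (G : 'rV[R]_n -> 'M[R]_n) (O : set 'rV[R]_n).
Hypothesis oO : open O.
Hypothesis Gsym : forall x, O x -> forall a b, G x a b = G x b a.
Hypothesis Gunit : forall x, O x -> G x \in unitmx.
Hypothesis Gsmooth : forall a b, smooth_on O (fun x => G x a b).
Variables (k : nat) (sigma : 'rV[R]_n -> {ffun 'I_k -> 'I_n} -> R).
Hypothesis kn : (k < n)%N.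
Hypothesis salt : forall y, O y -> alternating (sigma y).
Hypothesis ssmooth : forall b, smooth_on O (sigma^~ b).
Variables (l : nat).
Hypothesis l0 : (0 < l)%N.
Hypothesis lk : (l < k)%N.

Notation gi := (ginv G).
Notation N := ((n - k + 1)%:R : R).
Notation T := (overline G (l := l) sigma).
Notation S y := (fun p b => nabla_tensor G sigma p y b).
Notation K y := (cartan_proj G y (S y)).
Notation pl := (posl (ltnW lk)).
Notation pr := (posr (ltnW lk)).
Implicit Types (a : {ffun 'I_(k - l) -> 'I_n}) (b : {ffun 'I_l -> 'I_n}) (B : {ffun 'I_l -> tix n}).

Lemma alt_derivative y p : O y -> alternating (nabla_tensor G sigma p y).
Proof. by move=> Oy; apply: (alt_nabla _ oO). Qed.

Lemma overlineE y a B : O y -> T y a B =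
  N * (\sum_(b : {ffun 'I_l -> 'I_n}) (\prod_i Zt (B i) (b i)) * sigma y (cat_ix a b))
  - \sum_j \sum_(b : {ffun 'I_l -> 'I_n}) prodX j B b * \sum_d gi y (b j) d * nabla_tensor G sigma d y (cat_ix a b).
Proof.
move=> Oy; rewrite /overline; congr (_ * _ - _).
  by apply: sum_ZZ; apply: (alt_catr (ltnW lk)); apply: salt.
rewrite -(@sum_XX _ _ _ (fun j b => \sum_d gi y (b j) d * nabla_tensor G sigma d y (cat_ix a b)) (Ordinal l0)) //.
  congr (_ * _); apply: eq_bigr => b _; congr (_ * _).
  by rewrite (big_pred1 (Ordinal l0)) // => i; rewrite -(inj_eq val_inj).
move=> b s i; rewrite mulr_sumr; apply: eq_bigr => d _; rewrite ffunE.
have := alt_perm s b (alt_catr (ltnW lk) a (alt_derivative d Oy)) => /= ->.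
by rewrite mulrCA.
Qed.

Lemma overline_Z y a b : O y -> T y a (zword b) = N * sigma y (cat_ix a b).
Proof.
move=> Oy; rewrite overlineE // [X in _ - X]big1 ?subr0 => [|j _]; last first.
  by rewrite big1 // => b' _; rewrite prodX_notX ?mul0r // ffunE.
congr (_ * _); under eq_bigr => b' _ do rewrite prod_Zt_zword.
rewrite (bigD1 b) //= eqxx mul1r big1 ?addr0 // => b' nb.
by rewrite eq_sym (negbTE nb) mul0r.
Qed.

Lemma overline_X y a b j : O y -> T y a (upd_ix (zword b) j tX) =
  - mtrace G y (S y) (cat_ix a b) (pr j).
Proof.
move=> Oy; rewrite overlineE // big1 ?mulr0 ?sub0r => [|b' _]; last first.
  by rewrite (prod_Zt0 _ (i := j)) ?mul0r // => d; rewrite upd_same.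
congr (- _); rewrite (bigD1 j) //= [X in _ + X]big1 ?addr0 => [|i ij]; last first.
  by rewrite big1 // => b' _; rewrite prodX_notX ?mul0r // upd_other // ffunE.
rewrite (sum_prodX (fun b => \sum_d gi y (b j) d * nabla_tensor G sigma d y (cat_ix a b))).
rewrite /mtrace exchange_big; apply: eq_bigr => p _; apply: eq_bigr => d _ /=.
have -> : upd_ix b j d j = d by rewrite upd_same.
by rewrite (ginv_sym (Gsym Oy) d p) -(cat_updr (ltnW lk) a b j d).
Qed.

Lemma overline_Y y a B i : O y -> B i = tY -> T y a B = 0.
Proof.
move=> Oy Bi; rewrite overlineE // !big1 ?mulr0 ?subrr // => [j _|b _]; last first.
  by rewrite (prod_Zt0 _ (i := i)) ?mul0r // Bi.
rewrite big1 // => b _; have [ij|ij] := eqVneq i j.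
  by rewrite prodX_notX ?mul0r // -ij Bi.
by rewrite (prodX0 _ ij) ?mul0r // Bi.
Qed.

Lemma overline_XX y a B i j : O y -> i != j -> B i = tX -> B j = tX -> T y a B = 0.
Proof.
move=> Oy ij Bi Bj; rewrite overlineE // !big1 ?mulr0 ?subrr // => [j' _|b _]; last first.
  by rewrite (prod_Zt0 _ (i := i)) ?mul0r // Bi.
rewrite big1 // => b _; have [ij'|ij'] := eqVneq i j'.
  by rewrite (@prodX0 R n l j' B b j) ?mul0r // ?Bj // -ij' eq_sym.
by rewrite (prodX0 _ ij') ?mul0r // Bi.
Qed.

Lemma overline_alt y a : alternating (T y a).
Proof.
move=> i j B ij; rewrite /overline.
have e1 : \sum_(b : {ffun 'I_l -> 'I_n}) ZZ (swap_ix B i j) b * sigma y (cat_ix a b) =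
  - \sum_(b : {ffun 'I_l -> 'I_n}) ZZ B b * sigma y (cat_ix a b).
  by rewrite -sumrN; apply: eq_bigr => b _; rewrite -mulNr; congr (_ * _); apply: alt_skewing ij.
have e2 (phi : {ffun 'I_l -> 'I_n} -> R) :
  \sum_(b : {ffun 'I_l -> 'I_n}) XX (swap_ix B i j) b * phi b =
  - \sum_(b : {ffun 'I_l -> 'I_n}) XX B b * phi b.
  by rewrite -sumrN; apply: eq_bigr => b _; rewrite -mulNr; congr (_ * _); apply: alt_skewing ij.
by rewrite e1 e2 !mulrN opprK opprB addrC.
Qed.

Lemma overline_der x a B : O x -> pderivable (fun y => T y a B) x.
Proof.
move=> Ox; have dc (r : R) : pderivable (fun=> r) x by apply: pderivable_cst.
apply: pderivableB; (apply: pderivableM; first exact: dc); apply: pderivable_sum => b _;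
  (apply: pderivableM; first exact: dc).
  exact: (smooth_pderivable [::] (ssmooth _)).
apply: pderivable_sum => j _; apply: pderivable_sum => d _; apply: pderivableM.
  exact: (pderivable_ginv oO Gunit Gsmooth).
exact: (pderivable_nabla oO Gunit Gsmooth).
Qed.

Lemma split_ix (u : {ffun 'I_k -> 'I_n}) : exists a b, u = cat_ix a b.
Proof.
exists [ffun s => u (pl s)], [ffun t => u (pr t)]; apply/ffunP => i.
have [[s ->]|[t ->]] := pos_cases (ltnW lk) i.
  by rewrite cat_posl ffunE.
by rewrite cat_posr ffunE.
Qed.

Section AtAPoint.
Variable x : 'rV[R]_n.
Hypothesis Ox : O x.

Let Salt d : alternating (S x d).
Proof. exact: (alt_derivative d Ox). Qed.

Lemma overline_nabla_Z r c a b : nabla_x G r T c x a (zword b) =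
  N * nabla_tensor G sigma c x (cat_ix a b)
  - \sum_j G x c (b j) * mtrace G x (S x) (cat_ix a b) (pr j).
Proof.
have TZ y a' b' : O y -> T y a' (zword b') = N * sigma y (cat_ix a' b').
  by move=> Oy; apply: overline_Z.
rewrite (nabla_x_Z G Ox); last by move=> y a' B i; apply: overline_Y.
rewrite (pd_near (h := fun y => N * sigma y (cat_ix a b)) _ oO Ox); last by move=> y Oy; apply: TZ.
rewrite pdZ; last exact: (smooth_pderivable [::] (ssmooth _)).
have -> : (fun a' => T x a' (zword b)) = (fun a' => N * sigma x (cat_ix a' b)).
  by apply/funext => a'; apply: TZ.
have -> : (fun b' => T x a (zword b')) = (fun b' => N * sigma x (cat_ix a b')).
  by apply/funext => b'; apply: TZ.
rewrite !sharpZ -!mulrDr; congr (_ * _ + _).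
  by rewrite nablaE -addrA -(sharp_cat (ltnW lk)).
rewrite -sumrN; apply: eq_bigr => j _.
by rewrite overline_X // mulrN.
Qed.

(** The trace commutes with the covariant derivative, which acts on the tensor
    indices and on the slots Z like on the indices of sigma; the slots Z other
    than j and the tensor indices together make up the positions other than j. *)
Lemma overline_nabla_X c a b j :
  nabla_x G (2 / (n - k)%:R) T c x a (upd_ix (zword b) j tX) =
  codifferential_defect G sigma x (pr j) c (cat_ix a b).
Proof.
have TZ a' b' : T x a' (zword b') = N * sigma x (cat_ix a' b').
  exact: overline_Z.
have TX y a' b' : O y -> T y a' (upd_ix (zword b') j tX) = - mtrace G y (S y) (cat_ix a' b') (pr j).
  by move=> Oy; apply: overline_X.
have dS d u : pderivable (fun y => nabla_tensor G sigma d y u) x.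
  exact: (pderivable_nabla oO Gunit Gsmooth).
rewrite (nabla_x_X Ox (Gsym Ox)); first last.
- by move=> y a' B i i'; apply: overline_XX.
- by move=> y a' B i; apply: overline_Y.
rewrite (pd_near (h := fun y => - mtrace G y (S y) (cat_ix a b) (pr j)) _ oO Ox); last by move=> y Oy; apply: TX.
rewrite pdN; last exact: (pderivable_mtrace oO Gunit Gsmooth (S := fun p y => nabla_tensor G sigma p y) _ _ Ox).
have -> : (fun a' => T x a' (upd_ix (zword b) j tX)) = (fun a' => - mtrace G x (S x) (cat_ix a' b) (pr j)).
  by apply/funext => a'; apply: TX.
have -> : \sum_(i | i != j) \sum_d christoffel G d c (b i) x * T x a (upd_ix (zword (upd_ix b i d)) j tX) =
   - \sum_(i | i != j) \sum_d christoffel G d c (b i) x * mtrace G x (S x) (upd_ix (cat_ix a b) (pr i) d) (pr j).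
  rewrite -sumrN; apply: eq_bigr => i _; rewrite -sumrN; apply: eq_bigr => d _.
  by rewrite TX // mulrN (cat_updr (ltnW lk)).
rewrite sharpN sharpE.
have -> : \sum_s \sum_D christoffel G D c (a s) x * mtrace G x (S x) (cat_ix (upd_ix a s D) b) (pr j) =
   \sum_s \sum_D christoffel G D c (a s) x * mtrace G x (S x) (upd_ix (cat_ix a b) (pl s) D) (pr j).
  by apply: eq_bigr => i _; apply: eq_bigr => d _; rewrite (cat_updl (ltnW lk)).
have E := nabla_mtrace oO Gsym Gunit Gsmooth (S := fun p y => nabla_tensor G sigma p y) (pr j) c (cat_ix a b) Ox dS.
(* Split the positions other than the traced one into tensor indices and slots. *)
rewrite [X in _ - X = _](big_mkcond) /= (sum_pos (ltnW lk)) in E.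
have El : \sum_s (if pl s != pr j then \sum_D christoffel G D c (cat_ix a b (pl s)) x *
      mtrace G x (S x) (upd_ix (cat_ix a b) (pl s) D) (pr j) else 0) =
   \sum_s \sum_D christoffel G D c (a s) x * mtrace G x (S x) (upd_ix (cat_ix a b) (pl s) D) (pr j).
  by apply: eq_bigr => s _; rewrite posl_posr cat_posl.
have Er : \sum_s (if pr s != pr j then \sum_D christoffel G D c (cat_ix a b (pr s)) x *
      mtrace G x (S x) (upd_ix (cat_ix a b) (pr s) D) (pr j) else 0) =
   \sum_(i | i != j) \sum_D christoffel G D c (b i) x * mtrace G x (S x) (upd_ix (cat_ix a b) (pr i) D) (pr j).
  rewrite [RHS]big_mkcond; apply: eq_bigr => s _.
  by rewrite (inj_eq (@posr_inj _ _ (ltnW lk))) cat_posr.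
rewrite El Er in E.
have EP : \sum_d schouten_up G d c x * T x a (zword (upd_ix b j d)) =
    N * schouten_shift G x (sigma x) c (pr j) (cat_ix a b).
  rewrite mulr_sumr; apply: eq_bigr => d _; rewrite TZ (cat_updr (ltnW lk)).
  exact: mulrCA.
have EW : \sum_d \sum_e ginv G x d e *
   (sharp (fun f g => weyl_up G c e f g x) (fun a' => T x a' (zword (upd_ix b j d))) a +
    sharp (fun f g => weyl_up G c e f g x) (fun b' => T x a (zword b')) (upd_ix b j d)) =
   N * contr G x (fun d q => sharp (fun f g => weyl_up G c d f g x) (sigma x) (upd_ix (cat_ix a b) (pr j) q)).
  rewrite (contr_sym (Gsym Ox)) -contrZ; apply: eq_bigr => d _; apply: eq_bigr => e _; congr (_ * _).
  have -> : (fun a' => T x a' (zword (upd_ix b j d))) = (fun a' => N * sigma x (cat_ix a' (upd_ix b j d))).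
    by apply/funext => a'; apply: TZ.
  have -> : (fun b' => T x a (zword b')) = (fun b' => N * sigma x (cat_ix a b')).
    by apply/funext => b'; apply: TZ.
  by rewrite !sharpZ -mulrDr -(sharp_cat (ltnW lk)) (cat_updr (ltnW lk)).
rewrite EP EW /codifferential_defect -E.
have arith (p s t P W r : R) : - p - - s - - t - P + 2 / r / 2 * (N * W) =
   - (p - (s + t)) - P + N / r * W.
  have -> : 2 / r / 2 = r^-1 :> R by rewrite mulrAC mulfV ?mul1r ?pnatr_eq0.
  ring.
exact: arith.
Qed.

(** In the formula of cartan_projE for K the trace terms over the slots Z are
    those that the X-components of the extension supply. The trace terms over
    the tensor indices are pure traces in a as well, and the totally skew part
    of S is skew in c and a. *)
Lemma cartan_proj_overline_Z r c a b :
  cartan_proj G x (fun c a => nabla_x G r T c x a (zword b)) c a =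
  N * cartan_proj G x (fun c a => K x c (cat_ix a b)) c a.
Proof.
pose D c u := S x c u - \sum_j S x (u j) (upd_ix u j c).
pose t s a := mtrace G x (S x) (cat_ix a b) (pl s).
have N0 : N != 0 by rewrite pnatr_eq0 addn1.
have mn : (k - l <= n)%N by rewrite (leq_trans (leq_subr _ _)) // ltnW.
transitivity (cartan_proj G x (fun c a => N * K x c (cat_ix a b)
    + (N / k.+1%:R * D c (cat_ix a b) + \sum_s G x c (a s) * t s a)) c a).
  apply: eq_cartan_proj => d a'; rewrite overline_nabla_Z cartan_projE //.
  rewrite -/(D d (cat_ix a' b)) [X in N^-1 * X](sum_pos (ltnW lk)).
  under [X in N^-1 * (X + _)]eq_bigr => s _ do rewrite cat_posl -/(t s a').
  under [X in N^-1 * (_ + X)]eq_bigr => s _ do rewrite cat_posr.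
  
  have arith (r1 r2 S0 D0 s1 s2 : R) : r1 != 0 ->
     r1 * S0 - s2 = r1 * (S0 - r2 * D0 - r1^-1 * (s1 + s2)) + (r1 * r2 * D0 + s1).
    by move=> r10; field.
  exact: arith.
rewrite cartan_projD cartan_projD !cartan_projZ.
rewrite [X in _ + (_ * X + _)](_ : _ = 0) ?mulr0 ?add0r; last first.
  apply: (cartan_proj_skew (Gsym Ox)) => [d|d a' s].
    exact: (alt_catl (ltnW lk) b (alt_skew_diff Salt d)).
  have := skew_diff_total Salt d (cat_ix a' b) (pl s).
  by rewrite -!/(D _ _) cat_posl -(cat_updl (ltnW lk)).
rewrite (cartan_proj_trace (Gsym Ox) (Gunit Ox)) ?addr0 // => [s a' y|i j a' ij].
  by rewrite /t (cat_updl (ltnW lk)) mtrace_indep.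
rewrite /t (cat_updl (ltnW lk)) -(cat_posl (ltnW lk) a' b i).
by apply: mtrace_move => //; rewrite (inj_eq (@posl_inj _ _ (ltnW lk))).
Qed.

End AtAPoint.

(** In the components without second derivatives c sits at the position of a
    slot of sigma, or of a trace of S, so these are skew in c and a. *)
Lemma killing_overline : (forall y, O y -> forall c u, K y c u = 0) ->
  forall y, O y -> forall c a B,
    cartan_proj G y (fun c a => nabla_x G (2 / (n - k)%:R) T c y a B) c a = 0.
Proof.
move=> ckf y Oy c a B.
have Tproj (b : {ffun 'I_l -> 'I_n}) (p : 'I_l) (F : {ffun 'I_k -> 'I_n} -> R) : alternating F ->
  forall c a, cartan_proj G y (fun c a => F (cat_ix a (upd_ix b p c))) c a = 0.
  move=> aF c' a'; apply: (cartan_proj_skew (Gsym Oy)) => [d|d a1 s].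
    exact: (alt_catl (ltnW lk)).
  rewrite (cat_updl (ltnW lk)) !(cat_updr (ltnW lk)) -(cat_posl (ltnW lk) a1 b s).
  by apply: alt_move => //; apply: posl_posr.
apply: (cartan_proj_nabla_x oO Oy) => //.
- by move=> y' a' B' i; apply: overline_Y.
- by move=> y' a' _; apply: overline_alt.
- by move=> a' B'; apply: overline_der.
- move=> b c' a'; rewrite cartan_proj_overline_Z //.
  rewrite (@eq_cartan_proj _ _ G y _ _ (fun _ _ => 0)) ?cartan_proj0 ?mulr0 // => d a1; exact: ckf.
- move=> b j c' a'.
  rewrite (@eq_cartan_proj _ _ G y _ _ (fun c a => codifferential_defect G sigma y (pr j) c (cat_ix a b))); last first.
    by move=> d a1; apply: overline_nabla_X.
  apply: (cartan_proj_skew (Gsym Oy)) => [d i i' a1 ii|d a1 s].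
    rewrite (cat_swapl (ltnW lk)).
    apply: (codifferential_defect_alt oO Gunit Gsmooth salt ssmooth Oy);
      by rewrite ?posl_posr ?(inj_eq (@posl_inj _ _ (ltnW lk))).
  rewrite (cat_updl (ltnW lk)) -(cat_posl (ltnW lk) a1 b s).
  apply: (codifferential_defect_move oO Gsym Gunit Gsmooth kn salt ssmooth ckf Oy).
  exact: posl_posr.
- move=> b j c' a'.
  rewrite (@eq_cartan_proj _ _ G y _ _ (fun c a => N * sigma y (cat_ix a (upd_ix b j c)))); last first.
    by move=> d a1; apply: overline_Z.
  by rewrite cartan_projZ Tproj ?mulr0 //; apply: salt.
- move=> b i j c' a' ij.
  rewrite (@eq_cartan_proj _ _ G y _ _ (fun c a => - 1 * mtrace G y (S y) (cat_ix a (upd_ix b j c)) (pr i))); last first.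
    by move=> d a1; rewrite overline_X // mulN1r.
  rewrite cartan_projZ (_ : cartan_proj _ _ _ _ _ = 0) ?mulr0 //.
  apply: (cartan_proj_skew (Gsym Oy)) => [d s s' a1 ss|d a1 s].
    rewrite (cat_swapl (ltnW lk)) -sumrN; apply: eq_bigr => p _; rewrite -sumrN; apply: eq_bigr => q _.
    rewrite upd_swap tpermD ?posl_posr // -mulrN; congr (_ * _).
    by apply: alt_derivative => //; rewrite (inj_eq (@posl_inj _ _ (ltnW lk))).
  rewrite (cat_updl (ltnW lk)) !(cat_updr (ltnW lk)) -sumrN; apply: eq_bigr => p _; rewrite -sumrN; apply: eq_bigr => q _.
  rewrite -mulrN; congr (_ * _).
  (* Normalise the multi-indices so that c and the entry of a at s trade places at
   the slot j and the position s. *)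
  have ps : pl s != pr i := posl_posr _ _ _.
  have pj : pr j != pr i by rewrite (inj_eq (@posr_inj _ _ (ltnW lk))) eq_sym.
  rewrite (updC _ d q ps) (updC _ (a1 s) q pj) (updC _ d q pj).
  have -> : a1 s = upd_ix (cat_ix a1 b) (pr i) q (pl s) by rewrite upd_other // cat_posl.
  by apply: alt_move; [exact: alt_derivative|exact: posl_posr].
Qed.

(** Since K is trace-free, its projection with respect to the tensor indices alone
    can only vanish if K is skew in c and these; a single one of them is enough
    for cartan_proj_eq0. *)
Lemma overline_killing :
  (forall y, O y -> forall c a B,
    cartan_proj G y (fun c a => nabla_x G (2 / (n - k)%:R) T c y a B) c a = 0) ->
  forall y, O y -> forall c u, K y c u = 0.
Proof.
move=> tk y Oy; have Sa d : alternating (S y d) := alt_derivative d Oy.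
have kl : (0 < k - l)%N by rewrite subn_gt0.
apply: (cartan_proj_eq0 (Gsym Oy) Sa (p := pl (Ordinal kl))) => c u.
have [a [b ->]] := split_ix u; rewrite cat_posl -(cat_updl (ltnW lk)).
pose S' c a := K y c (cat_ix a b).
have S'a d : alternating (S' d).
  exact: (alt_catl (ltnW lk) b (alt_cartan_proj G y Sa d)).
have E d a' : S' d a' = (k - l).+1%:R^-1 * (S' d a' - \sum_j S' (a' j) (upd_ix a' j d)).
  have := tk y Oy d a' (zword b); rewrite cartan_proj_overline_Z // => /eqP.
  rewrite mulf_eq0 pnatr_eq0 addn1 /= => /eqP.
  rewrite cartan_projE // [X in _ - _ * X]big1 ?mulr0 ?subr0 => [/eqP|s _]; first by rewrite subr_eq0 => /eqP.
  rewrite (_ : mtrace _ _ _ _ _ = 0) ?mulr0 //.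
  rewrite -(mtrace_cartan_proj (Gsym Oy) (Gunit Oy) Sa (ltnW kn) (cat_ix a' b) (pl s)).
  by apply: eq_bigr => p _; apply: eq_bigr => q _; rewrite (cat_updl (ltnW lk)).
rewrite -!/(S' _ _) E (skew_diff_total S'a) mulrN; congr (- _).
exact/esym.
Qed.

End Overline.

(** * Products of metric factors *)

Lemma skewing_exch (R : realType) (I J : finType) m l
    (F : {ffun 'I_m -> I} -> {ffun 'I_l -> J} -> R) a B :
  skewing (fun a' => skewing (F a') B) a = skewing (fun B' => skewing (F^~ B') a) B.
Proof.
rewrite skewingE; under [RHS]eq_skewing => B' do rewrite skewingE.
rewrite skewingZ skewing_sum; congr (_ * _); apply: eq_bigr => s _.
by rewrite skewingZ.
Qed.

Section Append.
Context {I : finType} {k l : nat}.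
Implicit Types a : {ffun 'I_(k + l) -> I}.

Lemma take_updl a i y : take_ix (upd_ix a (lshift l i) y) = upd_ix (take_ix a) i y.
Proof. by apply/ffunP => t; rewrite !ffunE (inj_eq (@lshift_inj _ _)). Qed.

Lemma take_updr a j y : take_ix (upd_ix a (rshift k j) y) = take_ix a.
Proof. by apply/ffunP => t; rewrite !ffunE eq_lrshift. Qed.

Lemma take_swapr a i j : take_ix (swap_ix a (rshift k i) (rshift k j)) = take_ix a.
Proof. by rewrite swap_ixE !take_updr. Qed.

End Append.

Section MetricProducts.
Context {R : realType} {n : nat}.
Variables (G : 'rV[R]_n -> 'M[R]_n) (k l : nat).

Notation ls := (lshift l).
Notation rs := (@rshift k l).
Implicit Types (a : {ffun 'I_(k + l) -> 'I_n}) (b : {ffun 'I_l -> 'I_n}) (P : pred 'I_l).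

(** The predicate selects the slots Z; slot i is tied to the tensor index k + i. *)
Definition mprod P y b a : R := \prod_(i | P i) G y (b i) (a (rs i)).

Lemma mprodD1 P y b a j : P j ->
  mprod P y b a = G y (b j) (a (rs j)) * mprod (fun i => P i && (i != j)) y b a.
Proof. by move=> Pj; rewrite /mprod (bigD1 j). Qed.

Lemma mprod_updl P y b a i D : mprod P y b (upd_ix a (ls i) D) = mprod P y b a.
Proof. by apply: eq_bigr => j _; rewrite upd_other // eq_sym eq_lrshift. Qed.

Lemma mprod_updr P y b a j D : ~~ P j -> mprod P y b (upd_ix a (rs j) D) = mprod P y b a.
Proof.
move=> Pj; apply: eq_bigr => i Pi; rewrite upd_other // (inj_eq (@rshift_inj _ _)).
by apply: contraNneq Pj => <-.
Qed.

Lemma mprod_updb P y b a j D : ~~ P j -> mprod P y (upd_ix b j D) a = mprod P y b a.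
Proof.
move=> Pj; apply: eq_bigr => i Pi; rewrite upd_other //.
by apply: contraNneq Pj => <-.
Qed.

Lemma mprod_updrD1 P y b a j D : P j -> mprod P y b (upd_ix a (rs j) D) =
  G y (b j) D * mprod (fun i => P i && (i != j)) y b a.
Proof.
by move=> Pj; rewrite (mprodD1 _ _ _ Pj) upd_same mprod_updr // eqxx andbF.
Qed.

Lemma mprod_updbD1 P y b a j D : P j -> mprod P y (upd_ix b j D) a =
  G y D (a (rs j)) * mprod (fun i => P i && (i != j)) y b a.
Proof.
by move=> Pj; rewrite (mprodD1 _ _ _ Pj) upd_same mprod_updb // eqxx andbF.
Qed.

(** The Leibniz rule for the action of Q on tensor indices and slots: each metric
    factor is acted on at its tensor index and at its slot, and phi at the
    positions that do not belong to metric factors. *)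
Lemma sharp_mprod P (Q : 'I_n -> 'I_n -> R) y b (phi : {ffun 'I_(k + l) -> 'I_n} -> R) a :
  (forall j D, P j -> phi (upd_ix a (rs j) D) = phi a) ->
  sharp Q (fun a' => mprod P y b a' * phi a') a
  - \sum_(j | P j) \sum_D Q D (b j) * (mprod P y (upd_ix b j D) a * phi a) =
  - (\sum_(j | P j) (\sum_D (Q D (b j) * G y D (a (rs j)) + Q D (a (rs j)) * G y (b j) D))
      * mprod (fun i => P i && (i != j)) y b a) * phi a
  - mprod P y b a * (\sum_i \sum_D Q D (a (ls i)) * phi (upd_ix a (ls i) D)
     + \sum_(j | ~~ P j) \sum_D Q D (a (rs j)) * phi (upd_ix a (rs j) D)).
Proof.
move=> phiP; rewrite sharpE big_split_ord /= [X in - (_ + X)](bigID P) /=.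
have e1 : \sum_i \sum_D Q D (a (ls i)) * (mprod P y b (upd_ix a (ls i) D) * phi (upd_ix a (ls i) D)) =
   mprod P y b a * \sum_i \sum_D Q D (a (ls i)) * phi (upd_ix a (ls i) D).
  rewrite mulr_sumr; apply: eq_bigr => i _; rewrite mulr_sumr; apply: eq_bigr => D _.
  by rewrite mprod_updl mulrCA.
have e2 : \sum_(j | ~~ P j) \sum_D Q D (a (rs j)) * (mprod P y b (upd_ix a (rs j) D) * phi (upd_ix a (rs j) D)) =
   mprod P y b a * \sum_(j | ~~ P j) \sum_D Q D (a (rs j)) * phi (upd_ix a (rs j) D).
  rewrite mulr_sumr; apply: eq_bigr => i Pi; rewrite mulr_sumr; apply: eq_bigr => D _.
  by rewrite mprod_updr // mulrCA.
have e3 : \sum_(j | P j) \sum_D Q D (a (rs j)) * (mprod P y b (upd_ix a (rs j) D) * phi (upd_ix a (rs j) D))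
   + \sum_(j | P j) \sum_D Q D (b j) * (mprod P y (upd_ix b j D) a * phi a) =
   (\sum_(j | P j) (\sum_D (Q D (b j) * G y D (a (rs j)) + Q D (a (rs j)) * G y (b j) D))
      * mprod (fun i => P i && (i != j)) y b a) * phi a.
  rewrite -big_split mulr_suml; apply: eq_bigr => j Pj /=; rewrite -big_split -mulrA mulr_suml.
  apply: eq_bigr => D _ /=; rewrite mprod_updrD1 // mprod_updbD1 // phiP //; ring.
rewrite e1 e2 mulNr -e3.
have arith (q s u v w : R) : - (w * u + (q + w * v)) - s = - (q + s) - w * (u + v) by ring.
exact: arith.
Qed.

End MetricProducts.

(** * Exterior products detect trace-free Cartan tensors *)

Section PartialPermutations.
Context {R : realType} {I : finType} {k l : nat}.
Variable F : {ffun 'I_k -> I} -> R.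
Hypothesis aF : alternating F.

(** By induction on the number of moved positions it is enough to compare both
    sides along one transposition, which must exchange two of the first k
    positions. *)
Lemma alt_perm_take (s : 'S_(k + l)) (a : {ffun 'I_(k + l) -> I}) :
  (forall j, s (rshift k j) = rshift k j) ->
  F (take_ix (perm_ix a s)) = (-1) ^+ s * F (take_ix a).
Proof.
move: {2}#|_| (leqnn #|[pred t | s t != t]|) => N.
elim: N s a => [|N IH] s a cardN fs.
  have -> : s = 1%g.
    apply/permP => t; rewrite perm1; apply/eqP; rewrite -[_ == _]negbK.
    apply/negP => st; have : (0 < #|[pred t | s t != t]|)%N by apply/card_gt0P; exists t; rewrite inE.
    by rewrite lt0n -leqn0 cardN.
  by rewrite odd_perm1 mul1r; congr F; apply/ffunP => i; rewrite !ffunE perm1.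
have [t st|fix_all] := pickP (fun t => s t != t); last first.
  by apply: IH fs; rewrite eq_card0.
have left_ix z : s z != z -> exists i, z = lshift l i.
  by case: (split_ordP z) => i ->; [exists i | rewrite fs eqxx].
have [i ti] := left_ix t st.
have [i' ti'] : exists i', s t = lshift l i' by apply: left_ix; rewrite (inj_eq perm_inj).
(* Composed with this transposition, s fixes t in addition to what it fixed before. *)
pose s' := (s * tperm t (s t))%g.
have sE : s = (s' * tperm t (s t))%g by rewrite /s' -mulgA tperm2 mulg1.
have s'fix z : s z = z -> s' z = z.
  move=> sz; rewrite permM sz tpermD //; apply: contraNneq st => e; first by rewrite e sz.
  by move: sz; rewrite -e => /perm_inj ->.
have s't : s' t = t by rewrite permM tpermR.
have {}IH := IH s' (swap_ix a t (s t)).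
have -> : perm_ix a s = perm_ix (swap_ix a t (s t)) s'.
  by apply/ffunP => z; rewrite !ffunE {1}sE permM.
rewrite IH => [||j]; last by apply: s'fix.
  rewrite {2}sE odd_permM odd_tperm eq_sym st signr_addb mulrN1 mulNr -mulrN; congr (_ * _).
  have ii : i != i' by apply: contraNneq st => e; rewrite ti' ti e.
  rewrite -(aF _ ii); congr F; rewrite ti' ti.
  by apply/ffunP => z; rewrite !ffunE -(inj_tperm _ _ _ (@lshift_inj k l)).
rewrite -ltnS (leq_trans _ cardN) //; apply: proper_card; apply/properP; split.
  by apply/fintype.subsetP => z; rewrite !inE; apply: contraNneq => /s'fix ->.
by exists t; rewrite !inE ?s't ?eqxx.
Qed.

End PartialPermutations.

(** K is a trace-free Cartan tensor whose products with metric factors are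
    killed by the projection; the aim is exterior_eq0. *)
Section ExteriorProduct.
Context {R : realType} {n : nat}.
Variables (G : 'rV[R]_n -> 'M[R]_n) (x : 'rV[R]_n).
Hypothesis gsym : forall a b, G x a b = G x b a.
Hypothesis gunit : G x \in unitmx.
Variables (k l : nat) (K : 'I_n -> {ffun 'I_k -> 'I_n} -> R).
Hypothesis kln : (k + l < n)%N.
Hypothesis Kalt : forall c, alternating (K c).
Hypothesis Kcyc : forall c u, K c u = \sum_j K (u j) (upd_ix u j c).
Hypothesis Ktr : forall u j, mtrace G x K u j = 0.

Notation g := (G x).
Notation gi := (ginv G x).
Notation ls := (lshift l).
Notation rs := (@rshift k l).
Implicit Types (a : {ffun 'I_(k + l) -> 'I_n}) (b v : {ffun 'I_l -> 'I_n}) (u : {ffun 'I_k -> 'I_n}).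

Hypothesis proj0 : forall b c a,
  cartan_proj G x (fun c => skewing (fun a => mprod G xpredT x b a * K c (take_ix a))) c a = 0.

(** Raising the slot indices turns the metric factors into coordinate
    differentials, whose product can be evaluated. *)
Definition delta_prod v a : R := \prod_i (v i == a (rs i))%:R.

Definition wedge v c a : R := skewing (fun a => delta_prod v a * K c (take_ix a)) a.

Lemma delta_prodE v a : delta_prod v a = \sum_(b : {ffun 'I_l -> 'I_n}) (\prod_i gi (v i) (b i)) * mprod G xpredT x b a.
Proof.
rewrite /delta_prod /mprod; under eq_bigr => i _ do rewrite -(ginvl gunit).
by rewrite bigA_distr_bigA; apply: eq_bigr => b _; rewrite big_split.
Qed.

Lemma wedge_proj0 v c a : cartan_proj G x (wedge v) c a = 0.
Proof.
transitivity (cartan_proj G x (fun c a => \sum_(b : {ffun 'I_l -> 'I_n}) (\prod_i gi (v i) (b i)) *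
    skewing (fun a => mprod G xpredT x b a * K c (take_ix a)) a) c a).
  apply: eq_cartan_proj => d a'; under [RHS]eq_bigr => b _ do rewrite -skewingZ.
  rewrite -skewing_sum; apply: eq_skewing => a2; rewrite delta_prodE mulr_suml.
  by apply: eq_bigr => b _; rewrite mulrA.
by rewrite cartan_proj_sum big1 // => b _; rewrite cartan_projZ proj0 mulr0.
Qed.

Lemma delta_prod_updl v a i y : delta_prod v (upd_ix a (ls i) y) = delta_prod v a.
Proof. by apply: eq_bigr => j _; rewrite upd_other // eq_sym eq_lrshift. Qed.

(** Skew-symmetrising K over all of its indices gives 0, by the cyclic identity
    Kcyc: the k terms on the right are all opposite to the one on the left. *)
Lemma wskew_cyc (w : {ffun 'I_(k + l) -> 'I_n} -> R) j a :
  (forall i a y, w (upd_ix a (ls i) y) = w a) -> (forall a y, w (upd_ix a (rs j) y) = w a) ->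
  wskew w (fun a => K (a (rs j)) (take_ix a)) a = 0.
Proof.
move=> wl wr; set X := wskew _ _ _.
have : X = \sum_(i < k) - X.
  rewrite {1}/X; under eq_wskew => a' do rewrite Kcyc.
  rewrite wskew_sum; apply: eq_bigr => i _.
  have ij : ls i != rs j by rewrite eq_lrshift.
  rewrite -(wskew_swap _ a ij); last by move=> b; rewrite swap_ixE wr wl.
  apply: eq_wskew => a'; rewrite [in RHS]ffunE tpermR ffunE.
  by rewrite swap_ixE take_updr take_updl.
rewrite sumr_const card_ord mulNrn => e.
have {e} : k.+1%:R * X = 0 by rewrite mulr_natl mulrS {1}e addNr.
by move/eqP; rewrite mulf_eq0 pnatr_eq0 => /eqP.
Qed.

(** Skew-symmetrisation over c and a includes all indices of K, since the
    differentials do not involve c unless it is inserted there, where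
    wskew_cyc applies. *)
Lemma wedge_unskew v c a : wedge v c a = \sum_j wedge v (a j) (upd_ix a j c).
Proof.
rewrite /wedge (skewing_insert (fun c a => delta_prod v a * K c (take_ix a))).
under [RHS]eq_skewing => a' do rewrite big_split_ord /=.
rewrite skewingD [X in _ + X]skewing_sum [X in _ + X]big1 ?addr0; last first.
  move=> j _; pose w a := delta_prod v (upd_ix a (rs j) c).
  transitivity (wskew w (fun a => K (a (rs j)) (take_ix a)) a).
    by apply: eq_skewing => a'; rewrite take_updr.
  apply: wskew_cyc => [i a' y|a' y]; rewrite /w; last by rewrite upd_upd.
  by rewrite updC ?delta_prod_updl // eq_lrshift.
apply: eq_skewing => a'; rewrite Kcyc mulr_sumr; apply: eq_bigr => i _.
by rewrite delta_prod_updl take_updl ffunE.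
Qed.

(** Without a totally skew part, the vanishing of the projection leaves the trace
    part only: K(c) wedge alpha is the wedge product of c^flat with a form. *)
Lemma wedge_trace v c a : wedge v c a =
  \sum_j g c (a j) * ((n - (k + l) + 1)%:R^-1 * mtrace G x (wedge v) a j).
Proof.
have := wedge_proj0 v c a; rewrite cartan_projE; last by move=> d; apply: alt_skewing.
rewrite -wedge_unskew subrr mulr0 subr0 => /eqP; rewrite subr_eq0 => /eqP ->.
by rewrite mulr_sumr; apply: eq_bigr => j _; rewrite mulrCA.
Qed.

(** For F(X) = X^flat wedge tau one has X^flat wedge F(X) = 0; this is its
    polarised form, in p and q. *)
Lemma trace_family_polar m (t : 'I_m -> {ffun 'I_m -> 'I_n} -> R) p q d (a : {ffun 'I_m -> 'I_n}) :
  (forall j (a : {ffun 'I_m -> 'I_n}) y, t j (upd_ix a j y) = t j a) ->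
  (forall i j (a : {ffun 'I_m -> 'I_n}), i != j -> t i (upd_ix a j (a i)) = - t j a) ->
  let F c (a : {ffun 'I_m -> 'I_n}) := \sum_j g c (a j) * t j a in
  (g p d * F q a - \sum_i g p (a i) * F q (upd_ix a i d)) +
  (g q d * F p a - \sum_i g q (a i) * F p (upd_ix a i d)) = 0.
Proof.
move=> t_indep t_move F.
pose Z p q := \sum_i \sum_(j | j != i) g p (a i) * (g q (a j) * t j (upd_ix a i d)).
have E p' q' : \sum_i g p' (a i) * F q' (upd_ix a i d) = g q' d * F p' a + Z p' q'.
  rewrite mulr_sumr -big_split; apply: eq_bigr => i _ /=.
  rewrite /F (bigD1 i) //= upd_same t_indep mulrDr mulrCA; congr (_ + _).
  by rewrite mulr_sumr; apply: eq_bigr => j ji; rewrite upd_other.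
have tsym i j : j != i -> t j (upd_ix a i d) = - t i (upd_ix a j d).
  move=> ji; have ij : i != j by rewrite eq_sym.
  have := t_move _ _ (upd_ix a i d) ij; rewrite (upd_same a i d) (updC a d d ij) t_indep => ->.
  by rewrite opprK.
have ZN : Z q p = - Z p q.
  rewrite /Z (exchange_big_dep xpredT) //= -sumrN; apply: eq_bigr => i _; rewrite -sumrN.
  apply: eq_big => [j|j ij]; first by rewrite eq_sym.
  by rewrite tsym // mulrCA !mulrN.
rewrite !E ZN; ring.
Qed.

Lemma wedge_polar v p q d a :
  (g p d * wedge v q a - \sum_i g p (a i) * wedge v q (upd_ix a i d)) +
  (g q d * wedge v p a - \sum_i g q (a i) * wedge v p (upd_ix a i d)) = 0.
Proof.
have wa e : alternating (wedge v e) by apply: alt_skewing.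
under eq_bigr => i _ do rewrite wedge_trace.
under [X in _ + (_ - X)]eq_bigr => i _ do rewrite wedge_trace.
rewrite ![wedge v _ a]wedge_trace.
apply: (trace_family_polar (t := fun j a => (n - (k + l) + 1)%:R^-1 * mtrace G x (wedge v) a j)).
  by move=> j a' y; rewrite mtrace_indep.
by move=> i j a' ij; rewrite -mulrN mtrace_move.
Qed.

(** What remains of the normalisation of the skew-symmetrisation when only the
    permutations that fix the last l positions contribute. *)
Definition fix_ratio : R :=
  ((k + l)`!%:R)^-1 * \sum_(s : 'S_(k + l) | [forall j, s (rs j) == rs j]) 1.

Lemma fix_ratio_neq0 : fix_ratio != 0.
Proof.
rewrite mulf_neq0 ?invr_eq0 ?fact_neq0 // (bigD1 1%g) /=; last first.
  by apply/forallP => j; rewrite perm1.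
rewrite gt_eqF // ltr_pwDl ?ltr01 // sumr_ge0 // => s _; exact: ler01.
Qed.

(** When the entries of a are distinct, the differentials of the last l ones
    select the permutations that fix the last l positions. *)
Lemma wedge_inj c a : injective a -> wedge [ffun j => a (rs j)] c a = fix_ratio * K c (take_ix a).
Proof.
move=> ia; rewrite /wedge skewingE /fix_ratio -mulrA; congr (_ * _).
rewrite (bigID (fun s : 'S_(k + l) => [forall j, s (rs j) == rs j])) /= [X in _ + X]big1 ?addr0.
  rewrite mulr_suml; apply: eq_bigr => s /forallP fs; rewrite mul1r.
  have {}fs j : s (rs j) = rs j by apply/eqP.
  rewrite /delta_prod big1 => [|j _]; last by rewrite !ffunE fs eqxx.
  by rewrite mul1r (alt_perm_take (Kalt c)) // mulrA -expr2 sqrr_sign mul1r.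
move=> s; rewrite negb_forall => /existsP[j sj].
by rewrite /delta_prod (bigD1 j) //= !ffunE (inj_eq ia) eq_sym (negbTE sj) !mul0r mulr0.
Qed.

(** Every term contains the differential of v_j evaluated on an entry of a. *)
Lemma wedge_missing v c a j : (forall t, a t != v j) -> wedge v c a = 0.
Proof.
move=> av; rewrite /wedge skewingE big1 ?mulr0 // => s _.
by rewrite /delta_prod (bigD1 j) //= ffunE eq_sym (negbTE (av _)) !mul0r mulr0.
Qed.

(** Up to a factor, the wedge product of the covector p^flat with K(q), evaluated on
    d and u. *)
Definition polar p q d u : R := g p d * K q u - \sum_i g p (u i) * K q (upd_ix u i d).

(** There is room for l further distinct entries because k + 1 + l <= n. *)
Lemma extend_inj d u : injective u -> (forall i, u i != d) ->
  exists a, [/\ injective a, take_ix a = u & forall t, a t != d].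
Proof.
move=> iu ud; pose C := ~: (d |: [set u i | i : 'I_k])%SET.
have cC : (l <= size (enum C))%N.
  rewrite -cardE; have := cardsC (d |: [set u i | i : 'I_k])%SET.
  rewrite card_ord cardsU1 card_imset // card_ord => e.
  (* The values other than d and the entries of u are counted by e. *)
  have count (e0 : bool) c m : (e0 + k + c)%N = m -> (k + l < m)%N -> (l <= c)%N.
    by move=> <-; case: e0; rewrite ?add1n ?addSn ?ltnS ?add0n ?leq_add2l // ltn_add2l => /ltnW.
  exact: count e kln.
pose v (j : 'I_l) := nth d (enum C) j.
have vC j : v j \in C by rewrite -mem_enum mem_nth // (leq_trans (ltn_ord j)).
have vd j : v j != d by have := vC j; rewrite !inE negb_or => /andP[].
have vu j i : v j != u i.
  have := vC j; rewrite !inE negb_or => /andP[_ h]; apply: contraNneq h => ->.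
  exact: imset_f.
have iv : injective v.
  move=> i j /eqP; rewrite nth_uniq ?enum_uniq // ?(leq_trans (ltn_ord _)) // => /eqP; exact: val_inj.
pose a : {ffun 'I_(k + l) -> 'I_n} :=
  [ffun t => match fintype.split t with inl i => u i | inr j => v j end].
have al i : a (ls i) = u i by rewrite ffunE (unsplitK (inl i)).
have ar j : a (rs j) = v j by rewrite ffunE (unsplitK (inr j)).
exists a; split.
- move=> s t; case: (split_ordP s) => i ->; case: (split_ordP t) => j ->; rewrite ?al ?ar.
  + by move/iu ->.
  + by move/eqP; rewrite eq_sym (negbTE (vu _ _)).
  + by move/eqP; rewrite (negbTE (vu _ _)).
  + by move/iv ->.
- by apply/ffunP => i; rewrite ffunE al.
- by move=> t; case: (split_ordP t) => i ->; rewrite ?al ?ar.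
Qed.

(** For distinct entries d, u this is wedge_polar, evaluated with differentials
    complementary to them: in the other terms a differential is missing. When
    entries coincide both terms vanish by skew symmetry. *)
Lemma polar_alt p q d u : polar p q d u + polar q p d u = 0.
Proof.
have af p' q' e : alternating (fun u => g p' e * K q' u).
  by move=> i j u' ij; rewrite Kalt // mulrN.
have [iu|] := boolP (injectiveb u); last first.
  move=> /injectivePn[i [j ij uij]].
  have z p' q' : polar p' q' d u = 0 by apply: (alt_eq0 (alt_skew_diff (af p' q') d) ij uij).
  by rewrite !z addr0.
move/injectiveP in iu.
have [/existsP[i /eqP ui]|] := boolP [exists i, u i == d].
  have z p' q' : polar p' q' d u = 0.
    have := skew_diff_total (af p' q') d u i; rewrite -ui upd_self -/(polar p' q' (u i) u); lra.
  by rewrite !z addr0.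
move=> /existsPn ud.
have [a [ia tu ad]] := extend_inj iu ud.
pose v := [ffun j => a (rs j)].
have E p' q' : g p' d * wedge v q' a - \sum_i g p' (a i) * wedge v q' (upd_ix a i d) =
    fix_ratio * polar p' q' d u.
  rewrite wedge_inj // big_split_ord /= [X in _ - (_ + X)]big1 ?addr0; last first.
    move=> j _; rewrite (@wedge_missing _ _ _ j) ?mulr0 // => t; rewrite [v j]ffunE.
    have [->|tj] := eqVneq t (rs j); first by rewrite upd_same eq_sym.
    by rewrite upd_other // (inj_eq ia).
  rewrite /polar mulrBr mulr_sumr tu mulrCA; congr (_ - _); apply: eq_bigr => i _.
  have iai : injective (upd_ix a (ls i) d).
    move=> s t; have [->|si] := eqVneq s (ls i); have [->|ti] := eqVneq t (ls i) => //.
    - by rewrite upd_same upd_other // => /eqP; rewrite eq_sym (negbTE (ad _)).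
    - by rewrite upd_same upd_other // => /eqP; rewrite (negbTE (ad _)).
    - by rewrite !upd_other // => /ia.
  have -> : v = [ffun j => upd_ix a (ls i) d (rs j)].
    by apply/ffunP => j; rewrite !ffunE eq_sym eq_lrshift.
  rewrite wedge_inj // take_updl tu mulrCA -tu ffunE //.
have := wedge_polar v p q d a; rewrite !E -mulrDr => /eqP.
by rewrite mulf_eq0 (negbTE fix_ratio_neq0) => /eqP.
Qed.

(** Contracting p with d in polar_alt, the first term gives (n - k) K and the
    second one gives K, as K is trace-free. *)
Lemma exterior_eq0 c u : K c u = 0.
Proof.
have : contr G x (fun p d => polar p c d u + polar c p d u) = 0 by apply: contr0 => p d; apply: polar_alt.
rewrite contrD !contrB !contr_sum.
have -> : contr G x (fun p d => g p d * K c u) = n%:R * K c u.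
  by rewrite -(contr_dim gunit); apply: eq_contr => p q; rewrite gsym.
have -> : contr G x (fun p d => g c d * K p u) = K c u by apply: contr_metric.
have -> : \sum_i contr G x (fun p d => g p (u i) * K c (upd_ix u i d)) = k%:R * K c u.
  rewrite (eq_bigr (fun=> K c u)) => [|i _]; first by rewrite sumr_const card_ord mulr_natl.
  rewrite -[RHS](_ : K c (upd_ix u i (u i)) = _); last by rewrite upd_self.
  rewrite (contr_sym gsym) -(contr_metric gsym gunit (fun d => K c (upd_ix u i d))).
  by apply: eq_contr => p q; rewrite gsym.
rewrite big1 => [|i _]; last first.
  by rewrite contrZ [contr _ _ _]Ktr mulr0.
rewrite subr0 => e; have {e} : (n - k + 1)%:R * K c u = 0.
  have kn : (k <= n)%N by rewrite ltnW // (leq_ltn_trans _ kln) // leq_addr.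
  by rewrite -e natrD natrB // mulrDl mulrBl mul1r.
by move/eqP; rewrite mulf_eq0 pnatr_eq0 addn1 => /eqP.
Qed.

End ExteriorProduct.

(** * The second extension *)

Section Underline.
Context {R : realType} {n : nat}.
Variables (G : 'rV[R]_n -> 'M[R]_n) (O : set 'rV[R]_n).
Hypothesis oO : open O.
Hypothesis Gsym : forall x, O x -> forall a b, G x a b = G x b a.
Hypothesis Gunit : forall x, O x -> G x \in unitmx.
Hypothesis Gsmooth : forall a b, smooth_on O (fun x => G x a b).
Variables (k : nat) (sigma : 'rV[R]_n -> {ffun 'I_k -> 'I_n} -> R).
Hypothesis salt : forall y, O y -> alternating (sigma y).
Hypothesis ssmooth : forall b, smooth_on O (sigma^~ b).
Variables (l : nat).
Hypothesis l0 : (0 < l)%N.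
Hypothesis kln : (k + l < n)%N.

Notation T := (underline G (l := l) sigma).
Notation ls := (lshift l).
Notation rs := (@rshift k l).
Notation W := (@mprod R n G k l).
Notation but j := (fun i => i != j).
Notation S y := (fun p b => nabla_tensor G sigma p y b).
Notation K y := (cartan_proj G y (S y)).
Implicit Types (a : {ffun 'I_(k + l) -> 'I_n}) (b : {ffun 'I_l -> 'I_n}) (B : {ffun 'I_l -> tix n}).

Definition lowZ y B a : R := \prod_i Zlow G y (B i) (a (rs i)).

Definition lowX y j B a : R := \prod_i (if i == j then Xt (B i) else Zlow G y (B i) (a (rs i))).

Definition top_part y a B : R := skewing (fun a' => k.+1%:R * lowZ y B a' * sigma y (take_ix a')) a.

Definition bottom_part y j a B : R :=
  skewing (fun a' => lowX y j B a' * nabla_tensor G sigma (a' (rs j)) y (take_ix a')) a.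

Lemma swap_rs a i j t : swap_ix a (rs i) (rs j) (rs (tperm i j t)) = a (rs t).
Proof. by rewrite ffunE (inj_tperm _ _ _ (@rshift_inj _ _)) tpermK. Qed.

Lemma top_part_swap y a B i j : i != j -> top_part y a (swap_ix B i j) = - top_part y a B.
Proof.
move=> ij; rewrite /top_part.
have rij : rs i != rs j by rewrite (inj_eq (@rshift_inj _ _)).
rewrite -(skewing_swap _ a rij); apply: eq_skewing => a'; rewrite take_swapr; congr (_ * _ * _).
rewrite [RHS](reindex_inj (@perm_inj _ (tperm i j))) /=; apply: eq_bigr => t _.
by rewrite swap_rs ffunE.
Qed.

Lemma bottom_part_swap y a B i j t : i != j ->
  bottom_part y t a (swap_ix B i j) = - bottom_part y (tperm i j t) a B.
Proof.
move=> ij; rewrite /bottom_part.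
have rij : rs i != rs j by rewrite (inj_eq (@rshift_inj _ _)).
rewrite -(skewing_swap _ a rij); apply: eq_skewing => a'; rewrite take_swapr swap_rs; congr (_ * _).
rewrite [RHS](reindex_inj (@perm_inj _ (tperm i j))) /=; apply: eq_bigr => s _.
by rewrite swap_rs (inj_eq perm_inj) ffunE.
Qed.

(** Permuting the slots amounts to permuting the tensor indices tied to them, over
    which one skews anyway; so the skew-symmetrisation over the slots is
    superfluous, and the preferred slot of X becomes a sum over all slots. *)
Lemma underlineE y a B : T y a B = top_part y a B - \sum_j bottom_part y j a B.
Proof.
have at1 : alternating (top_part y a) by move=> i j B' ij; apply: top_part_swap.
have at2 : alternating (fun B => \sum_j bottom_part y j a B).
  move=> i j B' ij; rewrite -sumrN [RHS](reindex_inj (@perm_inj _ (tperm i j))) /=.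
  by apply: eq_bigr => t _; apply: bottom_part_swap.
pose i0 := Ordinal l0.
transitivity (skewing (fun B => top_part y a B - l%:R * bottom_part y i0 a B) B).
  rewrite /underline skewing_exch; apply: eq_skewing => B'.
  rewrite /top_part /bottom_part -skewingZ -skewingB; apply: eq_skewing => a'.
  rewrite addn1 mulrA; congr (_ - _ * _).
  by rewrite (big_pred1 i0) // => j; rewrite -(inj_eq val_inj).
rewrite skewingB skewingZ skewing_id //; congr (_ - _).
rewrite -[RHS](skewing_id B at2) skewing_sum -[X in X%:R]card_ord mulr_natl -sumr_const.
apply: eq_bigr => j _; have [->//|j0] := eqVneq j i0.
have ij : i0 != j by rewrite eq_sym.
rewrite -[LHS]opprK -(skewing_swap _ B ij) -skewingN; apply: eq_skewing => B'.
by rewrite bottom_part_swap // tpermL opprK.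
Qed.

Lemma Zlow_tZ y (d e : 'I_n) : Zlow G y (tZ d) e = G y d e.
Proof.
rewrite /Zlow (bigD1 d) //= Zt_tZ eqxx mul1r big1 ?addr0 // => f fd.
by rewrite Zt_tZ eq_sym (negbTE fd) mul0r.
Qed.

Lemma top_part0 y a B i : (forall d, B i != tZ d) -> top_part y a B = 0.
Proof.
move=> Bi; rewrite -[RHS](skewing0 a); apply: eq_skewing => a'.
rewrite /lowZ (bigD1 i) //= (_ : Zlow _ _ _ _ = 0) ?mul0r ?mulr0 ?mul0r //.
by rewrite /Zlow big1 // => f _; rewrite /Zt (negbTE (Bi f)) mul0r.
Qed.

Lemma bottom_part0 y a B i j : i != j -> (forall d, B i != tZ d) -> bottom_part y j a B = 0.
Proof.
move=> ij Bi; rewrite -[RHS](skewing0 a); apply: eq_skewing => a'.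
rewrite /lowX (bigD1 i) //= (negbTE ij) (_ : Zlow _ _ _ _ = 0) ?mul0r //.
by rewrite /Zlow big1 // => f _; rewrite /Zt (negbTE (Bi f)) mul0r.
Qed.

Lemma bottom_part_notX y a B j : B j != tX -> bottom_part y j a B = 0.
Proof.
move=> Bj; rewrite -[RHS](skewing0 a); apply: eq_skewing => a'.
by rewrite /lowX (bigD1 j) //= eqxx /Xt (negbTE Bj) !mul0r.
Qed.

Lemma underline_Z y a b : T y a (zword b) =
  k.+1%:R * skewing (fun a' => W xpredT y b a' * sigma y (take_ix a')) a.
Proof.
rewrite underlineE [X in _ - X]big1 ?subr0 => [|j _]; last by rewrite bottom_part_notX // ffunE.
rewrite -skewingZ; apply: eq_skewing => a'; rewrite mulrA; congr (_ * _ * _).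
by apply: eq_bigr => i _; rewrite ffunE Zlow_tZ.
Qed.

Lemma underline_X y a b j : T y a (upd_ix (zword b) j tX) =
  - skewing (fun a' => W (but j) y b a' * nabla_tensor G sigma (a' (rs j)) y (take_ix a')) a.
Proof.
rewrite underlineE (@top_part0 _ _ _ j) ?sub0r => [|d]; last by rewrite upd_same.
congr (- _); rewrite (bigD1 j) //= [X in _ + X]big1 ?addr0 => [|i ij]; last first.
  by rewrite bottom_part_notX // upd_other // ffunE.
apply: eq_skewing => a'; congr (_ * _).
rewrite /lowX (bigD1 j) //= eqxx upd_same /Xt eqxx mul1r; apply: eq_bigr => i ij.
by rewrite (negbTE ij) upd_other // ffunE Zlow_tZ.
Qed.

Lemma underline_Y y a B i : B i = tY -> T y a B = 0.
Proof.
move=> Bi; rewrite underlineE (@top_part0 _ _ _ i) ?Bi // big1 ?subrr // => j _.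
have [ij|ij] := eqVneq i j; first by rewrite bottom_part_notX // -ij Bi.
by rewrite (bottom_part0 _ _ ij) // Bi.
Qed.

Lemma underline_XX y a B i j : i != j -> B i = tX -> B j = tX -> T y a B = 0.
Proof.
move=> ij Bi Bj; rewrite underlineE (@top_part0 _ _ _ i) ?Bi // big1 ?subrr // => t _.
have [it|it] := eqVneq i t; last by rewrite (bottom_part0 _ _ it) // Bi.
by rewrite (@bottom_part0 _ _ _ j) ?Bj // -it eq_sym.
Qed.

Lemma underline_alt y a : alternating (T y a).
Proof.
move=> i j B ij; rewrite !underlineE top_part_swap // opprB addrC; congr (_ + _).
rewrite -sumrN [RHS](reindex_inj (@perm_inj _ (tperm i j))) /=.
by apply: eq_bigr => t _; rewrite bottom_part_swap // opprK.
Qed.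

Lemma pderivable_skewing (F : 'rV[R]_n -> {ffun 'I_(k + l) -> 'I_n} -> R) x a :
  (forall a', pderivable (fun y => F y a') x) -> pderivable (fun y => skewing (F y) a) x.
Proof.
move=> dF; apply: pderivableM; first exact: pderivable_cst.
by apply: pderivable_sum => s _; apply: pderivableM; first exact: pderivable_cst.
Qed.

Lemma pd_skewing c (F : 'rV[R]_n -> {ffun 'I_(k + l) -> 'I_n} -> R) x a :
  (forall a', pderivable (fun y => F y a') x) ->
  pd c (fun y => skewing (F y) a) x = skewing (fun a' => pd c (fun y => F y a') x) a.
Proof.
move=> dF; have dsF s : pderivable (fun y => (-1) ^+ odd_perm s * F y (perm_ix a s)) x.
  by apply: pderivableM; first exact: pderivable_cst.
rewrite /skewing pdZ; last by apply: pderivable_sum => s _; apply: dsF.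
rewrite pd_sum => [|s _]; last exact: dsF.
by congr (_ * _); apply: eq_bigr => s _; rewrite pdZ.
Qed.

Lemma pderivable_mprod P x b a : O x -> pderivable (fun y => W P y b a) x.
Proof. by move=> Ox; apply: pderivable_prod => i _; apply: (pderivable_metric Gsmooth). Qed.

Lemma underline_der x a B : O x -> pderivable (fun y => T y a B) x.
Proof.
move=> Ox; have dc (r : R) : pderivable (fun=> r) x by apply: pderivable_cst.
have dZ A e : pderivable (fun y => Zlow G y A e) x.
  apply: pderivable_sum => d _; apply: pderivableM => //; exact: (pderivable_metric Gsmooth).
apply: (pderivable_near (f := fun y => top_part y a B - \sum_j bottom_part y j a B) oO Ox).
  by move=> y _; rewrite underlineE.
apply: pderivableB.
  apply: pderivable_skewing => a'; apply: pderivableM; last exact: (smooth_pderivable [::] (ssmooth _)).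
  by apply: pderivableM => //; apply: pderivable_prod.
apply: pderivable_sum => j _; apply: pderivable_skewing => a'; apply: pderivableM.
  by apply: pderivable_prod => i _; have [_|_] := eqVneq i j; [apply: dc|apply: dZ].
exact: (pderivable_nabla oO Gunit Gsmooth).
Qed.

Section AtAPoint.
Variable x : 'rV[R]_n.
Hypothesis Ox : O x.

Notation Gam := (christoffel G).
Notation H := (nabla2 G sigma).
Notation conn_act c := (sharp (fun d e => Gam d c e x)).
Notation weyl_act c e := (sharp (fun f g => weyl_up G c e f g x)).
Notation top_slot y b := (fun a => W xpredT y b a * sigma y (take_ix a)).
Notation bottom_slot j y b :=
  (fun a => W (but j) y b a * nabla_tensor G sigma (a (rs j)) y (take_ix a)).

Let Salt d : alternating (S x d).
Proof. exact: (alt_derivative G oO salt ssmooth d Ox). Qed.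

Lemma pd_mprod P c b a : pd c (fun y => W P y b a) x =
  \sum_(j | P j) (\sum_D (Gam D c (b j) x * G x D (a (rs j)) + Gam D c (a (rs j)) x * G x (b j) D))
      * W (fun i => P i && (i != j)) x b a.
Proof.
rewrite /mprod pd_prod => [|j _]; last exact: (pderivable_metric Gsmooth).
by apply: eq_bigr => j _; rewrite (metric_compat oO Gsym Gunit).
Qed.

(** Metric compatibility cancels the derivatives of the metric factors against
    the action of the connection on their two indices. *)
Lemma pd_sharp_mprod (P : pred 'I_l) c b (phi : 'rV[R]_n -> {ffun 'I_(k + l) -> 'I_n} -> R) a :
  (forall a', pderivable (fun y => phi y a') x) ->
  (forall j D, P j -> phi x (upd_ix a (rs j) D) = phi x a) ->
  pd c (fun y => W P y b a * phi y a) x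
  + (conn_act c (fun a' => W P x b a' * phi x a') a
  - \sum_(j | P j) \sum_D Gam D c (b j) x * (W P x (upd_ix b j D) a * phi x a)) =
  W P x b a * (pd c (fun y => phi y a) x - (\sum_i \sum_D Gam D c (a (ls i)) x * phi x (upd_ix a (ls i) D)
     + \sum_(j | ~~ P j) \sum_D Gam D c (a (rs j)) x * phi x (upd_ix a (rs j) D))).
Proof.
move=> dphi phiP; rewrite (sharp_mprod G (fun d e => Gam d c e x) x b phiP).
rewrite pdM //; last exact: pderivable_mprod.
rewrite pd_mprod.
have arith (s p w t q : R) : s * p + w * t + (- s * p - w * q) = w * (t - q) by ring.
exact: arith.
Qed.

Lemma sharp_skew_b (P : pred 'I_l) (Q : 'I_n -> 'I_n -> R) b (F : {ffun 'I_l -> 'I_n} -> {ffun 'I_(k + l) -> 'I_n} -> R) a :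
  \sum_(j | P j) \sum_D Q D (b j) * skewing (F (upd_ix b j D)) a =
  skewing (fun a' => \sum_(j | P j) \sum_D Q D (b j) * F (upd_ix b j D) a') a.
Proof.
rewrite skewing_sum; apply: eq_bigr => j _; rewrite skewing_sum; apply: eq_bigr => D _.
by rewrite skewingZ.
Qed.

Lemma underline_nabla_Z r c a b : nabla_x G r T c x a (zword b) =
  skewing (fun a' => k.+1%:R * (W xpredT x b a' * nabla_tensor G sigma c x (take_ix a'))
    - \sum_j G x c (b j) * (W (but j) x b a' * nabla_tensor G sigma (a' (rs j)) x (take_ix a'))) a.
Proof.
have TY y a' B i : O y -> B i = tY -> T y a' B = 0 by move=> _; apply: underline_Y.
have ds a' : pderivable (fun y => sigma y (take_ix a')) x by exact: (smooth_pderivable [::] (ssmooth _)).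
have dF b' a' : pderivable (fun y => W xpredT y b' a' * sigma y (take_ix a')) x.
  by apply: pderivableM => //; exact: pderivable_mprod.
rewrite (nabla_x_Z G Ox TY) skewingB skewingZ skewing_sum; congr (_ + _); last first.
  rewrite -sumrN; apply: eq_bigr => j _; rewrite underline_X // mulrN; congr (- _).
  by rewrite -skewingZ.
have -> : (fun y => T y a (zword b)) =
   (fun y => k.+1%:R * skewing (top_slot y b) a).
  by apply/funext => y; rewrite underline_Z.
have -> : (fun a' => T x a' (zword b)) =
   (fun a' => k.+1%:R * skewing (top_slot x b) a').
  by apply/funext => a'; rewrite underline_Z.
have -> : (fun b' => T x a (zword b')) =
   (fun b' => k.+1%:R * skewing (top_slot x b') a).
  by apply/funext => b'; rewrite underline_Z.
rewrite pdZ; last exact: pderivable_skewing.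
rewrite [X in _ + X + _]sharpZ [X in _ + _ + X]sharpZ -!mulrDr; congr (_ * _).
rewrite (@pd_skewing c (fun y => top_slot y b) x a) //.
have -> : conn_act c (fun a' => skewing (top_slot x b) a') a =
   skewing (conn_act c (top_slot x b)) a.
  exact: sharp_skewing.
rewrite [X in _ + X]sharpE.
rewrite (sharp_skew_b xpredT (fun d e => Gam d c e x) b (fun b' => top_slot x b')).
rewrite -addrA -skewingB -skewingD; apply: eq_skewing => a'.
rewrite (@pd_sharp_mprod xpredT c b (fun y a' => sigma y (take_ix a')) a') //; last first.
  by move=> j D _; rewrite take_updr.
congr (_ * _); rewrite [X in _ - (_ + X)]big_pred0_eq addr0 nablaE sharpE; congr (_ - _).
by apply: eq_bigr => i _; apply: eq_bigr => D _; rewrite take_updl ffunE.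
Qed.

(** The Weyl tensor is skew in its last two indices, so it annihilates the
    metric factors. *)
Lemma weyl_mprod0 (P : pred 'I_l) c e b a :
  \sum_(j | P j) (\sum_D (weyl_up G c e D (b j) x * G x D (a (rs j)) + weyl_up G c e D (a (rs j)) x * G x (b j) D))
      * W (fun i => P i && (i != j)) x b a = 0.
Proof.
have low f h : \sum_D weyl_up G c e D f x * G x D h = weyl G c e h f x.
  under eq_bigr => D _ do rewrite mulr_suml.
  rewrite exchange_big /= -(sum_delta (fun d => weyl G c e d f x)); apply: eq_bigr => d _.
  under eq_bigr => D _ do rewrite mulrAC (ginv_sym (Gsym Ox)).
  by rewrite -mulr_suml (ginvl (Gunit Ox)) eq_sym.
rewrite big1 // => j _; rewrite big_split /= low.
under [X in _ + X]eq_bigr => D _ do rewrite (Gsym Ox).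
by rewrite low (weyl_skew oO Gsym Gunit Gsmooth c e _ _ Ox) addNr mul0r.
Qed.

(** The derivative falls on S, the Schouten tensor replaces the metric factor of
    slot j, and the Weyl tensor acts on sigma only, by weyl_mprod0. *)
Lemma underline_nabla_X c a b j :
  nabla_x G (2 / k%:R) T c x a (upd_ix (zword b) j tX) =
  - differential_defect G sigma x ls (rs j) (W (but j) x b) c a.
Proof.
have TY y a' B i : O y -> B i = tY -> T y a' B = 0 by move=> _; apply: underline_Y.
have TXX y a' B i i' : O y -> i != i' -> B i = tX -> B i' = tX -> T y a' B = 0 by move=> _; apply: underline_XX.
have dS d u : pderivable (fun y => nabla_tensor G sigma d y u) x.
  exact: (pderivable_nabla oO Gunit Gsmooth).
have dF b' a' : pderivable (fun y => W (but j) y b' a' * nabla_tensor G sigma (a' (rs j)) y (take_ix a')) x.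
  by apply: pderivableM => //; exact: pderivable_mprod.
rewrite (nabla_x_X Ox (Gsym Ox) TY TXX).
have -> : (fun y => T y a (upd_ix (zword b) j tX)) =
   (fun y => - skewing (bottom_slot j y b) a).
  by apply/funext => y; rewrite underline_X.
have -> : (fun a' => T x a' (upd_ix (zword b) j tX)) =
   (fun a' => - skewing (bottom_slot j x b) a').
  by apply/funext => a'; rewrite underline_X.
rewrite pdN; last exact: pderivable_skewing.
rewrite (@pd_skewing c (fun y => bottom_slot j y b) x a) //.
rewrite sharpN.
have -> : conn_act c (fun a' => skewing (bottom_slot j x b) a') a =
   skewing (conn_act c (bottom_slot j x b)) a.
  exact: sharp_skewing.
have -> : \sum_(i | i != j) \sum_d Gam d c (b i) x * T x a (upd_ix (zword (upd_ix b i d)) j tX) =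
   - skewing (fun a' => \sum_(i | i != j) \sum_d Gam d c (b i) x *
      (W (but j) x (upd_ix b i d) a' * nabla_tensor G sigma (a' (rs j)) x (take_ix a'))) a.
  rewrite -(sharp_skew_b (but j) (fun d e => Gam d c e x) b (fun b' => bottom_slot j x b')).
  rewrite -sumrN; apply: eq_bigr => i _; rewrite -sumrN; apply: eq_bigr => d _.
  by rewrite underline_X // mulrN.
have EH : skewing (fun a' => pd c (fun y => W (but j) y b a' * nabla_tensor G sigma (a' (rs j)) y (take_ix a')) x) a +
   (skewing (conn_act c (bottom_slot j x b)) a
    - skewing (fun a' => \sum_(i | i != j) \sum_d Gam d c (b i) x *
      (W (but j) x (upd_ix b i d) a' * nabla_tensor G sigma (a' (rs j)) x (take_ix a'))) a) =
   skewing (fun a' => W (but j) x b a' * H c (a' (rs j)) x (take_ix a')) a.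
  rewrite -skewingB -skewingD; apply: eq_skewing => a'.
  rewrite (@pd_sharp_mprod (but j) c b (fun y a' => nabla_tensor G sigma (a' (rs j)) y (take_ix a')) a') //; last first.
    move=> i D ij; rewrite take_updr upd_other // (inj_eq (@rshift_inj _ _)) eq_sym //.
  congr (_ * _); rewrite /nabla2 sharpE -addrA -opprD; congr (_ - _).
  rewrite addrC (big_pred1 j) => [|i]; last by rewrite negbK.
  congr (_ + _).
    by apply: eq_bigr => D _; rewrite take_updr upd_same.
  by apply: eq_bigr => i _; apply: eq_bigr => D _; rewrite take_updl upd_other ?ffunE // eq_sym eq_lrshift.
have EP : \sum_d schouten_up G d c x * T x a (zword (upd_ix b j d)) =
   k.+1%:R * skewing (fun a' => W (but j) x b a' * (schouten G c (a' (rs j)) x * sigma x (take_ix a'))) a.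
  under eq_bigr => d _ do rewrite underline_Z // mulrCA -skewingZ.
  rewrite -mulr_sumr -skewing_sum; congr (_ * _); apply: eq_skewing => a'.
  under eq_bigr => d _ do rewrite (@mprod_updbD1 _ _ _ _ _ xpredT) // -[_ * _ * sigma _ _]mulrA mulrA.
  rewrite -mulr_suml (_ : \sum_d _ = schouten G c (a' (rs j)) x); first exact: mulrCA.
  under eq_bigr => d _ do rewrite mulr_suml.
  rewrite exchange_big /= -(sum_delta (fun d => schouten G c d x)); apply: eq_bigr => d _.
  under eq_bigr => D _ do rewrite mulrAC (ginv_sym (Gsym Ox)).
  by rewrite -mulr_suml (ginvl (Gunit Ox)) eq_sym.
have EW e d : weyl_act c e (fun a' => T x a' (zword (upd_ix b j d))) a +
    weyl_act c e (fun b' => T x a (zword b')) (upd_ix b j d) =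
   k.+1%:R * skewing (fun a' => G x d (a' (rs j)) * (W (but j) x b a' *
       weyl_act c e (sigma x) (take_ix a'))) a.
  have -> : (fun a' => T x a' (zword (upd_ix b j d))) =
    (fun a' => k.+1%:R * skewing (top_slot x (upd_ix b j d)) a').
    by apply/funext => a'; rewrite underline_Z.
  have -> : (fun b' => T x a (zword b')) =
    (fun b' => k.+1%:R * skewing (top_slot x b') a).
    by apply/funext => b'; rewrite underline_Z.
  rewrite [X in X + _]sharpZ [X in _ + X]sharpZ -mulrDr; congr (_ * _).
  have -> : weyl_act c e (fun a' => skewing (top_slot x (upd_ix b j d)) a') a =
    skewing (weyl_act c e (top_slot x (upd_ix b j d))) a.
    exact: sharp_skewing.
  rewrite [X in _ + X]sharpE.
  rewrite (sharp_skew_b xpredT (fun f g => weyl_up G c e f g x) (upd_ix b j d) (fun b' => top_slot x b')).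
  rewrite -skewingB; apply: eq_skewing => a'.
  rewrite (@sharp_mprod _ _ _ _ _ xpredT (fun f g => weyl_up G c e f g x) x (upd_ix b j d) (fun a' => sigma x (take_ix a'))); last first.
    by move=> i D _; rewrite take_updr.
  rewrite weyl_mprod0 oppr0 mul0r sub0r big_pred0_eq addr0 (@mprod_updbD1 _ _ _ _ _ xpredT) //.
  rewrite -mulrN -mulrA sharpE; congr (_ * (_ * - _)).
  by apply: eq_bigr => i _; apply: eq_bigr => D _; rewrite take_updl ffunE.
have EWW : \sum_d \sum_e ginv G x d e *
   (weyl_act c e (fun a' => T x a' (zword (upd_ix b j d))) a +
    weyl_act c e (fun b' => T x a (zword b')) (upd_ix b j d)) =
   k.+1%:R * skewing (fun a' => W (but j) x b a' *
       weyl_act c (a' (rs j)) (sigma x) (take_ix a')) a.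
  transitivity (contr G x (fun e d => k.+1%:R * skewing (fun a' => G x (a' (rs j)) d * (W (but j) x b a' *
       weyl_act c e (sigma x) (take_ix a'))) a)).
    rewrite (contr_sym (Gsym Ox)); apply: eq_bigr => d _; apply: eq_bigr => e _; rewrite EW.
    by congr (_ * (_ * _)); apply: eq_skewing => a'; rewrite (Gsym Ox).
  rewrite contrZ; congr (_ * _).
  transitivity (skewing (fun a' => contr G x (fun e d => G x (a' (rs j)) d * (W (but j) x b a' *
       weyl_act c e (sigma x) (take_ix a')))) a).
    rewrite /contr skewing_sum; apply: eq_bigr => e _; rewrite skewing_sum; apply: eq_bigr => d _.
    by rewrite skewingZ.
  by apply: eq_skewing => a'; rewrite (contr_metric (Gsym Ox) (Gunit Ox)).
rewrite EP EWW /differential_defect wskewB wskewD !wskewZ.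
have -> : wskew (W (but j) x b) (fun e => H c (e (rs j)) x (pull_ix ls e)) a =
   skewing (fun a' => W (but j) x b a' * H c (a' (rs j)) x (take_ix a')) a by [].
have -> : wskew (W (but j) x b) (fun e => schouten G c (e (rs j)) x * sigma x (pull_ix ls e)) a =
   skewing (fun a' => W (but j) x b a' * (schouten G c (a' (rs j)) x * sigma x (take_ix a'))) a by [].
have -> : wskew (W (but j) x b) (fun e => weyl_act c (e (rs j)) (sigma x) (pull_ix ls e)) a =
   skewing (fun a' => W (but j) x b a' * weyl_act c (a' (rs j)) (sigma x) (take_ix a')) a by [].
rewrite -EH.
have arith (s1 s2 s3 s4 s5 : R) : - s1 - s2 - - s3 - k.+1%:R * s4 + 2 / k%:R / 2 * (k.+1%:R * s5) =
   - (s1 + (s2 - s3) + k.+1%:R * s4 - k.+1%:R / k%:R * s5).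
  have -> : 2 / k%:R / 2 = k%:R^-1 :> R by rewrite mulrAC mulfV ?mul1r ?pnatr_eq0.
  ring.
exact: arith.
Qed.

(** In the formula of cartan_projE for K the trace terms stay traces after
    multiplication by metric factors. The skew part of S, together with the
    X-components of the extension, makes up the skew-symmetrisation of the
    product over c and all tensor indices, which the projection kills. *)
Lemma cartan_proj_underline_Z r c a b :
  cartan_proj G x (fun c a => nabla_x G r T c x a (zword b)) c a =
  k.+1%:R * cartan_proj G x (fun c => skewing (fun a => W xpredT x b a * K x c (take_ix a))) c a.
Proof.
pose f d := skewing (fun a' => W xpredT x b a' * nabla_tensor G sigma d x (take_ix a')).
pose t i (a' : {ffun 'I_(k + l) -> 'I_n}) := k.+1%:R / (n - k + 1)%:R * (W xpredT x b a' * mtrace G x (S x) (take_ix a') i).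
have mn := ltnW kln.
transitivity (cartan_proj G x (fun c a =>
    k.+1%:R * skewing (fun a => W xpredT x b a * K x c (take_ix a)) a
    + (f c a - \sum_j f (a j) (upd_ix a j c)
      + \sum_i skewing (fun a' => G x c (a' (ls i)) * t i a') a)) c a).
  apply: eq_cartan_proj => d a'; rewrite underline_nabla_Z /f.
  rewrite (skewing_insert (fun e a' => W xpredT x b a' * nabla_tensor G sigma e x (take_ix a'))) -skewing_sum -skewingZ.
  rewrite -skewingB -!skewingD; apply: eq_skewing => u.
  rewrite cartan_projE // big_split_ord /=.
  have e1 : \sum_i W xpredT x b (upd_ix u (ls i) d) * nabla_tensor G sigma (u (ls i)) x (take_ix (upd_ix u (ls i) d)) =
     W xpredT x b u * \sum_i nabla_tensor G sigma (take_ix u i) x (upd_ix (take_ix u) i d).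
    by rewrite mulr_sumr; apply: eq_bigr => i _; rewrite mprod_updl take_updl ffunE.
  have e2 : \sum_j W xpredT x b (upd_ix u (rs j) d) * nabla_tensor G sigma (u (rs j)) x (take_ix (upd_ix u (rs j) d)) =
     \sum_j G x d (b j) * (W (but j) x b u * nabla_tensor G sigma (u (rs j)) x (take_ix u)).
    by apply: eq_bigr => j _; rewrite (@mprod_updrD1 _ _ _ _ _ xpredT) // take_updr (Gsym Ox) mulrA.
  have e3 : \sum_i G x d (u (ls i)) * t i u = k.+1%:R / (n - k + 1)%:R * (W xpredT x b u *
     \sum_i G x d (take_ix u i) * mtrace G x (S x) (take_ix u) i).
    by rewrite !mulr_sumr; apply: eq_bigr => i _; rewrite /t ffunE mulrCA [G x _ _ * (_ * _)]mulrCA.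
  rewrite e1 e2 e3.
  have arith (r1 r2 w s s1 s2 s3 : R) : r1 != 0 ->
    r1 * (w * s) - s2 = r1 * (w * (s - r1^-1 * (s - s1) - r2 * s3)) + (w * s - (w * s1 + s2) + r1 * r2 * (w * s3)).
    by move=> r10; field.
  by apply: arith; rewrite pnatr_eq0.
rewrite cartan_projD cartan_projD cartan_projZ (cartan_proj_skew_diff (Gsym Ox)) ?add0r; last first.
  by move=> d; apply: alt_skewing.
rewrite cartan_proj_sum big1 ?addr0 // => i _.
apply: (cartan_proj_skewing_metric (Gsym Ox) (Gunit Ox)) => // u y.
rewrite /t mprod_updl take_updl; congr (_ * (_ * _)); exact: mtrace_indep.
Qed.

End AtAPoint.

(** In the components without second derivatives c sits in a metric factor tied
    to a tensor index, so these are pure traces. *)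
Lemma killing_underline : (0 < k)%N -> (forall y, O y -> forall c u, K y c u = 0) ->
  forall y, O y -> forall c a B,
    cartan_proj G y (fun c a => nabla_x G (2 / k%:R) T c y a B) c a = 0.
Proof.
move=> k0 ckf y Oy c a B; have mn := ltnW kln.
apply: (cartan_proj_nabla_x oO Oy) => //.
- by move=> y' a' B' i _; apply: underline_Y.
- by move=> y' a' _; apply: underline_alt.
- by move=> a' B'; apply: underline_der.
- move=> b c' a'; rewrite cartan_proj_underline_Z //.
  rewrite (@eq_cartan_proj _ _ G y _ _ (fun _ _ => 0)) ?cartan_proj0 ?mulr0 // => d a1.
  by rewrite -[RHS](skewing0 a1); apply: eq_skewing => a2; rewrite ckf // mulr0.
- move=> b j c' a'.
  rewrite (@eq_cartan_proj _ _ G y _ _ (fun c a => -1 * differential_defect G sigma y ls (rs j) (W (but j) y b) c a)); last first.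
    by move=> d a1; rewrite underline_nabla_X // mulN1r.
  rewrite cartan_projZ (cartan_proj_differential_defect oO Gsym Gunit Gsmooth salt ssmooth ckf Oy) ?mulr0 //.
  + exact: lshift_inj.
  + by move=> i; rewrite eq_lrshift.
  + by move=> i b' y'; apply: mprod_updl.
  + by move=> b' y'; apply: mprod_updr; rewrite negbK.
- move=> b j c' a'.
  rewrite (@eq_cartan_proj _ _ G y _ _ (fun c a => k.+1%:R *
      skewing (fun a => G y c (a (rs j)) * (W (but j) y b a * sigma y (take_ix a))) a)); last first.
    move=> d a1; rewrite underline_Z //; congr (_ * _); apply: eq_skewing => a2.
    by rewrite (@mprod_updbD1 _ _ _ _ _ xpredT) // mulrA.
  rewrite cartan_projZ (@cartan_proj_skewing_metric _ _ G y (Gsym Oy) (Gunit Oy) _ (rs j)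
     (fun a => W (but j) y b a * sigma y (take_ix a))) ?mulr0 // => u z.
  by rewrite mprod_updr ?negbK // take_updr.
- move=> b i j c' a' ij; have ji : j != i by rewrite eq_sym.
  rewrite (@eq_cartan_proj _ _ G y _ _ (fun c a => -1 *
      skewing (fun a => G y c (a (rs j)) * (W (fun i' => (i' != i) && (i' != j)) y b a *
         nabla_tensor G sigma (a (rs i)) y (take_ix a))) a)); last first.
    move=> d a1; rewrite underline_X // mulN1r; congr (- _); apply: eq_skewing => a2.
    by rewrite (@mprod_updbD1 _ _ _ _ _ (but i)) // mulrA.
  rewrite cartan_projZ (@cartan_proj_skewing_metric _ _ G y (Gsym Oy) (Gunit Oy) _ (rs j)
     (fun a => W (fun i' => (i' != i) && (i' != j)) y b a * nabla_tensor G sigma (a (rs i)) y (take_ix a))) ?mulr0 // => u z.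
  rewrite mprod_updr ?eqxx ?andbF // take_updr upd_other // (inj_eq (@rshift_inj _ _)) //.
Qed.

Lemma underline_killing :
  (forall y, O y -> forall c a B, cartan_proj G y
     (fun c a => nabla_x G (2 / k%:R) T c y a B) c a = 0) ->
  forall y, O y -> forall c u, K y c u = 0.
Proof.
move=> tk y Oy; have Sa d := alt_derivative G oO salt ssmooth d Oy.
have kn : (k <= n)%N by rewrite ltnW // (leq_ltn_trans _ kln) // leq_addr.
apply: (exterior_eq0 (Gsym Oy) (Gunit Oy) kln).
- exact: alt_cartan_proj.
- by move=> c u; apply: (cartan_proj_unskew (Gsym Oy) Sa).
- by move=> u j; apply: (mtrace_cartan_proj (Gsym Oy) (Gunit Oy) Sa kn).
- move=> b c a; have := tk y Oy c a (zword b).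
  rewrite cartan_proj_underline_Z //.
  by move/eqP; rewrite mulf_eq0 pnatr_eq0 => /eqP.
Qed.

End Underline.

(** * Passage to charts *)

Section Charts.
Context {R : realType} {n : nat} {M : manifold R n}.
Variable g : metric M.
Implicit Types i : mchart M.

Lemma gram_sym i x : mimg i x -> forall a b, gram g i x a b = gram g i x b a.
Proof. by move=> ix a b; have /matrixP/(_ a b) := msym g ix; rewrite !mxE. Qed.

(** The signature condition makes the Gram matrix congruent to an invertible
    diagonal matrix. *)
Lemma gram_unit i x : mimg i x -> gram g i x \in unitmx.
Proof.
have [p _ sig] := msignature g; move=> /sig [P uP e].
have : P *m gram g i x *m P^T \in unitmx.
  rewrite e unitmxE det_diag unitfE; apply/prodf_neq0 => j _; rewrite mxE.
  by case: ifP; rewrite ?oppr_eq0 oner_eq0.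
by rewrite !unitmx_mul => /andP[/andP[]].
Qed.

Lemma gram_smooth i a b : smooth_on (mimg i) (fun x => gram g i x a b).
Proof.
rewrite (_ : (fun x => _) = (fun x => g i x (ix2 a b))); first exact: tsmooth.
by apply/funext => x; rewrite mxE.
Qed.

Lemma kform_alt k (s : kform M k) i x : mimg i x -> alternating (s i x).
Proof. by move=> ix j j' a jj; rewrite (fskew s a (tperm j j') ix) odd_tperm jj mulN1r. Qed.

Lemma overline_killing_iff k l (s : kform M k) : (0 < l < k)%N -> (k < n)%N ->
  conformal_killing g s <-> tractor_killing g (2 / (n - k)%:R) (overline_ext g l s).
Proof.
move=> /andP[l0 lk] kn; split=> h i.
  exact: (killing_overline (@mimg_open _ _ M i) (gram_sym (i := i)) (gram_unit (i := i)) (gram_smooth (i := i))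
            kn (kform_alt s (i := i)) (tsmooth s (i := i)) l0 lk (h i)).
exact: (overline_killing (@mimg_open _ _ M i) (gram_sym (i := i)) (gram_unit (i := i))
            kn (kform_alt s (i := i)) (tsmooth s (i := i)) l0 lk (h i)).
Qed.

Lemma underline_killing_iff k l (s : kform M k) : (0 < k)%N -> (0 < l)%N -> (k + l < n)%N ->
  conformal_killing g s <-> tractor_killing g (2 / k%:R) (underline_ext g l s).
Proof.
move=> k0 l0 kln; split=> h i.
  exact: (killing_underline (@mimg_open _ _ M i) (gram_sym (i := i)) (gram_unit (i := i)) (gram_smooth (i := i))
            (kform_alt s (i := i)) (tsmooth s (i := i)) l0 kln k0 (h i)).
exact: (underline_killing (@mimg_open _ _ M i) (gram_sym (i := i)) (gram_unit (i := i)) (gram_smooth (i := i))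
            (kform_alt s (i := i)) (tsmooth s (i := i)) l0 kln (h i)).
Qed.

End Charts.

Theorem theorem4p4 (R : realType) (n : nat) (M : manifold R n)
    (c : conformal_structure M) (k : nat)
    (sigma : weighted_form c k (k + 1)%:R) (g : metric M) :
  (3 <= n)%N -> (1 <= k <= n - 1)%N -> cclass c g ->
  (forall l : nat, (1 <= l <= k - 1)%N ->
     (conformal_killing g (sigma g) <->
      tractor_killing g (2 / (n - k)%:R) (overline_ext g l (sigma g)))) /\
  (forall l : nat, (1 <= l <= n - k - 1)%N ->
     (conformal_killing g (sigma g) <->
      tractor_killing g (2 / k%:R) (underline_ext g l (sigma g)))).
Proof.
move=> n3 /andP[k0 kn] _; have {}kn : (k < n)%N by rewrite (leq_ltn_trans kn) // subn1 ltn_predL (ltn_trans _ n3).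
split=> l /andP[l0 lm].
  apply: overline_killing_iff => //; rewrite l0 /=.
  by rewrite -(subnK k0) addn1 ltnS.
apply: underline_killing_iff => //.
by rewrite -ltn_subRL -(subnK (_ : 1 <= n - k)%N) ?subn_gt0 // addn1 ltnS.
Qed.
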